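(* Let $k\ge1$ and assume that $(X_n,x_n,T_n)\in\mathcal{M}^k_*$ ($n=1,2,\dots$) and $(Z,z,T)\in\mathcal{M}^k_*$ satisfy $d_{\mathcal{F}*}((X_n,x_n,T_n),(Z,z,T))\to0$ as $n\to\infty$. Then there exist $(Z',z',T')\in\mathcal{M}^k_*$ and isometric embeddings $\phi_n:X_n\hookrightarrow Z'$ such that $\phi_n(x_n)\to z'$ as $n\to\infty$ and $\phi_{n\#}T_n$ converges to $T'$ in the local flat topology. Moreover, $(Z',z',T')$ can be taken in such a way that there exists an isometric embedding $\phi:Z\hookrightarrow Z'$ satisfying $\phi(z)=z'$ and $\phi_\#T=T'$.
   Context: Metric spaces are nonempty; isometric embeddings are distance-preserving maps (not necessarily surjective). Let $X$ be a complete metric space. $B_r(A)$, $\bar B_r(A)$ denote the open and closed $r$-neighborhoods of a point or set $A$; $\operatorname{spt} f:=\overline{\{f\ne0\}}$. Function classes: $\mathrm{Lip}_{\mathrm{Loc}}(X)$ = functions $X\to\mathbb{R}$ that are Lipschitz on every bounded set; $\mathrm{Lip}_1(X)$ = 1-Lipschitz functions $X\to\mathbb{R}$; $\mathrm{Lip}_{\mathrm B}(X)$ = bounded Lipschitz functions $X\to\mathbb R$ with bounded support. $\mathcal{D}^k(X):=\mathrm{Lip}_{\mathrm B}(X)\times(\mathrm{Lip}_{\mathrm{Loc}}(X))^k$, with elements written $(f,\pi)=(f,\pi_1,\dots,\pi_k)$. Metric functional: a $k$-dimensional metric functional on $X$ ($k\ge0$) is a function $T:\mathcal{D}^k(X)\to\mathbb{R}$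 that is (i) multilinear; (ii) continuous: $T(f,\pi^j)\to T(f,\pi)$ whenever $\pi_i^j\to\pi_i$ pointwise for each $i$ with $\sup_j\mathrm{Lip}(\pi_i^j|_B)<\infty$ for each $i$ and each bounded $B\subset X$; (iii) local: $T(f,\pi)=0$ if some $\pi_i$ is constant on $\bar B_\delta(\operatorname{spt} f)$ for some $\delta>0$. Boundary ($k\ge1$): $(\partial T)(f,\pi_1,\dots,\pi_{k-1}):=T(\sigma,f,\pi_1,\dots,\pi_{k-1})$ for any $\sigma\in\mathrm{Lip}_{\mathrm B}(X)$ with $\sigma=1$ on $\bar B_\delta(\operatorname{spt} f)$ for some $\delta>0$ (independent of $\sigma$ by locality); it is a $(k-1)$-dimensional metric functional. Pushforward: if $\phi:X\to X'$ is Lipschitz on bounded sets and preimages of bounded sets are bounded, $(\phi_\#T)(f,\pi):=T(f\circ\phi,\pi_1\circ\phi,\dots,\pi_k\circ\phi)$. Mass: for open $O$, $\|T\|(O):=\sup\sum_{j=1}^N T(f^j,\pi^j)$ over all $N$ and $(f^j,\pi^j)\in\mathrm{Lip}_{\mathrm B}(X)\times(\mathrm{Lip}_1(X))^k$ with $\operatorname{spt} f^j\subset O$, $\sum_j|f^j|\le1$; for any $A\subset X$, $\|T\|(A):=\inf\{\|T\|(O):O\supset A\text{ open}\}$. $\mathbf{M}_{\mathrm{Loc},k}(X)$: the $k$-dimensional metric functionals $T$ such that for every bounded open $O$: $\|T\|(O)<\infty$, and for every $\epsilon>0$ there is a compact $K\subset O$ with $\|T\|(O\setminus K)<\epsilon$.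 Then $\|T\|$ is an outer measure for which Borel sets are measurable, and $T$ extends to $(f,\pi)$ with $f$ bounded Borel of bounded support by $T(f,\pi):=\lim_n T(f_n,\pi)$, where $f_n\in\mathrm{Lip}_{\mathrm B}(X)$ have supports in a fixed bounded neighborhood of $\operatorname{spt} f$ and $f_n\to f$ in $L^1(\|T\|)$ (the limit exists and is independent of choices). For a Borel set $A$, $(T\llcorner A)(f,\pi):=T(f\chi_A,\pi)$. Locally integer rectifiable currents: a compact $k$-rectifiable set is a finite union of images of compact subsets of $\mathbb{R}^k$ under Lipschitz maps into $X$. $\mathcal{I}_{\mathrm{Loc},k}(X)$ is the set of $T\in\mathbf{M}_{\mathrm{Loc},k}(X)$ such that (i) for every bounded open $O$ and $\epsilon>0$ there is a compact $k$-rectifiable set $K$ with $\|T\|(O\setminus K)<\epsilon$; (ii) for every bounded Borel $B\subset X$ and Lipschitz $\pi:X\to\mathbb{R}^k$ there is $\theta\in L^1(\mathbb{R}^k,\mathbb{Z})$ with $\pi_\#(T\llcorner B)=[\theta]$, where $(\pi_\#(T\llcorner B))(f,\tau):=T(\chi_B\,(f\circ\pi),\tau\circ\pi)$ and $[\theta](f,\tau_1,\dots,\tau_k):=\int_{\mathbb{R}^k}f\,\theta\,\det(\nabla\tau)\,d\mathcal{L}^k$ (for $k=0$, $\mathbb{R}^0$ is a point with counting measure). For $k\ge1$, the set of locally integral currents is $\mathbf{I}_{\mathrm{Loc},k}(X):=\{T\in\mathcal{I}_{\mathrm{Loc},k}(X):\partial T\in\mathcal{I}_{\mathrm{Loc},k-1}(X)\}$.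 Local flat topology: for $S_n,S\in\mathbf{I}_{\mathrm{Loc},k}(X)$, $S_n$ converges to $S$ in the local flat topology if for every bounded closed $B\subset X$ there exist $U_n\in\mathbf{I}_{\mathrm{Loc},k}(X)$, $V_n\in\mathbf{I}_{\mathrm{Loc},k+1}(X)$ with $S_n-S=U_n+\partial V_n$ and $(\|U_n\|+\|V_n\|)(B)\to0$ as $n\to\infty$. Pointed spaces: for $k\ge1$, $\mathcal{M}^k_*$ is the collection of $k$-dimensional pointed locally integral current spaces, i.e. triples $(X,x,T)$ with $X$ a complete separable metric space, $x\in X$ and $T\in\mathbf{I}_{\mathrm{Loc},k}(X)$. Pointed intrinsic flat distance: $d_{\mathcal{F}*}:=\min\{\widetilde{d_{\mathcal{F}*}},\tfrac12\}$, where $\widetilde{d_{\mathcal{F}*}}((X_1,x_1,T_1),(X_2,x_2,T_2))$ is the infimum (with $\inf\emptyset=\infty$) of all $\epsilon>0$ for which there exist a complete metric space $Z$ and isometric embeddings $\phi_i:X_i\hookrightarrow Z$ ($i=1,2$) such that (i) $d_Z(\phi_1(x_1),\phi_2(x_2))<\epsilon$; (ii) for each $i=1,2$ there exist $U_i\in\mathbf{I}_{\mathrm{Loc},k}(Z)$ and $V_i\in\mathbf{I}_{\mathrm{Loc},k+1}(Z)$ with $\phi_{1\#}T_1-\phi_{2\#}T_2=U_i+\partial V_i$ and $(\|U_i\|+\|V_i\|)(\bar B_{1/\epsilon}(\phi_i(x_i)))<\epsilon$. *)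

(* Defs.v *)
From HB Require Import structures.
From mathcomp Require Import all_boot all_order all_algebra.
From mathcomp Require Import all_classical all_reals all_analysis.

Set Implicit Arguments.
Unset Strict Implicit.
Unset Printing Implicit Defensive.

Import Order.TTheory GRing.Theory Num.Theory.
Import numFieldNormedType.Exports.

Local Open Scope classical_set_scope.
Local Open Scope ring_scope.

(* Nonempty complete metric spaces: [Complete] bundles a point, hence
   nonemptiness.  No definition below depends on which point it is. *)
#[short(type="completeMetricType")]
HB.structure Definition CompleteMetric (K : numDomainType) :=
  { M of CompletePseudoMetric K M & PseudoMetric_isMetric K M }.

(* R^n is the space of row vectors with the sup norm.  Lipschitz maps, bounded
   sets and compact sets are the same as for the Euclidean norm, and only these
   notions are used on R^n. *)
Section row_vectors_metric.
Variables (R : realType) (m n : nat).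

Let mx_dist (x y : 'M[R]_(m, n)) : R := `|x - y|.

Let mx_dist_ge0 x y : 0 <= mx_dist x y.
Proof. exact: normr_ge0. Qed.

Let mx_dist_positivity x y : mx_dist x y = 0 -> x = y.
Proof. by move=> /normr0_eq0/eqP; rewrite subr_eq0 => /eqP. Qed.

Let mx_ballE x d : ball x d = [set y | mx_dist x y < d].
Proof. by rewrite -ball_normE. Qed.

HB.instance Definition _ := @PseudoMetric_isMetric.Build R 'M[R]_(m, n)
  mx_dist mx_dist_ge0 mx_dist_positivity mx_ballE.

End row_vectors_metric.

Section lebesgue_measure_on_row_vectors.
Variables (R : realType) (n : nat).
Local Notation V := 'rV[R]_n.

(* [None] is the empty box: for n = 0 it is the only box of volume 0, the
   other one being the whole of R^0, of volume 1. *)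
Definition box (c : option (V * V)) : set V :=
  if c is Some (a, b) then [set x | forall i, a 0 i <= x 0 i < b 0 i]
  else set0.

Definition box_volume (c : option (V * V)) : R :=
  if c is Some (a, b) then \prod_i Num.max 0 (b 0 i - a 0 i) else 0.

Definition lebesgue_outer (A : set V) : \bar R :=
  ereal_inf [set (\sum_(j <oo) (box_volume (F j))%:E)%E |
             F in [set F | A `<=` \bigcup_j box (F j)]].

Local Open Scope ereal_scope.

Let box_volume_ge0 c : 0 <= (box_volume c)%:E.
Proof.
rewrite lee_fin; case: c => [[a b]|//]; apply: prodr_ge0 => i _.
by rewrite le_max lexx.
Qed.

Let lebesgue_outer_ge0 A : 0 <= lebesgue_outer A.
Proof. by apply: le_ereal_inf_tmp => _ [F _ <-]; exact: nneseries_ge0. Qed.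

Let lebesgue_outer0 : lebesgue_outer set0 = 0.
Proof.
apply/eqP; rewrite eq_le lebesgue_outer_ge0 andbT.
apply: ereal_inf_lbound; exists (fun=> None) => //.
by rewrite eseries0.
Qed.

Let le_lebesgue_outer : {homo lebesgue_outer : A B / A `<=` B >-> A <= B}.
Proof.
move=> A B AB; apply: ereal_inf_le_tmp => _ [F BF <-].
by exists F => //; exact: subset_trans BF.
Qed.

Let lebesgue_outer_sigma_subadditive : sigma_subadditive lebesgue_outer.
Proof.
move=> A; have [[i ioo]|] := pselect (exists i, lebesgue_outer (A i) = +oo).
  by rewrite (eseries_pinfty _ _ ioo) ?leey// => j _; rewrite -ltNye
    (lt_le_trans _ (lebesgue_outer_ge0 _)).
rewrite -forallNE => Aoo.
suff add2e (e : {posnum R}) : lebesgue_outer (\bigcup_n A n) <=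
    \sum_(i <oo) lebesgue_outer (A i) + e%:num%:E.
  by apply/lee_addgt0Pr => _/posnumP[].
rewrite (le_trans _ (epsilon_trick _ _ _))//.
pose P k (B : nat -> option (V * V)) := A k `<=` \bigcup_j box (B j) /\
  \sum_(j <oo) (box_volume (B j))%:E <=
    lebesgue_outer (A k) + (e%:num / (2 ^ k.+1)%:R)%:E.
have [G PG] : {G : nat -> nat -> option (V * V) & forall k, P k (G k)}.
  apply: (@choice _ _ P) => k; rewrite /P.
  have Afin : lebesgue_outer (A k) \is a fin_num.
    by rewrite ge0_fin_numE// ltey; exact/eqP/Aoo.
  have e0 : (0 < e%:num / (2 ^ k.+1)%:R :> R)%R by [].
  have [_ [B AB <-] /ltW BA] := lb_ereal_inf_adherent e0 Afin.
  by exists B.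
pose vol (ij : nat * nat) := (box_volume (G ij.1 ij.2))%:E.
have vol_ge0 ij : 0 <= vol ij by exact: box_volume_ge0.
apply: (@le_trans _ _ (\esum_(ij in setT) vol ij)).
  apply: ereal_inf_lbound => /=.
  have /card_esym/ppcard_eqP[f] := card_nat2.
  exists (fun j => G (f j).1 (f j).2).
    move=> t [i _ /(PG i).1[j _ Gijt]].
    by exists (f^-1%FUN (i, j)) => //=; rewrite invK ?inE.
  rewrite -(esum_pred_image vol _ xpredT) ?[fun=> _]set_true//.
  by rewrite image_eq.
rewrite (_ : esum _ _ = \sum_(i <oo) \sum_(j <oo) vol (i, j)); last first.
  pose J : nat -> set (nat * nat) := fun i => [set (i, j) | j in setT].
  rewrite (_ : setT = \bigcup_k J k); last first.
    by rewrite predeqE => -[a b]; split => // _; exists a => //; exists b.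
  rewrite esum_bigcupT //=; last first.
    apply/trivIsetP => i j _ _ ij.
    rewrite predeqE => -[n0 m] /=; split => //= -[] [_] _ [<-{n0} _].
    by move=> [m' _] [] /esym/eqP; rewrite (negbTE ij).
  rewrite -(image_id [set: nat]) -fun_true esum_pred_image//; last first.
    by move=> k _; exact: esum_ge0.
  apply: eq_eseriesr => /= j _.
  rewrite -(esum_pred_image vol (pair j) predT)//=; last first.
    by move=> ? ? _ _; exact: (@can_inj _ _ _ snd).
  by congr esum; rewrite predeqE => -[a b]; split; move=> [i _ <-]; exists i.
apply: lee_nneseries => [k _ _|k _]; first exact: nneseries_ge0.
exact: (PG k).2.
Qed.

HB.instance Definition _ := isOuterMeasure.Build R V lebesgue_outer
  lebesgue_outer0 lebesgue_outer_ge0 le_lebesgue_outer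
  lebesgue_outer_sigma_subadditive.

Definition lebesgue_outer_measure : {outer_measure set V -> \bar R} :=
  lebesgue_outer.

(* Lebesgue measure on the Lebesgue (Caratheodory) measurable sets of R^n; for
   n = 0, the counting measure on a point. *)
Definition lebesgue_rV :
    {measure set (caratheodory_type lebesgue_outer_measure) -> \bar R} :=
  lebesgue_outer_measure.

End lebesgue_measure_on_row_vectors.

Section metric_notions.
Variables (R : realType) (X Y : metricType R).

Definition mbounded (A : set X) : Prop :=
  exists M : R, forall x y, A x -> A y -> mdist x y <= M.

Definition klip_on (L : R) (A : set X) (f : X -> Y) : Prop :=
  forall x y, A x -> A y -> mdist (f x) (f y) <= L * mdist x y.

Definition lip_on (A : set X) (f : X -> Y) : Prop := exists L, klip_on L A f.

Definition isometric_embedding (phi : X -> Y) : Prop :=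
  forall x y, mdist (phi x) (phi y) = mdist x y.

(* The points at distance at most r from A; empty when A is. *)
Definition closed_nbhd (r : R) (A : set X) : set X :=
  [set x | (edist_inf A x <= r%:E)%E].

Definition separable : Prop := exists2 D : set X, countable D & dense D.

End metric_notions.

Section test_forms.
Variables (R : realType) (X : metricType R).

Definition spt (f : X -> R) : set X := closure [set x | f x != 0].

Definition LipLoc (f : X -> R) : Prop :=
  forall B : set X, mbounded B -> lip_on (Y := R^o) B f.

Definition Lip1 (f : X -> R) : Prop := klip_on (Y := R^o) 1 setT f.

Definition LipB (f : X -> R) : Prop :=
  [/\ lip_on (Y := R^o) setT f, exists M, forall x, `|f x| <= M
    & mbounded (spt f)].

(* Membership of (f, pi) in D^k(X). *)
Definition test_form (k : nat) (f : X -> R) (pi : 'I_k -> X -> R) : Prop :=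
  LipB f /\ forall i, LipLoc (pi i).

(* Functions on D^k(X) are represented by functions of arbitrary (f, pi), whose
   values off D^k(X) are irrelevant: no notion below depends on them, and
   equality of functionals is always meant on D^k(X). *)
Definition functional (k : nat) : Type := (X -> R) -> ('I_k -> X -> R) -> R.

Definition eq_functional (k : nat) (S T : functional k) : Prop :=
  forall f pi, test_form f pi -> S f pi = T f pi.

Definition set_coord (k : nat) (pi : 'I_k -> X -> R) (i : 'I_k) (u : X -> R) :
    'I_k -> X -> R :=
  fun j => if j == i then u else pi j.

Definition fun_multilinear (k : nat) (T : functional k) : Prop :=
  [/\ forall a f g pi, test_form f pi -> LipB g ->
        T (fun x => a * f x + g x) pi = a * T f pi + T g pi &
      forall a f pi i u v, test_form f pi -> LipLoc u -> LipLoc v ->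
        T f (set_coord pi i (fun x => a * u x + v x)) =
        a * T f (set_coord pi i u) + T f (set_coord pi i v)].

Definition fun_continuous (k : nat) (T : functional k) : Prop :=
  forall f pi (pi_ : nat -> 'I_k -> X -> R),
    test_form f pi -> (forall j, test_form f (pi_ j)) ->
    (forall i x, pi_ j i x @[j --> \oo] --> pi i x) ->
    (forall i (B : set X), mbounded B ->
       exists L, forall j, klip_on (Y := R^o) L B (pi_ j i)) ->
    T f (pi_ j) @[j --> \oo] --> T f pi.

Definition fun_local (k : nat) (T : functional k) : Prop :=
  forall f pi, test_form f pi ->
    (exists i d c, 0 < d /\ forall x, closed_nbhd d (spt f) x -> pi i x = c) ->
    T f pi = 0.

Definition metric_functional (k : nat) (T : functional k) : Prop :=
  [/\ fun_multilinear T, fun_continuous T & fun_local T].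

Definition cutoff (f s : X -> R) : Prop :=
  LipB s /\ exists2 d, 0 < d & forall x, closed_nbhd d (spt f) x -> s x = 1.

(* (boundary T)(f, pi) = T(s, f, pi) for a chosen cutoff function s of f; by
   locality the choice does not matter. *)
Definition boundary (k : nat) (T : functional k.+1) : functional k :=
  fun f pi => T (xget (cst 0) (cutoff f))
    (fun i => if unlift ord0 i is Some j then pi j else f).

Local Open Scope ereal_scope.

Definition mass_open (k : nat) (T : functional k) (O : set X) : \bar R :=
  ereal_sup [set s | exists (N : nat) (f : 'I_N -> X -> R)
                            (pi : 'I_N -> 'I_k -> X -> R),
    [/\ forall j, LipB (f j) /\ forall i, Lip1 (pi j i),
        forall j, spt (f j) `<=` O,
        forall x, (\sum_j `|f j x| <= 1)%R &
        s = (\sum_j T (f j) (pi j))%:E]].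

Definition mass (k : nat) (T : functional k) (A : set X) : \bar R :=
  ereal_inf [set mass_open T O | O in [set O | open O /\ A `<=` O]].

Definition MLoc (k : nat) (T : functional k) : Prop :=
  [/\ metric_functional T,
      forall O, open O -> mbounded O -> mass T O < +oo &
      forall O e, open O -> mbounded O -> (0 < e)%R ->
        exists2 K, compact K /\ K `<=` O & mass T (O `\` K) < e%:E].

End test_forms.

Section pushforward.
Variables (R : realType) (X Y : metricType R).

Definition push_functional (phi : X -> Y) (k : nat) (T : functional X k) :
    functional Y k :=
  fun f pi => T (f \o phi) (fun i => pi i \o phi).

End pushforward.

Section borel_extension.
Variables (R : realType) (X : completeMetricType R) (k : nat).

Local Notation borelType := (g_sigma_algebraType (@open X)).

Definition borel (A : set X) : Prop := measurable (A : set borelType).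

(* u_n -> f in L^1(||T||), with supports in a fixed bounded neighborhood of the
   support of f.  The integral is that of the set function [mass T], whose
   restriction to the Borel sets is a measure when T is in M_Loc. *)
Definition ext_approx (T : functional X k) (f : X -> R)
    (u : nat -> X -> R) : Prop :=
  [/\ forall n, LipB (u n),
      exists N : set X, [/\ mbounded N, spt f `<=` interior N &
                            forall n, spt (u n) `<=` N] &
      (\int[mass T : set borelType -> \bar R]_x `|u n x - f x|%:E)%E
        @[n --> \oo] --> 0%E].

(* Extension of T to bounded Borel f of bounded support. *)
Definition borel_ext (T : functional X k) : functional X k :=
  fun f pi => xget 0 [set l : R | exists2 u, ext_approx T f u &
                                   T (u n) pi @[n --> \oo] --> l].

(* pi_#(T |_ B) for a map p : X -> R^m *)
Definition push_restr (m : nat) (p : X -> 'rV[R]_m) (T : functional X k)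
    (B : set X) : functional 'rV[R]_m k :=
  fun f tau => borel_ext T (fun x => \1_B x * f (p x)) (fun i => tau i \o p).

End borel_extension.

Section rectifiable_currents.
Variable R : realType.

(* Partial derivatives of a locally Lipschitz tau exist almost everywhere. *)
Definition gradient (k : nat) (tau : 'I_k -> 'rV[R]_k -> R)
    (x : 'rV[R]_k) : 'M[R]_k :=
  \matrix_(i, j) 'D_(delta_mx 0 j) (tau i : 'rV[R]_k -> R^o) x.

Definition euclidean_current (k : nat) (theta : 'rV[R]_k -> int) :
    functional 'rV[R]_k k :=
  fun f tau => \int[lebesgue_rV R k]_x
    (f x * (theta x)%:~R * \det (gradient tau x)).

Definition L1_int (k : nat) (theta : 'rV[R]_k -> int) : Prop :=
  (lebesgue_rV R k).-integrable setT (fun x => ((theta x)%:~R : R)%:E).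

Definition compact_rectifiable (X : metricType R) (k : nat) (K : set X) : Prop :=
  exists (N : nat) (C : 'I_N -> set 'rV[R]_k) (g : 'I_N -> 'rV[R]_k -> X),
    (forall i, compact (C i) /\ lip_on (C i) (g i)) /\
    K = \bigcup_(i in [set: 'I_N]) (g i @` C i).

(* Locally integer rectifiable currents. *)
Definition IRLoc (X : completeMetricType R) (k : nat)
    (T : functional X k) : Prop :=
  [/\ MLoc T,
      forall (O : set X) e, open O -> mbounded O -> 0 < e ->
        exists2 K, compact_rectifiable k K & (mass T (O `\` K) < e%:E)%E &
      forall (B : set X) (p : X -> 'rV[R]_k),
        borel B -> mbounded B -> lip_on setT p ->
        exists2 theta, L1_int theta &
          eq_functional (push_restr p T B) (euclidean_current theta)].

(* Locally integral currents; only k >= 1 is used. *)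
Definition ILoc (X : completeMetricType R) (k : nat) : functional X k -> Prop :=
  match k with
  | 0%N => fun T => IRLoc T
  | k'.+1 => fun T => IRLoc T /\ IRLoc (boundary T)
  end.

(* S - S' = U + boundary V with U, V locally integral. *)
Definition flat_decomposition (X : completeMetricType R) (k : nat)
    (S S' U : functional X k) (V : functional X k.+1) : Prop :=
  [/\ ILoc U, ILoc V &
      eq_functional (fun f pi => S f pi - S' f pi)
                    (fun f pi => U f pi + boundary V f pi)].

Definition local_flat_cvg (X : completeMetricType R) (k : nat)
    (S_ : nat -> functional X k) (S : functional X k) : Prop :=
  [/\ forall n, ILoc (S_ n), ILoc S &
      forall B : set X, closed B -> mbounded B ->
        exists (U : nat -> functional X k) (V : nat -> functional X k.+1),
          (forall n, flat_decomposition (S_ n) S (U n) (V n)) /\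
          (mass (U n) B + mass (V n) B)%E @[n --> \oo] --> 0%E].

End rectifiable_currents.

Record pointed_current_space (R : realType) (k : nat) := PointedCurrentSpace {
  pcs_space :> completeMetricType R;
  pcs_separable : separable pcs_space;
  pcs_base : pcs_space;
  pcs_current : functional pcs_space k;
  pcs_current_ILoc : ILoc pcs_current
}.
Arguments pcs_base {R k} p.
Arguments pcs_current {R k} p.

Section pointed_flat_distance.
Variables (R : realType) (k : nat).
Implicit Types P Q : pointed_current_space R k.

Definition flat_close P Q (e : R) : Prop :=
  0 < e /\
  exists (Z : completeMetricType R) (phi1 : P -> Z) (phi2 : Q -> Z),
    [/\ isometric_embedding phi1, isometric_embedding phi2,
        mdist (phi1 (pcs_base P)) (phi2 (pcs_base Q)) < e &
        forall c, c = phi1 (pcs_base P) \/ c = phi2 (pcs_base Q) ->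
          exists U V,
            flat_decomposition (push_functional phi1 (pcs_current P))
                               (push_functional phi2 (pcs_current Q)) U V /\
            (mass U (closed_nbhd e^-1 [set c]) +
             mass V (closed_nbhd e^-1 [set c]) < e%:E)%E].

Definition dF_tilde P Q : \bar R := ereal_inf [set e%:E | e in flat_close P Q].

Definition dF P Q : \bar R := Order.min (dF_tilde P Q) (2^-1)%:E.

End pointed_flat_distance.

(* Main.v *)
From HB Require Import structures.
Require Import Defs.
From mathcomp Require Import finmap.
From mathcomp Require Import all_boot all_order all_algebra.
From mathcomp Require Import all_classical all_reals all_analysis.
From mathcomp Require Import ring lra perm measurable_realfun.
Import Order.TTheory GRing.Theory Num.Theory.
Import numFieldNormedType.Exports.

(** A small distance between [X n] and [Z] is realized in an ambient space that
    depends on [n] and need not be separable.  The common space is obtained by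
    making each of these ambient spaces separable and gluing all of them along
    [Z]; its base point and current are those of [Z].

    Separability.  Membership in [MLoc] makes the mass tight on bounded open
    sets, so that it is carried by the closure of a separable set
    ([MLoc_separable_carrier]).  Hence there is a closed separable subspace [Y] of the ambient space that contains both spaces
    and carries the masses of the filling currents [U], [V] and of their
    boundaries, and these currents can be restricted to [Y] ([restr]): a form on
    [Y] is extended to the ambient space and evaluated there.  The result does
    not depend on the extension because of strong locality ([mf_strong_local]):
    if every [pi i] is [L]-Lipschitz near the support of [f], then the absolute
    value of [T f pi] is at most [L ^+ k] times the integral of the absolute value
    of [f], with respect to the mass, over the set where a given coordinate
    [pi i] is nonzero.  Restriction keeps currents locally integral, does not
    increase mass and commutes with the boundary ([ILoc_restr], [mass_restr],
    [boundary_restr]).  The only delicate point is the continuity of the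
    restricted functional, since coordinates that converge on [Y] have extensions
    that need not converge off [Y]; tightness settles it
    ([restr_continuous]).  The outcome is [flat_bridge].

    Gluing.  Where the capped distance equals 1/2, which happens finitely
    often, there may be no filling at all.  For such indices any space containing
    isometric copies of [X n] and [Z] will do, with the difference of the two currents as [U] and with
    [V] zero: a difference of locally integral currents is locally integral
    ([ILocB]).  The analytic input here is that the current of an integrable
    function on [R^k] is additive in the function, which requires the partial
    derivatives of locally Lipschitz functions to be measurable
    ([measurable_derive]).  The amalgam of the spaces [Y n] along [Z] is complete
    and separable ([gluing_exists]).  Pushing forward along isometric embeddings
    keeps currents locally integral, commutes with the boundary and does not
    increase mass ([ILoc_push], [boundary_push], [mass_push]).  A bounded set [B]
    lies in a ball around the base point; for large [n] its trace on [Y n] lies in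
    the ball on which the distance controls [U] and [V], whose masses on [B] thus
    tend to 0.

    Integrality is phrased through the extension of a functional to bounded Borel
    functions, and must be transported along embeddings and differences.  This
    rests on approximating a Borel set from outside by an open set, so that the
    approximants differ from their limit on sets of vanishing mass only
    ([approx_exists]); it presupposes that the mass is a Borel measure
    ([borel_caratheodory]) and dominates the functional in the mean
    ([mf_le_integral]). *)

Set Implicit Arguments.
Unset Strict Implicit.
Unset Printing Implicit Defensive.

Local Open Scope classical_set_scope.
Local Open Scope ring_scope.

(** * Bounded sets and neighbourhoods *)

Lemma natSinv_lt (R : realType) (e : R) : 0 < e ->
  exists N, forall n, (N <= n)%N -> n.+1%:R^-1 < e.
Proof.
move=> e0; have [N _ hN] := near_infty_natSinv_lt (PosNum e0).
by exists N => n; exact: hN.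
Qed.

Section bounded_sets.
Variables (R : realType) (X : metricType R).
Implicit Types (A B : set X) (x y : X).

Lemma mdistRE (a b : R) : mdist (a : R^o) b = `|a - b|.
Proof. by rewrite /mdist/= distrC. Qed.

Lemma dist_mdist x y z : `|mdist x z - mdist y z| <= mdist x y.
Proof.
rewrite ler_norml; have := metric_triangle x y z; have := metric_triangle y x z.
by rewrite (metric_sym y x) => h1 h2; apply/andP; split; lra.
Qed.

Lemma mboundedS A B : A `<=` B -> mbounded B -> mbounded A.
Proof. by move=> AB [M h]; exists M => x y /AB Bx /AB By; exact: h. Qed.

Lemma mboundedP x0 A : mbounded A <-> exists r, forall x, A x -> mdist x0 x <= r.
Proof.
split=> [[M h]|[r h]].
  have [[y Ay]|nA] := pselect (exists y, A y).
    exists (mdist x0 y + M) => x Ax.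
    by rewrite (le_trans (metric_triangle _ y _))// lerD2l h.
  by exists 0 => x Ax; case: nA; exists x.
exists (r + r) => x y Ax Ay; rewrite (le_trans (metric_triangle _ x0 _))//.
by rewrite lerD// ?h// metric_sym h.
Qed.

Lemma mbounded_ball x0 r : mbounded (ball x0 r).
Proof.
by apply/(mboundedP x0); exists r => x; rewrite ballEmdist /= => /ltW.
Qed.

Lemma mboundedU A B : mbounded A -> mbounded B -> mbounded (A `|` B).
Proof.
have [[x0 _]|h _ _] := pselect (exists x0 : X, True); last first.
  by exists 0 => x; case: h; exists x.
move=> /(mboundedP x0)[r hr] /(mboundedP x0)[s hs].
by apply/(mboundedP x0); exists (Num.max r s) => x [/hr|/hs] h;
  rewrite le_max h ?orbT.
Qed.

Lemma closure_mdist A x e : 0 < e -> closure A x -> exists2 y, A y & mdist x y < e.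
Proof.
move=> e0 /(_ (ball x e) (nbhsx_ballx _ _ e0)) [y []].
by rewrite ballEmdist; exists y.
Qed.

Lemma closed_nbhd_mdist r A x y : 0 < r -> A y -> mdist x y <= r ->
  closed_nbhd r A x.
Proof.
move=> r0 Ay xy; rewrite /closed_nbhd/=.
apply: (@le_trans _ _ (edist (x, y))).
  by apply: ereal_inf_lbound; exists y.
apply/lee_addgt0Pr => e e0; rewrite -EFinD; apply: edist_fin => /=.
  by rewrite addr_gt0.
by rewrite ballEmdist /= (le_lt_trans xy)// ltrDl.
Qed.

Lemma closed_nbhd_lt r s A x : r < s -> closed_nbhd r A x ->
  exists2 y, A y & mdist x y < s.
Proof.
rewrite /closed_nbhd/= => rs h.
have : (edist_inf A x < s%:E)%E by rewrite (le_lt_trans h)// lte_fin.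
move=> /ereal_inf_lt[_ [y Ay <-] /edist_lt_ball/=].
by rewrite ballEmdist; exists y.
Qed.

Lemma closed_nbhdS r A B : A `<=` B -> closed_nbhd r A `<=` closed_nbhd r B.
Proof.
move=> AB x; rewrite /closed_nbhd/=; apply: le_trans.
by apply: ereal_inf_le_tmp => _ [y /AB Ay <-]; exists y.
Qed.

Lemma closed_nbhd_le r s A : r <= s -> closed_nbhd r A `<=` closed_nbhd s A.
Proof. by move=> rs x; rewrite /closed_nbhd/= => /le_trans; apply; rewrite lee_fin. Qed.

Lemma sub_closed_nbhd r A : 0 < r -> A `<=` closed_nbhd r A.
Proof. by move=> r0 x Ax; apply: (closed_nbhd_mdist r0 Ax); rewrite mdistxx ltW. Qed.

Lemma mbounded_closed_nbhd r A : mbounded A -> mbounded (closed_nbhd r A).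
Proof.
have [[x0 _]|h _] := pselect (exists x0 : X, True); last first.
  by exists 0 => x; case: h; exists x.
move=> /(mboundedP x0)[M h]; apply/(mboundedP x0); exists (M + (r + 1)) => x.
move=> /(@closed_nbhd_lt _ (r + 1))[|y /h yM xy]; first by rewrite ltrDl.
by rewrite (le_trans (metric_triangle _ y _))// lerD// metric_sym ltW.
Qed.

Lemma mbounded_closure A : mbounded A -> mbounded (closure A).
Proof.
move=> /(mbounded_closed_nbhd 1); apply: mboundedS => x.
move=> /(closure_mdist ltr01)[y Ay xy].
by apply: (closed_nbhd_mdist ltr01 Ay); rewrite ltW.
Qed.

Lemma nbhs_mdistP x (P : set X) : nbhs x P <->
  exists2 e, 0 < e & forall y, mdist x y < e -> P y.
Proof.
rewrite -filter_from_ballE; split => -[e e0 h]; exists e => // y.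
  by move=> xy; apply: h; rewrite ballEmdist.
by rewrite ballEmdist; exact: h.
Qed.

Lemma openP A : open A <-> forall x, A x -> exists2 e, 0 < e & forall y, mdist x y < e -> A y.
Proof.
rewrite openE; split => h x Ax; first by apply/nbhs_mdistP/h.
by apply/nbhs_mdistP/h.
Qed.

Lemma open_mball x r : open [set y | mdist x y < r].
Proof.
apply/openP => y /= xy; exists (r - mdist x y); first by rewrite subr_gt0.
by move=> z yz; rewrite (le_lt_trans (metric_triangle _ y _))// -ltrBrDl.
Qed.

Lemma mbounded_open A : mbounded A ->
  exists O, [/\ open O, mbounded O & A `<=` O].
Proof.
have [[x0 _]|h _] := pselect (exists x0 : X, True); last first.
  exists setT; split => //; first exact: openT.
  by exists 0 => x; case: h; exists x.
move=> /(mboundedP x0)[r hr]; exists [set x | mdist x0 x < r + 1]; split.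
- exact: open_mball.
- by apply/(mboundedP x0); exists (r + 1) => x /ltW.
- by move=> x /hr /= h; rewrite (le_lt_trans h)// ltrDl.
Qed.

End bounded_sets.

(** * Locally Lipschitz functions *)

Section lipschitz.
Variables (R : realType) (X : metricType R).
Implicit Types (A B : set X) (x y : X) (f g : X -> R).

Lemma klipP L A f : klip_on (Y := R^o) L A f <->
  forall x y, A x -> A y -> `|f x - f y| <= L * mdist x y.
Proof.
by split=> h x y Ax Ay; have := h x y Ax Ay; rewrite mdistRE.
Qed.

Lemma klip_onW (Y : metricType R) L L' A B (f : X -> Y) :
  L <= L' -> B `<=` A -> klip_on L A f -> klip_on L' B f.
Proof.
move=> LL BA h x y /BA Ax /BA Ay; rewrite (le_trans (h _ _ Ax Ay))//.
by rewrite ler_wpM2r// mdist_ge0.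
Qed.

Lemma lip_on_gt0 (Y : metricType R) A (f : X -> Y) : lip_on A f ->
  exists2 L, 0 < L & klip_on L A f.
Proof.
move=> [L h]; exists (Num.max L 1); first by rewrite lt_max ltr01 orbT.
by apply: klip_onW h => //; rewrite le_max lexx.
Qed.

Lemma LipLoc_klip f B : LipLoc f -> mbounded B ->
  exists2 L, 0 < L & forall x y, B x -> B y -> `|f x - f y| <= L * mdist x y.
Proof. by move=> fl /fl/lip_on_gt0[L L0 /klipP h]; exists L. Qed.

Lemma LipLocP f : (forall B, mbounded B ->
  exists L, forall x y, B x -> B y -> `|f x - f y| <= L * mdist x y) -> LipLoc f.
Proof. by move=> h B /h[L hL]; exists L; apply/klipP. Qed.

Lemma LipLoc_bounded f B : LipLoc f -> mbounded B ->
  exists2 M, 0 < M & forall x, B x -> `|f x| <= M.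
Proof.
move=> fl Bb; have [L L0 h] := LipLoc_klip fl Bb.
have [[x0 Bx0]|nB] := pselect (exists x, B x); last first.
  by exists 1 => // x Bx; case: nB; exists x.
have [M hM] := Bb; exists (`|f x0| + L * `|M| + 1).
  by rewrite ltr_wpDl// addr_ge0// mulr_ge0// ltW.
move=> x Bx; rewrite -[f x](subrK (f x0)) (le_trans (ler_normD _ _))//.
rewrite addrC -addrA lerD2l (le_trans (h _ _ Bx Bx0))//.
apply: (@le_trans _ _ (L * `|M|)); last by rewrite lerDl.
by apply: ler_wpM2l; [exact: ltW|exact: le_trans (hM _ _ Bx Bx0) (ler_norm _)].
Qed.

Lemma LipLoc_cst c : LipLoc (fun _ : X => c).
Proof.
by move=> B _; exists 0; apply/klipP => x y _ _; rewrite subrr normr0 mul0r.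
Qed.

Lemma LipLocD f g : LipLoc f -> LipLoc g -> LipLoc (fun x => f x + g x).
Proof.
move=> fl gl; apply: LipLocP => B Bb; have [L L0 hL] := LipLoc_klip fl Bb.
have [M M0 hM] := LipLoc_klip gl Bb; exists (L + M) => x y Bx By.
rewrite opprD addrACA (le_trans (ler_normD _ _))// mulrDl lerD//.
  exact: hL.
exact: hM.
Qed.

Lemma LipLocM f g : LipLoc f -> LipLoc g -> LipLoc (fun x => f x * g x).
Proof.
move=> fl gl; apply: LipLocP => B Bb; have [L L0 hL] := LipLoc_klip fl Bb.
have [M M0 hM] := LipLoc_klip gl Bb.
have [L' L'0 hL'] := LipLoc_bounded fl Bb.
have [M' M'0 hM'] := LipLoc_bounded gl Bb.
exists (L' * M + M' * L) => x y Bx By.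
have -> : f x * g x - f y * g y = f x * (g x - g y) + g y * (f x - f y) by ring.
rewrite (le_trans (ler_normD _ _))// mulrDl !normrM -!mulrA lerD//.
  by rewrite ler_pM// ?hL' ?hM.
by rewrite ler_pM// ?hM' ?hL.
Qed.

Lemma LipLoc_comp (h : R -> R) (K : R) f : 0 <= K ->
  (forall a b, `|h a - h b| <= K * `|a - b|) ->
  LipLoc f -> LipLoc (fun x => h (f x)).
Proof.
move=> K0 hK fl; apply: LipLocP => B Bb; have [L L0 hL] := LipLoc_klip fl Bb.
exists (K * L) => x y Bx By; rewrite (le_trans (hK _ _))// -mulrA.
by rewrite ler_wpM2l// hL.
Qed.

Lemma LipLocZ a f : LipLoc f -> LipLoc (fun x => a * f x).
Proof. by move=> fl; apply: LipLocM => //; exact: LipLoc_cst. Qed.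

Lemma LipLocN f : LipLoc f -> LipLoc (fun x => - f x).
Proof.
move=> fl; rewrite (_ : (fun x => _) = (fun x => -1 * f x)); first exact: LipLocZ.
by apply/funext => x; rewrite mulN1r.
Qed.

Lemma LipLocB f g : LipLoc f -> LipLoc g -> LipLoc (fun x => f x - g x).
Proof. by move=> fl gl; apply: LipLocD => //; exact: LipLocN. Qed.

Lemma LipLoc_sum (I : Type) (r : seq I) (P : pred I) (F : I -> X -> R) :
  (forall i, LipLoc (F i)) -> LipLoc (fun x => \sum_(i <- r | P i) F i x).
Proof.
move=> h; rewrite (_ : (fun x => _) = \sum_(i <- r | P i) F i); last first.
  by apply/funext => x; rewrite fct_sumE.
by apply: big_ind => //; [exact: LipLoc_cst|exact: LipLocD].
Qed.

Lemma LipLoc_norm f : LipLoc f -> LipLoc (fun x => `|f x|).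
Proof.
apply: (@LipLoc_comp Num.norm 1) => // a b.
by rewrite mul1r ler_dist_dist.
Qed.

Lemma LipLoc_max f g : LipLoc f -> LipLoc g ->
  LipLoc (fun x => Num.max (f x) (g x)).
Proof.
move=> fl gl; rewrite (_ : (fun x => _) =
    (fun x => 2^-1 * ((f x + g x) + `|f x - g x|))).
  by apply/LipLocZ/LipLocD; [exact: LipLocD|exact/LipLoc_norm/LipLocB].
by apply/funext => x; rewrite maxr_absE mulrC.
Qed.

Lemma LipLoc_min f g : LipLoc f -> LipLoc g ->
  LipLoc (fun x => Num.min (f x) (g x)).
Proof.
move=> fl gl; rewrite (_ : (fun x => _) =
    (fun x => 2^-1 * ((f x + g x) - `|f x - g x|))).
  by apply/LipLocZ/LipLocB; [exact: LipLocD|exact/LipLoc_norm/LipLocB].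
by apply/funext => x; rewrite minr_absE mulrC.
Qed.

Lemma LipLoc_lip f L : (forall x y, `|f x - f y| <= L * mdist x y) -> LipLoc f.
Proof. by move=> h; apply: LipLocP => B _; exists L. Qed.

Lemma Lip1_LipLoc f : Lip1 f -> LipLoc f.
Proof.
by move=> /klipP h; apply: (@LipLoc_lip _ 1) => x y; exact: h.
Qed.

Lemma LipLoc_mdist x0 : LipLoc (mdist x0).
Proof.
apply: (@LipLoc_lip _ 1) => x y.
by rewrite ![mdist x0 _]metric_sym mul1r dist_mdist.
Qed.

Lemma LipLoc_continuous f : LipLoc f -> continuous f.
Proof.
move=> fl x; have [L L0 h] := LipLoc_klip fl (mbounded_ball x 1).
apply/cvgrPdist_lt => e e0; near=> y.
have xy : mdist x y < Num.min 1 (e / L).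
  near: y; apply/nbhs_mdistP; exists (Num.min 1 (e / L)) => //.
  by rewrite lt_min ltr01 divr_gt0.
move: xy; rewrite lt_min => /andP[xy1 xye].
rewrite (le_lt_trans (h _ _ _ _))//; rewrite ?ballEmdist//= ?mdistxx//.
by rewrite mulrC -ltr_pdivlMr.
Unshelve. all: by end_near. Qed.

Lemma spt_nz f x : f x != 0 -> spt f x.
Proof. by move=> fx; exact: subset_closure. Qed.

Lemma spt_out f x : ~ spt f x -> f x = 0.
Proof. by move=> h; apply: contrapT => /eqP/spt_nz. Qed.

Lemma sptS f A : closed A -> (forall x, f x != 0 -> A x) -> spt f `<=` A.
Proof. by move=> Ac fA; rewrite (closure_id A).1 //; exact: closureS. Qed.

Lemma spt_sub f g : (forall x, g x = 0 -> f x = 0) -> spt f `<=` spt g.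
Proof.
move=> h; apply: closureS => x /=; apply: contra_neq; exact: h.
Qed.

Lemma closed_spt f : closed (spt f).
Proof. exact: closed_closure. Qed.

(** A locally Lipschitz function that vanishes off a bounded set is Lipschitz:
    far apart points are controlled by its supremum, close ones by its Lipschitz
    constant near the support. *)
Lemma LipBP f : LipB f <-> LipLoc f /\ mbounded [set x | f x != 0].
Proof.
split=> [[[L hL] [M hM] sb]|[fl fb]].
  split; last by apply: mboundedS sb; exact: subset_closure.
  by move=> B _; exists L; apply: klip_onW hL.
have Nb : mbounded (closed_nbhd 1 [set x | f x != 0]).
  exact: mbounded_closed_nbhd.
have [L L0 hL] := LipLoc_klip fl Nb; have [M M0 hM] := LipLoc_bounded fl Nb.
have hM' x : `|f x| <= M.
  have [->|fx] := eqVneq (f x) 0; first by rewrite normr0 ltW.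
  by apply: hM; exact: (sub_closed_nbhd ltr01).
split; [|by exists M|exact: mbounded_closure].
exists (L + M); apply/klipP => x y _ _.
wlog fx : x y / f x != 0.
  move=> H; have [fx0|/H//] := eqVneq (f x) 0.
  have [fy0|/H] := eqVneq (f y) 0; last by rewrite distrC metric_sym.
  by rewrite fx0 fy0 subrr normr0 mulr_ge0 ?mdist_ge0// addr_ge0 ?ltW.
have Nx : closed_nbhd 1 [set x | f x != 0] x by exact: (sub_closed_nbhd ltr01).
have [xy|xy] := leP (mdist x y) 1.
  rewrite (le_trans (hL _ _ Nx _))//.
    by apply: (closed_nbhd_mdist ltr01 fx); rewrite metric_sym.
  by rewrite ler_wpM2r ?mdist_ge0// lerDl ltW.
have [fy|fy] := eqVneq (f y) 0.
  rewrite fy subr0 (le_trans (hM' _))// -[leLHS]mulr1.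
  by rewrite ler_pM// ?ltW// ltrDr.
rewrite (le_trans (hL _ _ Nx _))//; first exact: (sub_closed_nbhd ltr01).
by rewrite ler_wpM2r ?mdist_ge0// lerDl ltW.
Qed.

Lemma LipB_LipLoc f : LipB f -> LipLoc f. Proof. by case/LipBP. Qed.

Lemma LipB_mbounded f : LipB f -> mbounded (spt f). Proof. by case. Qed.

Lemma LipB_bounded f : LipB f -> exists2 M, 0 < M & forall x, `|f x| <= M.
Proof.
case=> _ [M hM] _; exists (Num.max 1 M); first by rewrite lt_max ltr01.
by move=> x; rewrite le_max hM orbT.
Qed.

Lemma LipB_sub f g : LipB g -> LipLoc f -> (forall x, g x = 0 -> f x = 0) ->
  LipB f.
Proof.
move=> /LipBP[_ gb] fl fg; apply/LipBP; split => //; apply: mboundedS gb.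
by move=> x /=; apply: contra_neq; exact: fg.
Qed.

Lemma LipBM f g : LipB f -> LipLoc g -> LipB (fun x => f x * g x).
Proof.
move=> fB gl; apply: (LipB_sub fB); last by move=> x ->; rewrite mul0r.
by apply: LipLocM => //; exact: LipB_LipLoc.
Qed.

Lemma LipBD f g : LipB f -> LipB g -> LipB (fun x => f x + g x).
Proof.
move=> /LipBP[fl fb] /LipBP[gl gb]; apply/LipBP; split; first exact: LipLocD.
apply: mboundedS (mboundedU fb gb) => x /= fg.
have [fx0|] := eqVneq (f x) 0; [right|by left].
by move: fg; rewrite fx0 add0r.
Qed.

Lemma LipB0 : LipB (fun _ : X => 0).
Proof.
apply/LipBP; split; first exact: LipLoc_cst.
by exists 0 => x y /=; rewrite eqxx.
Qed.

Lemma LipBZ a f : LipB f -> LipB (fun x => a * f x).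
Proof.
move=> fB; apply: (LipB_sub fB); last by move=> x ->; rewrite mulr0.
by apply: LipLocZ; exact: LipB_LipLoc.
Qed.

Lemma LipBN f : LipB f -> LipB (fun x => - f x).
Proof.
move=> fB; apply: (LipB_sub fB); last by move=> x ->; rewrite oppr0.
by apply: LipLocN; exact: LipB_LipLoc.
Qed.

Lemma LipBB f g : LipB f -> LipB g -> LipB (fun x => f x - g x).
Proof. by move=> fB gB; apply: LipBD => //; exact: LipBN. Qed.

Lemma LipB_sum (I : Type) (r : seq I) (P : pred I) (F : I -> X -> R) :
  (forall i, LipB (F i)) -> LipB (fun x => \sum_(i <- r | P i) F i x).
Proof.
move=> h; rewrite (_ : (fun x => _) = \sum_(i <- r | P i) F i); last first.
  by apply/funext => x; rewrite fct_sumE.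
by apply: big_ind => //; [exact: LipB0|exact: LipBD].
Qed.

(** ** McShane extension and distance cutoffs *)

Definition mcshane (L : R) A f x := inf [set f y + L * mdist x y | y in A].

Section mcshane.
Variables (L : R) (A : set X) (f : X -> R).
Hypotheses (L0 : 0 <= L)
  (fL : forall x y, A x -> A y -> `|f x - f y| <= L * mdist x y).

Let lbnd y0 x y : A y0 -> A y -> f y0 - L * mdist x y0 <= f y + L * mdist x y.
Proof.
move=> Ay0 Ay; have := fL Ay0 Ay; rewrite ler_norml => /andP[_ h].
have := ler_wpM2l L0 (metric_triangle y0 x y); rewrite (metric_sym y0 x).
by rewrite mulrDr; lra.
Qed.

Let has_lb x : has_lbound [set f y + L * mdist x y | y in A].
Proof.
have [[y0 Ay0]|nA] := pselect (exists y, A y); last first.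
  by exists 0 => w [y Ay _]; case: nA; exists y.
by exists (f y0 - L * mdist x y0) => _ [y Ay <-]; exact: lbnd.
Qed.

Lemma mcshane_le x y : A y -> mcshane L A f x <= f y + L * mdist x y.
Proof. by move=> Ay; apply: ge_inf => //; exists y. Qed.

Lemma mcshane_ge x c : A !=set0 -> (forall y, A y -> c <= f y + L * mdist x y) ->
  c <= mcshane L A f x.
Proof.
move=> [y0 Ay0] h; apply: lb_le_inf; first by exists (f y0 + L * mdist x y0), y0.
by move=> _ [y Ay <-]; exact: h.
Qed.

Lemma mcshaneE x : A x -> mcshane L A f x = f x.
Proof.
move=> Ax; apply/eqP; rewrite eq_le; apply/andP; split.
  by have := mcshane_le x Ax; rewrite mdistxx mulr0 addr0.
apply: mcshane_ge; first by exists x.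
by move=> y Ay; have := lbnd x Ax Ay; rewrite mdistxx mulr0 subr0.
Qed.

Lemma mcshane_lip x y : `|mcshane L A f x - mcshane L A f y| <= L * mdist x y.
Proof.
have [[y0 Ay0]|nA] := pselect (exists y, A y); last first.
  have e0 z : mcshane L A f z = 0.
    rewrite /mcshane (_ : image _ _ = set0) ?inf0// -subset0 => w [t At _].
    by case: nA; exists t.
  by rewrite !e0 subrr normr0 mulr_ge0// mdist_ge0.
suff H u v : mcshane L A f u - mcshane L A f v <= L * mdist u v.
  by rewrite ler_norml lerNl opprB H metric_sym H.
rewrite lerBlDr -lerBlDl; apply: mcshane_ge; first by exists y0.
move=> z Az; rewrite lerBlDr (le_trans (mcshane_le u Az))//.
rewrite -addrA lerD2l -mulrDr ler_wpM2l//.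
by rewrite (le_trans (metric_triangle _ v _))// addrC.
Qed.

End mcshane.

(** Capping the distance at 1 keeps it finite and 1-Lipschitz even when [A] is
    empty. *)
Definition cdist A x := inf ([set 1] `|` [set mdist x y | y in A]).

Section cdist.
Variable A : set X.

Let has_lb x : has_lbound ([set 1 : R] `|` [set mdist x y | y in A]).
Proof. by exists 0 => w [->|[y _ <-]]//; rewrite mdist_ge0. Qed.

Lemma cdist_le x y : A y -> cdist A x <= mdist x y.
Proof. by move=> Ay; apply: ge_inf => //; right; exists y. Qed.

Lemma cdist_le1 x : cdist A x <= 1.
Proof. by apply: ge_inf => //; left. Qed.

Lemma cdist_ge x c : c <= 1 -> (forall y, A y -> c <= mdist x y) -> c <= cdist A x.
Proof.
by move=> c1 h; apply: lb_le_inf => [|_ [->|[y Ay <-]]]; [exists 1; left| |exact: h].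
Qed.

Lemma cdist_ge0 x : 0 <= cdist A x.
Proof. by apply: cdist_ge => // y _; rewrite mdist_ge0. Qed.

Lemma cdist_lt x r : cdist A x < r -> r <= 1 -> exists2 y, A y & mdist x y < r.
Proof.
move=> h r1; apply: contrapT => nA; move: h; apply/negP; rewrite -leNgt.
by apply: cdist_ge => // y Ay; rewrite leNgt; apply/negP => xy; apply: nA; exists y.
Qed.

Lemma cdist_lip x y : `|cdist A x - cdist A y| <= mdist x y.
Proof.
suff H u v : cdist A u - cdist A v <= mdist u v.
  by rewrite ler_norml lerNl opprB H metric_sym H.
rewrite lerBlDr -lerBlDl; apply: cdist_ge => [|z Az].
  by rewrite lerBlDr (le_trans (cdist_le1 _))// lerDl mdist_ge0.
rewrite lerBlDr (le_trans (cdist_le u Az))// addrC.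
by rewrite (le_trans (metric_triangle _ v _)).
Qed.

Lemma LipLoc_cdist : LipLoc (cdist A).
Proof. by apply: (@LipLoc_lip _ 1) => x y; rewrite mul1r cdist_lip. Qed.

Lemma cdist0 x : A x -> cdist A x = 0.
Proof.
move=> Ax; apply/eqP; rewrite eq_le cdist_ge0 andbT.
by rewrite (le_trans (cdist_le x Ax))// mdistxx.
Qed.

Lemma cdist_gt0 x : closed A -> ~ A x -> 0 < cdist A x.
Proof.
move=> Ac nAx; rewrite lt_neqAle cdist_ge0 andbT eq_sym; apply/eqP => c0.
apply: nAx; apply: Ac => B /nbhs_mdistP[e e0 h].
have [||y Ay xy] := @cdist_lt x (Num.min e 1).
- by rewrite c0 lt_min e0 ltr01.
- by rewrite ge_min lexx orbT.
by exists y; split => //; apply: h; move: xy; rewrite lt_min => /andP[].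
Qed.

End cdist.

Lemma cutoff_exists B : mbounded B -> exists s : X -> R, [/\ LipB s,
  forall x, 0 <= s x <= 1 & forall x, B x -> s x = 1].
Proof.
move=> Bb; exists (fun x => 1 - cdist B x); split.
- apply/LipBP; split; first by apply: LipLocB; [exact: LipLoc_cst|exact: LipLoc_cdist].
  apply: mboundedS (mbounded_closed_nbhd 1 Bb) => x /= h.
  have : cdist B x < 1.
    by rewrite lt_neqAle cdist_le1 andbT; apply: contra_neq h => ->; rewrite subrr.
  by move=> /cdist_lt[]// y By xy; apply: (closed_nbhd_mdist ltr01 By); rewrite ltW.
- by move=> x; rewrite subr_ge0 cdist_le1 gerBl cdist_ge0.
- by move=> x Bx; rewrite cdist0// subr0.
Qed.

End lipschitz.

(** * Metric functionals *)

Section functionals.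
Variables (R : realType) (X : metricType R) (k : nat).
Implicit Types (f g : X -> R) (pi rho : 'I_k -> X -> R) (T : functional X k).

Lemma set_coordE pi i u : set_coord pi i u i = u.
Proof. by rewrite /set_coord eqxx. Qed.

Lemma set_coord_id pi i : set_coord pi i (pi i) = pi.
Proof. by apply/funext => j; rewrite /set_coord; case: eqVneq => // ->. Qed.

Lemma LipLoc_set_coord pi i u : (forall j, LipLoc (pi j)) -> LipLoc u ->
  forall j, LipLoc (set_coord pi i u j).
Proof. by move=> h hu j; rewrite /set_coord; case: ifP. Qed.

(** Interpolates from [pi] to [rho] by switching the first [n] coordinates, so
    that multilinearity and locality apply to one coordinate at a time. *)
Definition mix pi rho (n : nat) : 'I_k -> X -> R :=
  fun j => if (j < n)%N then rho j else pi j.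

Lemma mix0 pi rho : mix pi rho 0 = pi.
Proof. by []. Qed.

Lemma mixk pi rho : mix pi rho k = rho.
Proof. by apply/funext => j; rewrite /mix ltn_ord. Qed.

Lemma mixS pi rho n (nk : (n < k)%N) :
  mix pi rho n.+1 = set_coord (mix pi rho n) (Ordinal nk) (rho (Ordinal nk)).
Proof.
apply/funext => j; rewrite /mix /set_coord; case: eqVneq => [->|jn].
  by rewrite ltnSn.
by rewrite ltnS leq_eqVlt -[j == n :> nat]/(j == Ordinal nk) (negPf jn).
Qed.

Lemma mixE pi rho n (nk : (n < k)%N) :
  mix pi rho n = set_coord (mix pi rho n) (Ordinal nk) (pi (Ordinal nk)).
Proof.
rewrite -{1}[LHS](set_coord_id _ (Ordinal nk)); congr set_coord.
by rewrite /mix ltnn.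
Qed.

Lemma LipLoc_mix pi rho n : (forall j, LipLoc (pi j)) ->
  (forall j, LipLoc (rho j)) -> forall j, LipLoc (mix pi rho n j).
Proof. by move=> h h' j; rewrite /mix; case: ifP. Qed.

Section metric_functional.
Variable T : functional X k.
Hypothesis HT : metric_functional T.

Lemma mfDZ a f g pi : LipB f -> LipB g -> (forall i, LipLoc (pi i)) ->
  T (fun x => a * f x + g x) pi = a * T f pi + T g pi.
Proof. by case: HT => -[h _ _ _] fB gB pl; apply: h. Qed.

Lemma mfD f g pi : LipB f -> LipB g -> (forall i, LipLoc (pi i)) ->
  T (fun x => f x + g x) pi = T f pi + T g pi.
Proof.
move=> fB gB pl; rewrite -[T f pi]mul1r -mfDZ//; congr (T _ pi).
by apply/funext => x; rewrite mul1r.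
Qed.

Lemma mf0 pi : (forall i, LipLoc (pi i)) -> T (fun=> 0) pi = 0.
Proof.
move=> pl; have := mfD (LipB0 X) (LipB0 X) pl.
rewrite (_ : (fun x => _) = (fun=> 0)); last by apply/funext => x; rewrite addr0.
by move/eqP; rewrite -subr_eq0 opprD addrA subrr sub0r oppr_eq0 => /eqP.
Qed.

Lemma mfZ a f pi : LipB f -> (forall i, LipLoc (pi i)) ->
  T (fun x => a * f x) pi = a * T f pi.
Proof.
move=> fB pl; rewrite -[RHS]addr0 -[X in _ + X](mf0 pl) -mfDZ//; last exact: LipB0.
by congr (T _ pi); apply/funext => x; rewrite addr0.
Qed.

Lemma mfN f pi : LipB f -> (forall i, LipLoc (pi i)) ->
  T (fun x => - f x) pi = - T f pi.
Proof.
move=> fB pl; rewrite -mulN1r -mfZ//; congr (T _ pi).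
by apply/funext => x; rewrite mulN1r.
Qed.

Lemma mfB f g pi : LipB f -> LipB g -> (forall i, LipLoc (pi i)) ->
  T (fun x => f x - g x) pi = T f pi - T g pi.
Proof. by move=> fB gB pl; rewrite mfD ?mfN//; exact: LipBN. Qed.

Lemma mf_sum (I : Type) (r : seq I) (P : pred I) (F : I -> X -> R) pi :
  (forall i, LipB (F i)) -> (forall i, LipLoc (pi i)) ->
  T (fun x => \sum_(i <- r | P i) F i x) pi = \sum_(i <- r | P i) T (F i) pi.
Proof.
move=> FB pl; elim: r => [|i r IH].
  rewrite big_nil -[RHS](mf0 pl); congr (T _ pi).
  by apply/funext => x; rewrite big_nil.
rewrite big_cons -IH; case: ifP => Pi.
  rewrite -mfD//; last exact: LipB_sum.
  by congr (T _ pi); apply/funext => x; rewrite big_cons Pi.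
by congr (T _ pi); apply/funext => x; rewrite big_cons Pi.
Qed.

Lemma mf_coordDZ a f pi i u v : LipB f -> (forall i, LipLoc (pi i)) ->
  LipLoc u -> LipLoc v ->
  T f (set_coord pi i (fun x => a * u x + v x)) =
  a * T f (set_coord pi i u) + T f (set_coord pi i v).
Proof. by case: HT => -[_ h _ _] fB pl ul vl; apply: h. Qed.

Lemma mf_coordB f pi i u v : LipB f -> (forall i, LipLoc (pi i)) ->
  LipLoc u -> LipLoc v ->
  T f (set_coord pi i (fun x => u x - v x)) =
  T f (set_coord pi i u) - T f (set_coord pi i v).
Proof.
move=> fB pl ul vl; rewrite addrC -mulN1r -mf_coordDZ//; congr (T f (set_coord pi i _)).
by apply/funext => x; rewrite mulN1r addrC.
Qed.

Lemma mf_local f pi i d c : LipB f -> (forall i, LipLoc (pi i)) -> 0 < d ->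
  (forall x, closed_nbhd d (spt f) x -> pi i x = c) -> T f pi = 0.
Proof.
by case: HT => _ _ h fB pl d0 hc; apply: h => //; exists i, d, c.
Qed.

Lemma mf_coord0 f pi i : LipB f -> (forall i, LipLoc (pi i)) ->
  T f (set_coord pi i (fun=> 0)) = 0.
Proof.
move=> fB pl; apply: (@mf_local _ _ i 1 0) => //.
  by apply: LipLoc_set_coord => //; exact: LipLoc_cst.
by move=> x _; rewrite set_coordE.
Qed.

Lemma mf_coordZ a f pi i u : LipB f -> (forall i, LipLoc (pi i)) -> LipLoc u ->
  T f (set_coord pi i (fun x => a * u x)) = a * T f (set_coord pi i u).
Proof.
move=> fB pl ul; rewrite -[RHS]addr0 -(@mf_coord0 f pi i)// -mf_coordDZ//.
  by congr (T f (set_coord pi i _)); apply/funext => x; rewrite addr0.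
exact: LipLoc_cst.
Qed.

(** Each switch of a coordinate contributes a value of [T] with a difference in
    that coordinate, the others being taken from either family. *)
Lemma mf_telescope c f pi rho : LipB f ->
  (forall i, LipLoc (pi i)) -> (forall i, LipLoc (rho i)) ->
  (forall sigma i, (forall j, sigma j = pi j \/ sigma j = rho j) ->
     `|T f (set_coord sigma i (fun x => pi i x - rho i x))| <= c) ->
  `|T f pi - T f rho| <= k%:R * c.
Proof.
move=> fB pl rl h.
suff H n : (n <= k)%N -> `|T f pi - T f (mix pi rho n)| <= n%:R * c.
  by have := H k (leqnn k); rewrite mixk.
elim: n => [_|n IH nk]; first by rewrite mix0 subrr normr0 mul0r.
have -> : T f pi - T f (mix pi rho n.+1) = (T f pi - T f (mix pi rho n)) +
    (T f (mix pi rho n) - T f (mix pi rho n.+1)) by ring.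
rewrite (le_trans (ler_normD _ _))// -natr1 mulrDl mul1r.
apply: lerD; first by apply: IH; exact: ltnW.
rewrite (mixS _ _ nk) {1}(mixE _ _ nk) -mf_coordB//; last exact: LipLoc_mix.
by apply: h => j; rewrite /mix; case: ifP; [right|left].
Qed.

Lemma mf_congr_near d f pi rho : LipB f -> 0 < d ->
  (forall i, LipLoc (pi i)) -> (forall i, LipLoc (rho i)) ->
  (forall i x, closed_nbhd d (spt f) x -> pi i x = rho i x) ->
  T f pi = T f rho.
Proof.
move=> fB d0 pl rl h; apply/eqP; rewrite -subr_eq0 -normr_le0.
rewrite (le_trans (mf_telescope (c := 0) _ _ _ _))// ?mulr0// => s i hs.
rewrite (@mf_local _ _ i d 0) ?normr0//.
  apply: LipLoc_set_coord => [j|]; last exact: LipLocB.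
  by case: (hs j) => ->.
by move=> x hx; rewrite set_coordE h// subrr.
Qed.

Lemma mf_homogeneous a f pi : LipB f -> (forall i, LipLoc (pi i)) ->
  T f (fun i x => a * pi i x) = a ^+ k * T f pi.
Proof.
move=> fB pl; set rho := (fun i x => a * pi i x).
have rl i : LipLoc (rho i) by exact: LipLocZ.
suff H n : (n <= k)%N -> T f (mix pi rho n) = a ^+ n * T f pi.
  by have := H k (leqnn k); rewrite mixk.
elim: n => [_|n IH nk]; first by rewrite mix0 expr0 mul1r.
rewrite (mixS _ _ nk) mf_coordZ//; last exact: LipLoc_mix.
by rewrite -mixE IH ?(ltnW nk)// mulrA -exprS.
Qed.

Lemma mass_open_ge f pi O : LipB f -> (forall i, Lip1 (pi i)) ->
  (forall x, `|f x| <= 1) -> spt f `<=` O -> (`|T f pi|%:E <= mass_open T O)%E.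
Proof.
move=> fB pl f1 fO; have pl' i : LipLoc (pi i) by exact: Lip1_LipLoc.
wlog T0 : f fB f1 fO / 0 <= T f pi.
  move=> H; have [|T0] := leP 0 (T f pi); first exact: H.
  rewrite -normrN -mfN//; apply: H => //.
  - exact: LipBN.
  - by move=> x; rewrite normrN.
  - by apply: subset_trans fO; apply: spt_sub => x ->; rewrite oppr0.
  - by rewrite mfN// oppr_ge0 ltW.
rewrite ger0_norm//; apply: ereal_sup_ubound => /=.
exists 1%N, (fun=> f), (fun=> pi); split => //.
  by move=> x; rewrite big_ord1.
by rewrite big_ord1.
Qed.

(** Mass is tested on globally 1-Lipschitz coordinates, whereas [pi] is only
    controlled near the support of [f].  Locality allows it to be replaced by
    its McShane extension from there; the rest is homogeneity. *)
Lemma mf_le_mass_open M L m f pi O : LipB f -> (forall i, LipLoc (pi i)) ->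
  0 < M -> 0 < L -> (forall x, `|f x| <= M) -> spt f `<=` O ->
  (forall i, klip_on (Y := R^o) L (closed_nbhd 1 (spt f)) (pi i)) ->
  (mass_open T O <= m%:E)%E -> `|T f pi| <= M * L ^+ k * m.
Proof.
move=> fB pl M0 L0 fM fO pL Om.
set N := closed_nbhd 1 (spt f) in pL.
have pL' i x y : N x -> N y -> `|pi i x - pi i y| <= L * mdist x y.
  by move/klipP : (pL i); apply.
pose q i := mcshane L N (pi i).
have ql i x y : `|q i x - q i y| <= L * mdist x y.
  by apply: mcshane_lip; [exact: ltW|exact: pL'].
have qloc i : LipLoc (q i) by exact: LipLoc_lip (ql i).
have -> : T f pi = T f q.
  apply: (mf_congr_near (d := 1)) => // i x Nx.
  by rewrite /q (mcshaneE (ltW L0) (pL' i)).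
have -> : f = (fun x => M * (M^-1 * f x)).
  by apply/funext => x; rewrite mulVKf// gt_eqF.
have -> : q = (fun i x => L * (L^-1 * q i x)).
  by apply/funext => i; apply/funext => x; rewrite mulVKf// gt_eqF.
have fB' : LipB (fun x => M^-1 * f x) by exact: LipBZ.
have ql' i : LipLoc (fun x => L^-1 * q i x) by exact: LipLocZ.
rewrite mfZ//; last by move=> i; exact: LipLocZ.
rewrite mf_homogeneous// mulrA normrM ger0_norm; last first.
  by rewrite mulr_ge0 ?exprn_ge0// ltW.
rewrite ler_wpM2l//; first by rewrite mulr_ge0 ?exprn_ge0// ltW.
rewrite -lee_fin (le_trans _ Om)//; apply: mass_open_ge => //.
- move=> i; apply/klipP => x y _ _; rewrite -mulrBr normrM gtr0_norm ?invr_gt0//.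
  by rewrite mul1r ler_pdivrMl.
- by move=> x; rewrite normrM gtr0_norm ?invr_gt0// ler_pdivrMl// mulr1.
- by apply: subset_trans fO; apply: spt_sub => x ->; rewrite mulr0.
Qed.

End metric_functional.

Section mass_set_function.
Variable T : functional X k.
Local Open Scope ereal_scope.

Lemma mass_open_mono O O' : O `<=` O' -> mass_open T O <= mass_open T O'.
Proof.
move=> OO'; apply: ereal_sup_le => s [N [f [pi [h1 h2 h3 h4]]]].
by exists N, f, pi; split => // j; exact: subset_trans OO'.
Qed.

Lemma mass_openE O : open O -> mass T O = mass_open T O.
Proof.
move=> Oo; apply/eqP; rewrite eq_le; apply/andP; split.
  by apply: ereal_inf_lbound; exists O => //; split => //; exact: subset_refl.
by apply: le_ereal_inf_tmp => _ [V [_ OV] <-]; exact: mass_open_mono.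
Qed.

Lemma mass_mono A B : A `<=` B -> mass T A <= mass T B.
Proof.
move=> AB; apply: ereal_inf_le_tmp => _ [V [Vo BV] <-].
by exists V => //; split => //; exact: subset_trans BV.
Qed.

Lemma mass_open_ge0 O : 0 <= mass_open T O.
Proof.
apply: ereal_sup_ubound => /=; exists 0%N, (fun=> fun=> 0%R), (fun=> fun=> fun=> 0%R).
split; [by case|by case| |by rewrite big_ord0].
by move=> x; rewrite big_ord0.
Qed.

Lemma mass_ge0 A : 0 <= mass T A.
Proof. by apply: le_ereal_inf_tmp => _ [V _ <-]; exact: mass_open_ge0. Qed.

Lemma mass_le_open A O : open O -> A `<=` O -> mass T A <= mass_open T O.
Proof. by move=> Oo AO; apply: ereal_inf_lbound; exists O. Qed.

End mass_set_function.

Lemma mass_open_eq T T' O : eq_functional T T' -> mass_open T O = mass_open T' O.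
Proof.
suff H (S S' : functional X k) : eq_functional S S' -> (mass_open S O <= mass_open S' O)%E.
  by move=> h; apply/eqP; rewrite eq_le !H// => f pi fp; rewrite h.
move=> h; rewrite /mass_open; apply: ereal_sup_le => s [N [f [pi [h1 h2 h3 ->]]]].
exists N, f, pi; split => //; congr (_%:E); apply: eq_bigr => j _.
rewrite h//; split; first by case: (h1 j).
by move=> i; apply: Lip1_LipLoc; case: (h1 j) => _; exact.
Qed.

Lemma mass_eq T T' : eq_functional T T' -> mass T = mass T'.
Proof.
move=> h; apply/funext => A; rewrite /mass; congr ereal_inf.
by apply: eq_imagel => O _; exact: mass_open_eq.
Qed.

End functionals.

(** * The mass is a Borel measure *)

Section mass_measure.
Variables (R : realType) (X : completeMetricType R).
Implicit Types (f g : X -> R) (O A B K : set X).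

Lemma open_cgt (h : X -> R) c : continuous h -> open [set x | c < h x].
Proof.
by move=> hc; apply: (@open_comp _ _ h [set y | c < y]) => [x _|];
  [exact: hc|exact: open_gt].
Qed.

Lemma open_clt (h : X -> R) c : continuous h -> open [set x | h x < c].
Proof.
by move=> hc; apply: (@open_comp _ _ h [set y | y < c]) => [x _|];
  [exact: hc|exact: open_lt].
Qed.

Lemma closed_cge (h : X -> R) c : continuous h -> closed [set x | c <= h x].
Proof.
move=> hc; rewrite -openC (_ : ~` _ = [set x | h x < c]); first exact: open_clt.
by apply/seteqP; split => x /=; rewrite ltNge => /negP.
Qed.

Lemma closed_cle (h : X -> R) c : continuous h -> closed [set x | h x <= c].
Proof.
move=> hc; rewrite -openC (_ : ~` _ = [set x | c < h x]); first exact: open_cgt.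
by apply/seteqP; split => x /=; rewrite ltNge => /negP.
Qed.

Lemma compact_bigcup_cover K (F : nat -> set X) : compact K ->
  (forall i, open (F i)) -> K `<=` \bigcup_i F i ->
  exists n, K `<=` \bigcup_(i < n) F i.
Proof.
rewrite compact_cover => Kc Fo KF.
have [D _ KD] := Kc nat setT F (fun i _ => Fo i) KF.
exists (\max_(i <- finmap.enum_fset D) i).+1 => x /KD[i Di Fix].
by exists i => //=; rewrite ltnS; apply: leq_bigmax_seq.
Qed.

Lemma compact_pos_lbound K (h : X -> R) : compact K -> continuous h ->
  (forall x, K x -> 0 < h x) -> exists2 c, 0 < c & forall x, K x -> c < h x.
Proof.
move=> Kc hc h0; pose F n := [set x | n.+1%:R^-1 < h x].
have [||n Kn] := @compact_bigcup_cover K F Kc.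
- by move=> n; exact: open_cgt.
- by move=> x /h0/natSinv_lt[N hN]; exists N => //; exact: hN.
exists n.+1%:R^-1 => [|x /Kn[i /= ni]]; first by rewrite invr_gt0.
apply: le_lt_trans; rewrite lef_pV2 ?posrE// ler_nat; exact: ltnW.
Qed.

Lemma lip_invmax (c : R) : 0 < c -> forall a b : R,
  `|(Num.max a c)^-1 - (Num.max b c)^-1| <= c^-1 ^+ 2 * `|a - b|.
Proof.
move=> c0 a b; set u := Num.max a c; set v := Num.max b c.
have cu : c <= u by rewrite le_max lexx orbT.
have cv : c <= v by rewrite le_max lexx orbT.
have u0 := lt_le_trans c0 cu; have v0 := lt_le_trans c0 cv.
have -> : u^-1 - v^-1 = (u^-1 * v^-1) * (v - u).
  by field; rewrite !gt_eqF.
rewrite normrM ler_pM//.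
  rewrite normrM !gtr0_norm ?invr_gt0// expr2.
  by apply: ler_pM; rewrite ?invr_ge0 ?(ltW u0) ?(ltW v0) ?lef_pV2 ?posrE.
rewrite distrC /u /v; case: (lerP a c) => ac; case: (lerP b c) => bc //.
- by rewrite subrr normr0.
- by rewrite distrC [leRHS]distrC !ger0_norm ?subr_ge0; lra.
- by rewrite !ger0_norm ?subr_ge0; lra.
Qed.

(** The distances to the complements of the [F i], lowered by a small [t] so that
    their supports lie inside the [F i], have a sum bounded below near the
    compact set and can be normalized there. *)
Lemma compact_partition K (F : nat -> set X) : compact K ->
  (forall i, open (F i)) -> K `<=` \bigcup_i F i ->
  exists n (r : 'I_n -> X -> R), [/\ forall i, LipLoc (r i),
    forall i x, 0 <= r i x,
    forall i, spt (r i) `<=` F i,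
    forall x, \sum_i r i x <= 1 &
    exists C, [/\ closed C, C `&` K = set0 & forall x, ~ C x -> \sum_i r i x = 1]].
Proof.
move=> Kc Fo KF; have [n Kn] := compact_bigcup_cover Kc Fo KF.
pose d i := cdist (~` F i); pose h x := \sum_(i < n) d i x.
have hl : LipLoc h by apply: LipLoc_sum => i; exact: LipLoc_cdist.
have [||c c0 Kh] := @compact_pos_lbound K h Kc.
- exact: LipLoc_continuous.
- move=> x /Kn[i /= ni Fix]; rewrite /h (bigD1 (Ordinal ni))//=.
  rewrite ltr_pwDl//; last by apply: sumr_ge0 => j _; exact: cdist_ge0.
  by apply: cdist_gt0; [exact: open_closedC|by apply].
pose t := c / (2 * n.+1%:R); have t0 : 0 < t by rewrite divr_gt0// mulr_gt0.
pose e (i : 'I_n) x := Num.max 0 (d i x - t).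
pose H x := \sum_i e i x.
pose r i x := e i x * (Num.max (H x) (c / 2))^-1.
have c20 : 0 < c / 2 by rewrite divr_gt0.
have m0 x : 0 < Num.max (H x) (c / 2) by rewrite lt_max c20 orbT.
have e0 i x : 0 <= e i x by rewrite le_max lexx.
have el i : LipLoc (e i).
  apply: LipLoc_max; first exact: LipLoc_cst.
  by apply: LipLocB; [exact: LipLoc_cdist|exact: LipLoc_cst].
have Hl : LipLoc H by exact: LipLoc_sum.
have sumr x : \sum_i r i x = H x / Num.max (H x) (c / 2) by rewrite -mulr_suml.
exists n, r; split.
- move=> i; apply: LipLocM => //.
  by apply: (LipLoc_comp _ (lip_invmax c20) Hl); rewrite exprn_ge0 ?invr_ge0 ?ltW.
- by move=> i x; rewrite mulr_ge0// invr_ge0 ltW.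
- move=> i; apply: (@subset_trans _ [set x | t <= d i x]).
    apply: (@sptS R X (r i) [set x | t <= d i x]) => [|x].
      by apply: closed_cge; apply: LipLoc_continuous; exact: LipLoc_cdist.
    apply: contra_neqP => /negP; rewrite -ltNge => dt.
    by rewrite /r /e max_l ?mul0r// subr_le0 ltW.
  move=> x /= td; apply: contrapT => nF; move: td.
  by rewrite leNgt /d (cdist0 (A := ~` F i))//= t0.
- move=> x; rewrite sumr ler_pdivrMr// mul1r le_max lexx//.
- exists [set x | h x <= c]; split.
  + by apply: closed_cle; exact: LipLoc_continuous.
  + rewrite -subset0 => x [/= hc /Kh]; by rewrite ltNge hc.
  + move=> x /= /negP; rewrite -ltNge => hc.
    suff cH : c / 2 <= H x by rewrite sumr max_l// divff// gt_eqF// (lt_le_trans c20).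
    apply: (@le_trans _ _ (h x - n%:R * t)); last first.
      have -> : h x - n%:R * t = \sum_(i < n) (d i x - t).
        by rewrite sumrB sumr_const card_ord mulr_natl.
      by apply: ler_sum => i _; rewrite le_max lexx orbT.
    have : n%:R * t <= c / 2.
      have : t * (2 * n.+1%:R) = c by rewrite /t divfK// gt_eqF// mulr_gt0.
      move=> <-; rewrite (_ : _ / 2 = t * n.+1%:R); last by field.
      rewrite [_ * t]mulrC.
      by apply: ler_wpM2l; [exact: ltW|rewrite ler_nat].
    lra.
Qed.

Section outer.
Variables (k : nat) (T : functional X k).
Hypothesis HT : MLoc T.

Let mfT : metric_functional T. Proof. by case: HT. Qed.

Local Open Scope ereal_scope.

(** Mass is localized by cutoffs: multiplying an admissible family by one
    keeps it admissible and shrinks its supports. *)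
Lemma cut_family N (f : 'I_N -> X -> R) (pi : 'I_N -> 'I_k -> X -> R) r O :
  (forall j, LipB (f j) /\ forall i, Lip1 (pi j i)) ->
  (forall x, \sum_j `|f j x| <= 1)%R -> LipLoc r ->
  (forall x, 0 <= r x <= 1)%R ->
  (forall j, spt (fun x => f j x * r x)%R `<=` O) ->
  (\sum_j T (fun x => f j x * r x)%R (pi j))%:E <= mass_open T O.
Proof.
move=> fp f1 rl r01 sO; apply: ereal_sup_ubound => /=.
exists N, (fun j x => f j x * r x)%R, pi; split => //.
  by move=> j; split; [apply: LipBM => //; case: (fp j)|case: (fp j)].
move=> x; apply: le_trans (f1 x); apply: ler_sum => j _.
rewrite normrM ler_piMr//; have /andP[r0 r1] := r01 x.
by rewrite ger0_norm.
Qed.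

(** By tightness a compact set leaves out less than [e] of the mass.  A partition
    of unity near it splits a family into finitely many ones, carried by the
    [F i], and a remainder carried by the complement of the compact set. *)
Lemma mass_open_bigcup (F : nat -> set X) : (forall i, open (F i)) ->
  mass_open T (\bigcup_i F i) <= \sum_(i <oo) mass_open T (F i).
Proof.
move=> Fo; apply: ge_ereal_sup => _ [N [f [pi [fp fF f1 ->]]]].
apply/lee_addgt0Pr => e e0.
pose g x := (\sum_j `|f j x|)%R.
have gB : LipB g.
  apply: LipB_sum => j; have [fB _] := fp j; apply: (LipB_sub fB).
    by apply: LipLoc_norm; exact: LipB_LipLoc.
  by move=> x ->; rewrite normr0.
have fg j : spt (f j) `<=` spt g.
  apply: spt_sub => x /eqP; rewrite psumr_eq0// => /allP/(_ j).
  by rewrite mem_index_enum normr_eq0 => /(_ isT)/eqP.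
have [V [Vo Vb gV]] := mbounded_open (LipB_mbounded gB).
pose O := V `&` \bigcup_i F i.
have Oo : open O by apply: openI => //; exact: bigcup_open.
have Ob : mbounded O by apply: mboundedS Vb; exact: subIsetl.
have fO j : spt (f j) `<=` O.
  by move=> x fx; split; [exact: gV _ (fg _ _ fx)|exact: fF fx].
case: (HT) => _ _ /(_ O e Oo Ob e0)[K [Kc KO] Ke].
have OKo : open (O `\` K).
  rewrite setDE; apply: openI => //; apply: closed_openC.
  by apply: compact_closed => //; exact: metric_hausdorff.
have [n [r_ [rl r0 rF r1 [C [Cc CK Cr]]]]] := compact_partition Kc Fo
  (subset_trans KO (@subIsetr _ _ _)).
have r01 i x : (0 <= r_ i x <= 1)%R.
  rewrite r0/= (le_trans _ (r1 x))// (bigD1 i)//= lerDl.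
  by apply: sumr_ge0 => j _.
pose q x := (1 - \sum_i r_ i x)%R.
have ql : LipLoc q by apply: LipLocB; [exact: LipLoc_cst|exact: LipLoc_sum].
have q01 x : (0 <= q x <= 1)%R.
  by rewrite subr_ge0 r1 gerBl sumr_ge0.
have fB j : LipB (f j) by case: (fp j).
have pl j i : LipLoc (pi j i) by apply: Lip1_LipLoc; case: (fp j).
have -> : (\sum_j T (f j) (pi j) =
    \sum_(i < n) \sum_j T (fun x => f j x * r_ i x) (pi j) +
    \sum_j T (fun x => f j x * q x) (pi j))%R.
  rewrite exchange_big -big_split/=; apply: eq_bigr => j _.
  rewrite -mf_sum//; last by move=> i; exact: LipBM.
  rewrite -mfD//; [|by apply: LipB_sum => i; exact: LipBM|exact: LipBM].
  congr (T _ _); apply/funext => x.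
  by rewrite -mulr_sumr -mulrDr /q addrC subrK mulr1.
rewrite EFinD leeD//.
  rewrite -sumEFin (le_trans _ (nneseries_lim_ge n _))//.
    rewrite big_mkord; apply: lee_sum => i _; apply: cut_family => //.
    by move=> j; apply: subset_trans (rF i); apply: spt_sub => x ->; rewrite mulr0.
  by move=> i _ _; exact: mass_open_ge0.
rewrite (@le_trans _ _ (mass T (O `\` K)))//; last exact: ltW.
rewrite mass_openE//; apply: cut_family => //.
move=> j x fqx; split; first by apply: (fO j); apply: spt_sub fqx => y ->; rewrite mul0r.
move=> Kx; have : C x.
  apply: (sptS Cc) fqx => y; apply: contra_neqP => /Cr.
  by rewrite /q => ->; rewrite subrr mulr0.
by move=> Cx; have : (C `&` K) x by []; rewrite CK.
Qed.

Lemma mass_sigma_subadditive : sigma_subadditive (mass T).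
Proof.
move=> A; have [[i ioo]|] := pselect (exists i, mass T (A i) = +oo).
  by rewrite (eseries_pinfty _ _ ioo) ?leey// => j _; rewrite -ltNye
    (lt_le_trans _ (mass_ge0 _ _)).
rewrite -forallNE => Aoo; apply/lee_addgt0Pr => e e0.
rewrite (le_trans _ (epsilon_trick _ _ _))//; last 2 first.
- by move=> n; exact: mass_ge0.
- exact: ltW.
have [V hV] : {V : nat -> set X & forall i, [/\ open (V i), A i `<=` V i &
    mass_open T (V i) <= mass T (A i) + (e / (2 ^ i.+1)%:R)%:E]}.
  apply: (@choice _ _ (fun i V => [/\ open V, A i `<=` V &
    mass_open T V <= mass T (A i) + (e / (2 ^ i.+1)%:R)%:E])) => i.
  have Afin : mass T (A i) \is a fin_num.
    by rewrite ge0_fin_numE ?mass_ge0// ltey; exact/eqP/Aoo.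
  have e20 : (0 < e / (2 ^ i.+1)%:R)%R by rewrite divr_gt0// ltr0n expn_gt0.
  have [_ [W [Wo AW] <-] /ltW WA] := lb_ereal_inf_adherent e20 Afin.
  by exists W.
have AV : \bigcup_n A n `<=` \bigcup_n V n.
  by apply: subset_bigcup => i _; case: (hV i).
apply: (@le_trans _ _ (mass_open T (\bigcup_n V n))).
  by apply: mass_le_open => //; apply: bigcup_open => i _; case: (hV i).
apply: (le_trans (mass_open_bigcup _)); first by move=> i; case: (hV i).
apply: lee_nneseries => [i _ _|i _]; first exact: mass_open_ge0.
by case: (hV i).
Qed.

Lemma mass_set0 : mass T set0 = 0.
Proof.
rewrite mass_openE; last exact: open0.
apply/eqP; rewrite eq_le mass_open_ge0 andbT.
apply: ge_ereal_sup => _ [N [f [pi [fp f0 _ ->]]]].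
rewrite big1// => j _; rewrite (_ : f j = fun=> 0%R).
  by rewrite mf0// => i; apply: Lip1_LipLoc; case: (fp j).
by apply/funext => x; apply: spt_out => /f0.
Qed.

(** The mass is an outer measure only for functionals in [MLoc]; the proof is an
    argument so that the structure can be inferred from it. *)
Definition mass_outer of MLoc T : set X -> \bar R := mass T.

HB.instance Definition _ := isOuterMeasure.Build R X (mass_outer HT)
  mass_set0 (@mass_ge0 R X k T) (@mass_mono R X k T) mass_sigma_subadditive.

(** An admissible family carried by [O] can be completed by any family carried
    by the complement of its supports. *)
Lemma mass_open_split (G O : set X) : open G -> open O ->
  mass T (G `&` O) + mass T (G `&` ~` O) <= mass_open T G.
Proof.
move=> Go Oo; have [->|Gfin] := eqVneq (mass_open T G) +oo; first by rewrite leey.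
have Gf : mass_open T G \is a fin_num.
  by rewrite ge0_fin_numE ?mass_open_ge0// ltey.
have OGf : mass T (G `&` ~` O) \is a fin_num.
  rewrite ge0_fin_numE ?mass_ge0//; apply: (@le_lt_trans _ _ (mass_open T G)).
    by apply: mass_le_open => //; exact: subIsetl.
  by rewrite ltey.
rewrite -leeBrDr// mass_openE; last exact: openI.
apply: ge_ereal_sup => _ [N [f [pi [fp fO f1 ->]]]].
rewrite leeBrDr//.
pose S := \bigcup_(j in [set: 'I_N]) spt (f j).
have Sc : closed S.
  by apply: closed_bigcup => [|j _]; [exact: finite_finset|exact: closed_spt].
have GSo : open (G `\` S).
  by rewrite setDE; apply: openI => //; exact: closed_openC.
have GfS : mass_open T (G `\` S) \is a fin_num.
  rewrite ge0_fin_numE ?mass_open_ge0// (@le_lt_trans _ _ (mass_open T G))//.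
    by apply: mass_open_mono; exact: subDsetl.
  by rewrite ltey.
rewrite (@le_trans _ _ ((\sum_j T (f j) (pi j))%:E + mass_open T (G `\` S)))//.
  rewrite leeD2l//; apply: mass_le_open => // x [Gx nOx]; split => //.
  by move=> [j _ /fO[]].
rewrite -leeBrDl//; apply: ge_ereal_sup => _ [M [g [q [gq gS g1 ->]]]].
rewrite leeBrDl// -EFinD; apply: ereal_sup_ubound => /=.
exists (N + M)%N, (fun i => match fintype.split i with inl j => f j | inr l => g l end),
  (fun i => match fintype.split i with inl j => pi j | inr l => q l end); split.
- by move=> i; case: (fintype.split i).
- by move=> i; case: (fintype.split i) => [j x /(fO j)[]|l x /(gS l)[]].
- move=> x; rewrite big_split_ord/=.
  under eq_bigr do rewrite (unsplitK (inl _)).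
  under [X in (_ + X <= _)%R]eq_bigr do rewrite (unsplitK (inr _)).
  have [Sx|nSx] := pselect (S x).
    rewrite [X in (_ + X <= _)%R]big1 ?addr0// => l _.
    by rewrite (@spt_out _ _ (g l)) ?normr0// => /gS[_].
  rewrite big1 ?add0r// => j _.
  by rewrite (@spt_out _ _ (f j)) ?normr0// => fx; apply: nSx; exists j.
- rewrite big_split_ord/=; congr (_%:E); congr (_ + _)%R.
    by apply: eq_bigr => j _; rewrite (unsplitK (inl _)).
  by apply: eq_bigr => j _; rewrite (unsplitK (inr _)).
Qed.

Lemma open_caratheodory O : open O -> (mass_outer HT).-caratheodory O.
Proof.
move=> Oo; apply: le_caratheodory_measurable => A.
apply: le_ereal_inf_tmp => _ [G [Go AG] <-].
apply: le_trans (mass_open_split Go Oo); rewrite /mass_outer.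
by apply: leeD; apply: mass_mono; exact: setSI.
Qed.

Local Notation borelX := (g_sigma_algebraType (@open X)).

Lemma borel_caratheodory (A : set X) : borel A -> (mass_outer HT).-caratheodory A.
Proof.
suff : <<s @open X >> `<=` (mass_outer HT).-caratheodory by exact.
apply: smallest_sub; last by move=> O; exact: open_caratheodory.
exact: (sigma_algebra_measurable (caratheodory_type (mass_outer HT))).
Qed.

Definition mass_measure of MLoc T : set borelX -> \bar R := mass T.

Let mass_measure_sigma_additive : semi_sigma_additive (mass_measure HT).
Proof.
move=> F mF tF mUF.
have := @caratheodory_measure_sigma_additive R X (mass_outer HT) F.
by apply => //; [move=> i; exact: borel_caratheodory (mF i)|exact: borel_caratheodory mUF].
Qed.

HB.instance Definition _ := isMeasure.Build _ borelX R (mass_measure HT)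
  mass_set0 (@mass_ge0 R X k T) mass_measure_sigma_additive.

End outer.
End mass_measure.

(** * Estimates by integrals against the mass *)

Lemma measurable_fun_gt d (S : measurableType d) (R : realType) (h : S -> R) :
  (forall c, measurable [set x | c < h x]) -> measurable_fun setT h.
Proof.
move=> hc; apply: (measurability _ (RGenOInfty.measurableE R)) => //.
move=> _ [_ [c ->] <-]; rewrite setTI.
rewrite (_ : _ @^-1` _ = [set x | c < h x]); first exact: hc.
by apply/seteqP; split => x /=; rewrite in_itv/= andbT.
Qed.

Section borel_functions.
Variables (R : realType) (X : completeMetricType R).
Local Notation borelX := (g_sigma_algebraType (@open X)).

Lemma borel_open (O : set X) : open O -> borel O.
Proof. exact: sub_sigma_algebra. Qed.

Lemma continuous_borel (h : X -> R) : continuous h ->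
  measurable_fun setT (h : borelX -> R).
Proof.
by move=> hc; apply: measurable_fun_gt => c; apply: borel_open; exact: open_cgt.
Qed.

Lemma LipLoc_borel (h : X -> R) : LipLoc h -> measurable_fun setT (h : borelX -> R).
Proof. by move/LipLoc_continuous/continuous_borel. Qed.

Lemma borel_nz (h : borelX -> R) : measurable_fun setT h -> borel [set x | h x != 0].
Proof.
move=> mh; rewrite (_ : [set x | _] = h @^-1` (~` [set 0])).
  by rewrite -[X in borel X]setTI; apply: mh => //; apply: measurableC.
by apply/seteqP; split => x /= /eqP.
Qed.

End borel_functions.

Section integral_estimates.
Variables (R : realType) (X : completeMetricType R) (k : nat).
Variables (T : functional X k).
Hypothesis HT : MLoc T.
Implicit Types (f g : X -> R) (pi rho : 'I_k -> X -> R).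
Local Notation borelX := (g_sigma_algebraType (@open X)).
Local Notation mu := (mass_measure HT).

Let mfT : metric_functional T. Proof. by case: HT. Qed.

Local Open Scope ereal_scope.

Lemma mass_finite A : mbounded A -> mass T A < +oo.
Proof.
move=> Ab; have [W [Wo Wb AW]] := mbounded_open Ab; have [_ fin _] := HT.
exact: le_lt_trans (mass_mono T AW) (fin W Wo Wb).
Qed.

Lemma mass_fin_num A : mbounded A -> mass T A \is a fin_num.
Proof. by move=> Ab; rewrite ge0_fin_numE ?mass_ge0//; exact: mass_finite. Qed.

Let clamp (c s : R) : R := Num.max (- c)%R (Num.min c s).

Let clamp_id c s : (`|s| <= c)%R -> clamp c s = s.
Proof. by rewrite ler_norml /clamp => /andP[cs sc]; rewrite min_r// max_r. Qed.

Let clamp_gt c s : (0 <= c)%R -> (c <= s)%R -> clamp c s = c.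
Proof. by move=> c0 cs; rewrite /clamp min_l// max_r//; lra. Qed.

Let clamp_lt c s : (0 <= c)%R -> (s <= - c)%R -> clamp c s = (- c)%R.
Proof. by move=> c0 sc; rewrite /clamp min_r ?max_l//; lra. Qed.

Let clampP (c s : R) : (0 <= c)%R ->
  [\/ ((`|s| <= c) /\ clamp c s = s)%R,
      ((c <= s) /\ clamp c s = c)%R | ((s <= - c) /\ clamp c s = - c)%R].
Proof.
move=> c0; have [h|] := lerP `|s|%R c; first by apply: Or31; rewrite clamp_id.
rewrite ltNge ler_norml negb_and -!ltNge => /orP[/ltW h|/ltW h].
  by apply: Or33; rewrite clamp_lt.
by apply: Or32; rewrite clamp_gt.
Qed.

Let clamp_step c d s : (0 <= c)%R -> (0 <= d)%R ->
  (`|clamp (c + d) s - clamp c s| <= d)%R.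
Proof.
move=> c0 d0; have cd : (0 <= c + d)%R by rewrite addr_ge0.
by case: (clampP s c0) => -[]; rewrite ?ler_norml => h1 ->;
  case: (clampP s cd) => -[]; rewrite ?ler_norml => h2 ->;
  rewrite ?ler_norml; apply/andP; split; lra.
Qed.

Let clamp_lip2 c s t : (0 <= c)%R ->
  (`|clamp c s - clamp c t| <= `|s - t|)%R /\
  (`|(s - clamp c s) - (t - clamp c t)| <= `|s - t|)%R.
Proof.
move=> c0; wlog st : s t / (s <= t)%R.
  move=> H; have [/H//|/ltW/H] := leP s t.
  by rewrite (distrC t s) (distrC (clamp c t)) (distrC (t - clamp c t)%R).
rewrite (distrC s t) (@ger0_norm _ (t - s)%R) ?subr_ge0//.
by case: (clampP s c0) => -[]; rewrite ?ler_norml => h1 ->;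
  case: (clampP t c0) => -[]; rewrite ?ler_norml => h2 ->;
  rewrite ?ler_norml; split; apply/andP; split; lra.
Qed.

(** Only levels [j * d] below [s + d] contribute, whence at most [s / d + 2] of
    them. *)
Let count_levels (d s : R) n : (0 < d)%R -> (0 <= s)%R ->
  (\sum_(j < n) d * ((j%:R - 1) * d < s)%R%:R <= s + 2 * d)%R.
Proof.
move=> d0 s0; elim: n => [|n IH]; first by rewrite big_ord0; lra.
rewrite big_ord_recr/=; case: ltP => h; last by rewrite mulr0 addr0.
apply: (@le_trans _ _ (n.+1%:R * d)%R); last by rewrite -natr1; nra.
rewrite -natr1 mulrDl lerD//; last by rewrite mulr1 mul1r.
rewrite (@le_trans _ _ (\sum_(j < n) d)%R)//.
  by apply: ler_sum => j _; case: (_ < s)%R; rewrite ?mulr1// mulr0 ltW.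
by rewrite sumr_const card_ord mulr_natl.
Qed.

(** Layer-cake decomposition: the slice of [f] between the levels [j * d] and
    [(j + 1) * d] is bounded by [d] and supported where [|f| >= j * d]. *)
Lemma mf_le_integral (L : R) f pi : LipB f -> (forall i, LipLoc (pi i)) -> (0 < L)%R ->
  (forall i, klip_on (Y := R^o) L (closed_nbhd 1 (spt f)) (pi i)) ->
  `|T f pi|%:E <= (L ^+ k)%:E * \int[mass T : set borelX -> _]_x `|f x|%:E.
Proof.
move=> fB pl L0 pL; rewrite -[mass T]/(mu : set borelX -> _).
have Lk0 : (0 < L ^+ k)%R by rewrite exprn_gt0.
have fl := LipB_LipLoc fB.
have mf : measurable_fun setT (fun x : borelX => `|f x|%:E).
  by apply/measurable_EFinP; apply: LipLoc_borel; exact: LipLoc_norm.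
set I := integral _ _ _.
have I0 : 0 <= I by apply: integral_ge0 => x _; rewrite lee_fin.
have [->|Ioo] := eqVneq I +oo; first by rewrite gt0_muley ?lte_fin// leey.
have Ifin : I \is a fin_num by rewrite ge0_fin_numE// ltey.
have [W [Wo Wb fW]] := mbounded_open (LipB_mbounded fB).
have mW := mass_fin_num Wb; pose m := fine (mass T W).
have m0 : (0 <= m)%R by rewrite fine_ge0// mass_ge0.
have [M M0 fM] := LipB_bounded fB.
suff H (d : R) : (0 < d)%R -> (`|T f pi| <= L ^+ k * (fine I + 2 * d * m))%R.
  rewrite -[I]fineK// -EFinM lee_fin; apply/ler_addgt0Pr => e e0.
  have Lm : (0 < L ^+ k * (2 * m + 1))%R by rewrite mulr_gt0//; lra.
  have := H (e / (L ^+ k * (2 * m + 1)))%R (divr_gt0 e0 Lm).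
  move=> /le_trans; apply; rewrite mulrDr lerD2l.
  rewrite [X in (X <= _)%R](_ : _ = e * ((2 * m) / (2 * m + 1)))%R; last first.
    by field; rewrite !gt_eqF//; lra.
  by rewrite ler_piMr ?(ltW e0)// ler_pdivrMr; lra.
move=> d0; pose N := (Num.bound (M / d)).
have NM : (M <= N%:R * d)%R.
  by rewrite -ler_pdivrMr// ltW// archi_boundP// divr_ge0// ltW.
pose fj (j : nat) x : R := (clamp (j.+1%:R * d) (f x) - clamp (j%:R * d) (f x))%R.
have jd0 (j : nat) : (0 <= j%:R * d :> R)%R by rewrite mulr_ge0// ltW.
have cl (j : nat) : LipLoc (fun x => clamp (j%:R * d) (f x)).
  by apply: (@LipLoc_comp _ _ (clamp _) 1) => // a b; rewrite mul1r (clamp_lip2 _ _ (jd0 j)).1.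
have c00 (j : nat) : clamp (j%:R * d) 0 = 0%R by rewrite clamp_id// normr0.
have fjB (j : nat) : LipB (fj j).
  apply: (LipB_sub fB); first by apply: LipLocB; exact: cl.
  by move=> x fx; rewrite /fj fx !c00 subrr.
have fE : f = (fun x => \sum_(j < N) fj j x)%R.
  apply/funext => x; rewrite -(big_mkord xpredT (fj^~ x)) telescope_sumr//.
  rewrite clamp_id; last exact: le_trans (fM x) NM.
  by rewrite mul0r /clamp oppr0; case: (lerP 0%R (f x)) => h; rewrite ?maxxx ?max_l ?subr0// ltW.
have fjd (j : nat) x : (`|fj j x| <= d)%R.
  by rewrite /fj -natr1 mulrDl mul1r; apply: clamp_step => //; exact: ltW.
pose Oj (j : nat) := W `&` [set x | (j%:R - 1) * d < `|f x|]%R.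
have Ojo (j : nat) : open (Oj j).
  apply: openI => //; apply: open_cgt; apply: LipLoc_continuous.
  exact: LipLoc_norm.
have fjO (j : nat) : spt (fj j) `<=` Oj j.
  move=> x fx; split.
    by apply/fW/(spt_sub _ fx) => y fy; rewrite /fj fy !c00 subrr.
  have : (j%:R * d <= `|f x|)%R.
    apply: (@sptS _ _ (fj j) [set y | j%:R * d <= `|f y|]%R) fx => [|y].
      by apply/closed_cge/LipLoc_continuous/LipLoc_norm.
    apply: contra_neqP => /negP; rewrite -ltNge => /ltW h.
    rewrite /fj !clamp_id ?subrr//; apply: (le_trans h).
    by rewrite ler_wpM2r ?(ltW d0)// ler_nat.
  by move=> /= h; apply: lt_le_trans h; rewrite ltr_pM2r// ltrBlDr ltrDl.
have Ojfin (j : nat) : mass T (Oj j) \is a fin_num.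
  by apply: mass_fin_num; apply: mboundedS Wb; exact: subIsetl.
have Tj (j : nat) : (`|T (fj j) pi| <= d * L ^+ k * fine (mass T (Oj j)))%R.
  apply: (mf_le_mass_open mfT (O := Oj j)) => //.
    move=> i; apply: klip_onW (pL i) => //; apply: closed_nbhdS.
    by apply: spt_sub => y fy; rewrite /fj fy !c00 subrr.
  by rewrite -mass_openE// fineK.
rewrite {1}fE mf_sum// (le_trans (ler_norm_sum _ _ _))//.
apply: (@le_trans _ _ (\sum_(j < N) d * L ^+ k * fine (mass T (Oj j)))%R).
  by apply: ler_sum => j _; exact: Tj.
under eq_bigr do rewrite mulrAC mulrC.
rewrite -mulr_sumr ler_pM2l// -lee_fin -sumEFin.
rewrite EFinD EFinM !fineK//.
have mOj (j : nat) : measurable (Oj j : set borelX) by exact: borel_open.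
have mW' : measurable (W : set borelX) by exact: borel_open.
have -> : \sum_(j < N) (d * fine (mass T (Oj j)))%:E =
    \int[mu]_x (\sum_(j < N) (d * \1_(Oj j) x)%:E).
  rewrite ge0_integral_sum//.
  - apply: eq_bigr => j _; rewrite EFinM fineK//.
    under eq_integral do rewrite EFinM.
    rewrite ge0_integralZl_EFin ?integral_indic ?setIT ?(ltW d0)//.
    by apply/measurable_EFinP; exact: measurable_indic.
  - move=> j; apply/measurable_EFinP; apply: measurable_funM => //.
  - by move=> j x _; rewrite lee_fin mulr_ge0// ltW.
have -> : I + (2 * d)%:E * mass T W = \int[mu]_x (`|f x|%:E + (2 * d * \1_W x)%:E).
  rewrite ge0_integralD//.
  - congr (_ + _); under eq_integral do rewrite EFinM.
    rewrite ge0_integralZl_EFin ?integral_indic ?setIT ?mulr_ge0 ?(ltW d0)//.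
    by apply/measurable_EFinP; exact: measurable_indic.
  - by move=> x _; rewrite lee_fin !mulr_ge0// ltW.
  - by apply/measurable_EFinP; apply: measurable_funM.
apply: ge0_le_integral => //.
- by move=> x _; apply: sume_ge0 => j _; rewrite lee_fin mulr_ge0// ltW.
- by apply: emeasurable_sum => j; apply/measurable_EFinP; apply: measurable_funM.
- apply: emeasurable_funD => //.
  by apply/measurable_EFinP; apply: measurable_funM.
- move=> x _; rewrite sumEFin -EFinD lee_fin.
  have [Wx|nWx] := pselect (W x).
    rewrite indicE mem_set// mulr1.
    apply: le_trans (count_levels N d0 (normr_ge0 (f x))).
    apply: ler_sum => j _; rewrite ler_wpM2l ?(ltW d0)// indicE ler_nat.
    by case: (boolP (x \in Oj j)) => // /set_mem[_ /= ->].
  rewrite big1 ?addr_ge0 ?mulr_ge0 ?(ltW d0)// => j _.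
  by rewrite indicE memNset ?mulr0// => -[].
Qed.

Lemma integral_le_mass M A f : LipLoc f -> (0 <= M)%R ->
  (forall x, `|f x| <= M)%R -> borel A ->
  \int[mass T : set borelX -> _]_(x in A) `|f x|%:E <=
    M%:E * mass T (A `&` [set x | f x != 0%R]).
Proof.
move=> fl M0 fM mA; rewrite -[mass T]/(mu : set borelX -> _).
have mnz : measurable ([set x | f x != 0%R] : set borelX).
  by apply: borel_nz; exact: LipLoc_borel.
rewrite setIC -integral_indic// -ge0_integralZl_EFin//; last first.
  by apply/measurable_EFinP; exact: measurable_indic.
apply: ge0_le_integral => //.
- apply/measurable_EFinP; apply: (@measurable_funS _ _ _ _ setT) => //.
  by apply: LipLoc_borel; exact: LipLoc_norm.
- apply/measurable_EFinP; apply: measurable_funM => //.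
- move=> x Ax; rewrite -EFinM lee_fin indicE.
  have [fx|fx] := eqVneq (f x) 0%R.
    by rewrite fx normr0 mulr_ge0.
  by rewrite mem_set// mulr1.
Qed.

(** Strong locality: subtracting from a coordinate its truncation at height [d]
    makes it vanish on a neighbourhood of its zero set, and by locality the part
    of [f] supported near the zero set then contributes nothing.  Continuity lets
    [d] go to 0. *)
Lemma mf_strong_local (L : R) f pi i : LipB f -> (forall i, LipLoc (pi i)) ->
  (0 < L)%R ->
  (forall i, klip_on (Y := R^o) L (closed_nbhd 1 (spt f)) (pi i)) ->
  `|T f pi|%:E <=
    (L ^+ k)%:E * \int[mass T : set borelX -> _]_(x in [set x | pi i x != 0%R]) `|f x|%:E.
Proof.
move=> fB pl L0 pL; rewrite -[mass T]/(mu : set borelX -> _).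
have Lk0 : (0 < L ^+ k)%R by rewrite exprn_gt0.
have fl := LipB_LipLoc fB.
set D := [set x | _]; have mD : measurable (D : set borelX).
  by apply: borel_nz; exact: LipLoc_borel.
set I := integral _ _ _.
have [->|Ioo] := eqVneq I +oo; first by rewrite gt0_muley ?lte_fin// leey.
have Ifin : I \is a fin_num.
  by rewrite ge0_fin_numE ?ltey//; apply: integral_ge0 => x _; rewrite lee_fin.
pose b (d : R) x := (pi i x - clamp d (pi i x))%R.
have bl d : (0 <= d)%R -> LipLoc (b d).
  move=> d0; apply: (@LipLoc_comp _ _ (fun s => s - clamp d s)%R 1) => // u v.
  by rewrite mul1r (clamp_lip2 _ _ d0).2.
have bL (d : R) : (0 <= d)%R -> forall j,
    klip_on (Y := R^o) L (closed_nbhd 1 (spt f)) (set_coord pi i (b d) j).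
  move=> d0 j; rewrite /set_coord; case: eqP => // _.
  apply/klipP => x y Nx Ny; rewrite (le_trans (clamp_lip2 _ _ d0).2)//.
  by move/klipP : (pL i); apply.
suff H (d : R) : (0 < d)%R -> (`|T f (set_coord pi i (b d))| <= L ^+ k * fine I)%R.
  have [_ cT _] := mfT; rewrite -[I]fineK// -EFinM lee_fin.
  have cvgb : T f (set_coord pi i (b n.+1%:R^-1%R)) @[n --> \oo] --> T f pi.
    apply: cT => //.
    - by move=> n; split => //; apply: LipLoc_set_coord => //; exact: bl.
    - move=> j x; rewrite /set_coord; case: eqP => [->|_]; last exact: cvg_cst.
      rewrite -[X in _ --> X]subr0; apply: cvgB; first exact: cvg_cst.
      apply: (@squeeze_cvgr _ _ _ _ (fun n => - n.+1%:R^-1)%R (fun n => n.+1%:R^-1)%R).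
      + apply: nearW => n; rewrite -ler_norml.
        have n0 : (0 <= n.+1%:R^-1 :> R)%R by [].
        case: (clampP (pi i x) n0) => -[h ->] //; rewrite ?normrN ger0_norm//.
      + by rewrite -[X in _ --> X]oppr0; apply: cvgN; exact: cvg_harmonic.
      + exact: cvg_harmonic.
    - move=> j B Bb; have [K K0 hK] := LipLoc_klip (pl j) Bb; exists K => n.
      apply/klipP => x y Bx By; rewrite /set_coord; case: eqP => [ji|_]; last exact: hK.
      by rewrite (le_trans (clamp_lip2 _ _ _).2)// -ji; exact: hK.
  apply: (cvgr_to_le (cvg_norm cvgb)).
  by apply: nearW => n; exact: H.
move=> d0; have d0' := ltW d0.
(* [q] is 1 where the coordinate vanishes and 0 where it exceeds [d / 2]. *)
pose h (s : R) : R := (2 - 4 / d * s)%R.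
pose q x : R := (Num.max 0 (Num.min 1 (h `|pi i x|)))%R.
have ql : LipLoc q.
  apply: LipLoc_max; first exact: LipLoc_cst.
  apply: LipLoc_min; first exact: LipLoc_cst.
  apply: LipLocB; first exact: LipLoc_cst.
  by apply: LipLocZ; exact: LipLoc_norm.
have q01 x : (0 <= q x <= 1)%R by rewrite le_max lexx/= ge_max ler01 ge_min lexx.
have q0 x : (d / 2 <= `|pi i x|)%R -> q x = 0%R.
  move=> dx; rewrite /q max_l// ge_min; apply/orP; right; rewrite /h.
  rewrite subr_le0 (@le_trans _ _ (4 / d * (d / 2))%R)//; last first.
    by rewrite ler_wpM2l// divr_ge0.
  by rewrite (_ : 4 / d * (d / 2) = 2)%R//; field; rewrite gt_eqF.
have q1 x : pi i x = 0%R -> q x = 1%R.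
  by move=> px; rewrite /q /h px normr0 mulr0 subr0 min_l ?max_r// ler1n.
have sl : forall j, LipLoc (set_coord pi i (b d) j).
  by apply: LipLoc_set_coord => //; exact: bl.
have fqB : LipB (fun x => f x * q x)%R by exact: LipBM.
have rl : LipLoc (fun x => 1 - q x)%R by apply: LipLocB => //; exact: LipLoc_cst.
have frB : LipB (fun x => f x * (1 - q x))%R by exact: LipBM.
have -> : T f (set_coord pi i (b d)) =
    T (fun x => f x * (1 - q x))%R (set_coord pi i (b d)).
  have fE : f = (fun x => f x * (1 - q x) + f x * q x)%R.
    by apply/funext => x; rewrite -mulrDr subrK mulr1.
  rewrite {1}fE mfD// -[RHS]addr0; congr (_ + _)%R.
  (* Within [2 * t] of the support of [f * q] the coordinate stays below [d]. *)
  pose t : R := (Num.min 2^-1 (d / (4 * L)))%R.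
  have t0 : (0 < t)%R by rewrite lt_min invr_gt0 ltr0n divr_gt0// mulr_gt0.
  apply: (@mf_local _ _ _ _ mfT _ _ i t 0%R) => // x.
  have t2 : (t < 2 * t)%R by lra.
  move=> /(closed_nbhd_lt t2)[y fqy xy]; rewrite set_coordE.
  have fy : spt f y by apply: spt_sub fqy => z ->; rewrite mul0r.
  have pdy : (`|pi i y| <= d / 2)%R.
    apply: (@sptS _ _ _ [set z | `|pi i z| <= d / 2]%R) fqy => [|z].
      by apply/closed_cle/LipLoc_continuous/LipLoc_norm.
    apply: contra_neqP => /negP; rewrite -ltNge => /ltW/q0 ->.
    by rewrite mulr0.
  have tt : (2 * t <= 1)%R.
    by have : (t <= 2^-1)%R; [by rewrite ge_min lexx|lra].
  have Nx : closed_nbhd 1 (spt f) x.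
    by apply: (closed_nbhd_mdist ltr01 fy); rewrite (le_trans (ltW xy)).
  have Ny := sub_closed_nbhd (ltr01 : (0 < 1 :> R)%R) fy.
  have := (klipP _ _ _).1 (pL i) _ _ Nx Ny.
  move=> hxy; rewrite /b clamp_id ?subrr//.
  have tL : (L * (2 * t) <= d / 2)%R.
    have : (t <= d / (4 * L))%R by rewrite ge_min lexx orbT.
    rewrite ler_pdivlMr ?mulr_gt0// => tL; lra.
  rewrite -(subrK (pi i y) (pi i x)) (le_trans (ler_normD _ _))//.
  have : (L * mdist x y <= L * (2 * t))%R by rewrite ler_wpM2l// ltW.
  lra.
have fE0 x : f x = 0%R -> (f x * (1 - q x))%R = 0%R by move=> ->; rewrite mul0r.
rewrite -lee_fin (le_trans (mf_le_integral frB sl L0 _))//.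
  move=> j; apply: klip_onW (bL _ d0' j) => //; apply: closed_nbhdS.
  exact: spt_sub.
rewrite EFinM fineK// lee_wpmul2l//; first by rewrite lee_fin ltW.
rewrite -[mass T]/(mu : set borelX -> _) /I [leRHS]integral_mkcond.
apply: ge0_le_integral => //.
- by apply/measurable_EFinP; apply: LipLoc_borel; apply/LipLoc_norm/LipB_LipLoc.
- apply/(measurable_restrictT _ mD); apply: (@measurable_funS _ _ _ _ setT) => //.
  by apply/measurable_EFinP; apply: LipLoc_borel; exact: LipLoc_norm.
- move=> x _; rewrite patchE; case: ifPn => [_|/negP xD].
    rewrite lee_fin normrM ler_piMr//; have /andP[u v] := q01 x.
    by rewrite ger0_norm; lra.
  rewrite q1 ?subrr ?mulr0 ?normr0//; apply: contrapT => /eqP px.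
  by apply: xD; rewrite inE.
Qed.

End integral_estimates.

Section ereal_limits.
Variable R : realType.
Local Open Scope ereal_scope.

Lemma ge0_cvge0P (a : nat -> \bar R) : (forall n, 0 <= a n) ->
  a n @[n --> \oo] --> 0 <->
  forall e, (0 < e)%R -> \forall n \near \oo, a n <= e%:E.
Proof.
move=> a0; split=> [/fine_cvgP[afin /cvgrPdist_lt ca] e e0|h].
  near=> n; have fa : a n \is a fin_num by near: n.
  rewrite -[a n]fineK// lee_fin.
  have : (`|0 - fine (a n)| < e)%R by near: n; exact: ca.
  by rewrite sub0r normrN => /ltW/(le_trans (ler_norm _)).
apply/fine_cvgP; split.
  near=> n; rewrite ge0_fin_numE//; apply: (@le_lt_trans _ _ 1%:E); rewrite ?ltry//.
  by near: n; exact: h.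
apply/cvgrPdist_le => e e0; near=> n.
have ae : a n <= e%:E by near: n; exact: h.
rewrite sub0r normrN /= ger0_norm ?fine_ge0// -lee_fin fineK//.
by rewrite ge0_fin_numE// (le_lt_trans ae) ?ltry.
Unshelve. all: by end_near. Qed.

End ereal_limits.

(** * Null sets *)

Section null_sets.
Variables (R : realType) (X : completeMetricType R) (k : nat).
Variables (T : functional X k).
Hypothesis HT : MLoc T.
Implicit Types (f g : X -> R) (pi rho : 'I_k -> X -> R).
Local Notation borelX := (g_sigma_algebraType (@open X)).
Local Notation mu := (mass_measure HT).

Let mfT : metric_functional T. Proof. by case: HT. Qed.

Lemma common_klip N (pi : 'I_k -> X -> R) : (forall i, LipLoc (pi i)) -> mbounded N ->
  exists2 L, 0 < L & forall i, klip_on (Y := R^o) L N (pi i).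
Proof.
move=> pl Nb.
have /choice[L hL] i : exists L, 0 < L /\ klip_on (Y := R^o) L N (pi i).
  by have [L L0 h] := lip_on_gt0 (pl i _ Nb); exists L.
have L0 i : 0 <= L i by apply: ltW; case: (hL i).
exists (1 + \sum_i L i); first by rewrite ltr_pwDl// sumr_ge0.
move=> i; apply: klip_onW (hL i).2 => //.
by rewrite (bigD1 i)//= addrCA lerDl addr_ge0// sumr_ge0.
Qed.

Lemma common_klip_spt f pi : LipB f -> (forall i, LipLoc (pi i)) ->
  exists2 L, 0 < L & forall i, klip_on (Y := R^o) L (closed_nbhd 1 (spt f)) (pi i).
Proof.
move=> fB pl; apply: common_klip => //; apply: mbounded_closed_nbhd.
exact: LipB_mbounded.
Qed.

Lemma mf_le_mass (M L m : R) f pi : LipB f -> (forall i, LipLoc (pi i)) ->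
  0 <= M -> 0 < L -> (forall x, `|f x| <= M) ->
  (forall i, klip_on (Y := R^o) L (closed_nbhd 1 (spt f)) (pi i)) ->
  (mass T [set x | f x != 0%R] <= m%:E)%E -> `|T f pi| <= L ^+ k * (M * m).
Proof.
move=> fB pl M0 L0 fM pL fm; rewrite -lee_fin.
rewrite (le_trans (mf_le_integral HT fB pl L0 pL))// !EFinM.
apply: lee_wpmul2l; first by rewrite lee_fin exprn_ge0// ltW.
rewrite (le_trans (integral_le_mass HT (LipB_LipLoc fB) M0 fM _))//.
  exact: (@measurableT _ borelX).
by rewrite setTI; apply: lee_wpmul2l.
Qed.

Lemma mf_strong_le_mass (M L m : R) f pi i : LipB f -> (forall i, LipLoc (pi i)) ->
  0 <= M -> 0 < L -> (forall x, `|f x| <= M) ->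
  (forall i, klip_on (Y := R^o) L (closed_nbhd 1 (spt f)) (pi i)) ->
  (mass T [set x | f x != 0%R /\ pi i x != 0%R] <= m%:E)%E ->
  `|T f pi| <= L ^+ k * (M * m).
Proof.
move=> fB pl M0 L0 fM pL fm; rewrite -lee_fin.
rewrite (le_trans (mf_strong_local HT i fB pl L0 pL))// !EFinM.
apply: lee_wpmul2l; first by rewrite lee_fin exprn_ge0// ltW.
rewrite (le_trans (integral_le_mass HT (LipB_LipLoc fB) M0 fM _))//.
  by apply: borel_nz; exact: LipLoc_borel.
apply: lee_wpmul2l => //; apply: le_trans fm.
by apply: mass_mono => x [].
Qed.

Lemma mf_null0 f pi : LipB f -> (forall i, LipLoc (pi i)) ->
  mass T [set x | f x != 0%R] = 0%E -> T f pi = 0.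
Proof.
move=> fB pl f0; have [L L0 pL] := common_klip_spt fB pl.
have [M M0 fM] := LipB_bounded fB.
apply/eqP; rewrite -normr_le0.
have := @mf_le_mass M L 0 f pi fB pl (ltW M0) L0 fM pL.
by rewrite f0 !mulr0; apply.
Qed.

Lemma mf_null_eq f g pi : LipB f -> LipB g -> (forall i, LipLoc (pi i)) ->
  mass T [set x | f x != g x] = 0%E -> T f pi = T g pi.
Proof.
move=> fB gB pl fg; apply/eqP; rewrite -subr_eq0 -mfB//; apply/eqP.
apply: mf_null0 => //; first exact: LipBB.
rewrite -fg; congr (mass T _); apply/seteqP; split => x /=; by rewrite subr_eq0.
Qed.

(** The mass does not see how a coordinate is changed on a null set, nor where
    [f] vanishes: strong locality kills every telescoping term. *)
Lemma mf_null_congr f pi rho : LipB f -> (forall i, LipLoc (pi i)) ->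
  (forall i, LipLoc (rho i)) ->
  (forall i, mass T [set x | f x != 0%R /\ pi i x != rho i x] = 0%E) ->
  T f pi = T f rho.
Proof.
move=> fB pl rl h; apply/eqP; rewrite -subr_eq0 -normr_le0.
rewrite (le_trans (mf_telescope mfT (c := 0) _ _ _ _))// ?mulr0// => s i hs.
have sl j : LipLoc (set_coord s i (fun x => pi i x - rho i x) j).
  apply: LipLoc_set_coord => [l|]; last exact: LipLocB.
  by case: (hs l) => ->.
have [L L0 pL] := common_klip_spt fB sl.
have [M M0 fM] := LipB_bounded fB.
have := @mf_strong_le_mass M L 0 f _ i fB sl (ltW M0) L0 fM pL.
rewrite !mulr0; apply; rewrite set_coordE -[X in (_ <= X)%E](h i).
by apply: mass_mono => x /=; rewrite subr_eq0.
Qed.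

End null_sets.

(** * The Borel extension *)

Section borel_extension.
Variables (R : realType) (X : completeMetricType R) (k : nat).
Local Notation borelX := (g_sigma_algebraType (@open X)).
Implicit Types (f g : X -> R) (pi : 'I_k -> X -> R) (T : functional X k).

Section limit.
Variable T : functional X k.
Hypothesis HT : MLoc T.
Local Notation mu := (mass_measure HT).

Let mfT : metric_functional T. Proof. by case: HT. Qed.

Lemma integral_dist_triangle (u v f : borelX -> R) :
  measurable_fun setT u -> measurable_fun setT v -> measurable_fun setT f ->
  (\int[mu]_x `|u x - v x|%:E <=
   \int[mu]_x `|u x - f x|%:E + \int[mu]_x `|v x - f x|%:E)%E.
Proof.
move=> um vm fm.
have m (h h' : borelX -> R) : measurable_fun setT h -> measurable_fun setT h' ->
    measurable_fun setT (fun x : borelX => (`|h x - h' x| : R)%:E).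
  move=> mh mh'; apply/measurable_EFinP; apply: measurableT_comp => //.
  exact: measurable_funB.
rewrite -ge0_integralD//; [|exact: m|exact: m].
apply: ge0_le_integral => //; [exact: m|by apply: emeasurable_funD; exact: m|].
move=> x _; rewrite -EFinD lee_fin.
by rewrite (distrC (v x)) ler_distD.
Qed.

(** Two approximations of [f] in the mean are close in the mean, and the supports
    in a fixed bounded set provide a Lipschitz constant of the coordinates that
    serves all terms. *)
Lemma ext_approx_dist f u v pi : measurable_fun setT (f : borelX -> R) ->
  ext_approx T f u -> ext_approx T f v -> (forall i, LipLoc (pi i)) ->
  forall e, 0 < e -> exists N, forall n m, (N <= n)%N -> (N <= m)%N ->
    `|T (u n) pi - T (v m) pi| <= e.
Proof.
move=> fm [uB [N [Nb _ uN]] cu] [vB [N' [N'b _ vN]] cv] pl e e0.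
have [L L0 pL] := @common_klip R X k (closed_nbhd 1 (N `|` N')) pi pl
  (mbounded_closed_nbhd 1 (mboundedU Nb N'b)).
have Lk0 : 0 < L ^+ k by rewrite exprn_gt0.
pose t := e / (2 * L ^+ k); have t0 : 0 < t by rewrite divr_gt0// mulr_gt0.
pose a (w : nat -> X -> R) n := (\int[mu]_x `|w n x - f x|%:E)%E.
have a0 w n : (0 <= a w n)%E by apply: integral_ge0 => x _; rewrite lee_fin.
have {}cu : a u n @[n --> \oo] --> 0%E by exact: cu.
have {}cv : a v n @[n --> \oo] --> 0%E by exact: cv.
have [n1 _ h1] := (ge0_cvge0P (a0 u)).1 cu _ t0.
have [n2 _ h2] := (ge0_cvge0P (a0 v)).1 cv _ t0.
exists (maxn n1 n2) => n m; rewrite !geq_max => /andP[n1n _] /andP[_ n2m].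
rewrite -mfB// -lee_fin.
have uvB : LipB (fun x => u n x - v m x) by exact: LipBB.
rewrite (le_trans (mf_le_integral HT uvB pl L0 _))//.
  move=> i; apply: klip_onW (pL i) => //; apply: closed_nbhdS.
  apply: (@subset_trans _ (spt (u n) `|` spt (v m))).
    apply: sptS => [|x]; first by apply: closedU; exact: closed_spt.
    have [ux|ux] := eqVneq (u n x) 0; last by move=> _; left; exact: spt_nz.
    by rewrite ux sub0r oppr_eq0 => vx; right; exact: spt_nz.
  by move=> x [/uN|/vN] h; [left|right].
have -> : e = L ^+ k * (t + t) by rewrite /t; field; rewrite gt_eqF.
rewrite EFinM; apply: lee_wpmul2l; first by rewrite lee_fin ltW.
rewrite -[mass T]/(mu : set borelX -> _) EFinD.
apply: (le_trans (integral_dist_triangle _ _ fm)).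
- by apply: LipLoc_borel; exact: LipB_LipLoc.
- by apply: LipLoc_borel; exact: LipB_LipLoc.
- by apply: leeD; [exact: h1|exact: h2].
Qed.

Lemma ext_approx_cvg f u pi : measurable_fun setT (f : borelX -> R) ->
  ext_approx T f u -> (forall i, LipLoc (pi i)) -> cvgn (fun n => T (u n) pi).
Proof.
move=> fm fu pl; apply: cauchy_cvg; apply: cauchy_exP => e e0.
have e20 : 0 < e / 2 by rewrite divr_gt0.
have [N hN] := ext_approx_dist fm fu fu pl e20.
exists (T (u N) pi); exists N => // n /= Nn.
rewrite -ball_normE /=; apply: (@le_lt_trans _ _ (e / 2)); last by lra.
exact: hN.
Qed.

Lemma borel_extE f u pi l : measurable_fun setT (f : borelX -> R) ->
  ext_approx T f u -> (forall i, LipLoc (pi i)) ->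
  T (u n) pi @[n --> \oo] --> l -> borel_ext T f pi = l.
Proof.
move=> fm fu pl ul; apply: xget_unique; first by exists u.
move=> l' [v fv vl]; apply/eqP; rewrite -subr_eq0 -normr_le0.
apply/ler_addgt0Pr => e e0; rewrite add0r.
have [N hN] := ext_approx_dist fm fv fu pl e0.
apply: (cvgr_to_le (cvg_norm (cvgB vl ul))).
by exists N => // n /= Nn; exact: hN.
Qed.

(** A bounded error on sets of vanishing mass is small in the mean.  This form
    of the approximation transfers between functionals by comparing masses
    only. *)
Lemma ext_approx_sets f u (D : nat -> set X) (M : R) N :
  measurable_fun setT (f : borelX -> R) -> (forall n, LipB (u n)) ->
  mbounded N -> spt f `<=` interior N -> (forall n, spt (u n) `<=` N) ->
  0 <= M -> (forall n x, `|u n x - f x| <= M) ->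
  (forall n x, ~ D n x -> u n x = f x) -> (forall n, borel (D n)) ->
  mass T (D n) @[n --> \oo] --> 0%E -> ext_approx T f u.
Proof.
move=> fm uB Nb fN uN M0 uM uD Db cD; split => //; first by exists N.
pose a n := (\int[mu]_x `|u n x - f x|%:E)%E.
have a0 n : (0 <= a n)%E by apply: integral_ge0 => x _; rewrite lee_fin.
suff : a n @[n --> \oo] --> 0%E by exact.
have cMD : (M%:E * mass T (D n))%E @[n --> \oo] --> 0%E.
  by rewrite -(mule0 M%:E); apply: cvgeZl.
apply: squeeze_cvge (cvg_cst _) cMD; apply: nearW => n; rewrite a0/=.
rewrite -[mass T]/(mu : set borelX -> _) /a -[D n]setIT -integral_indic//; last exact: Db.
rewrite -ge0_integralZl_EFin//; last first.
  by apply/measurable_EFinP; apply: measurable_indic; exact: Db.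
have um : measurable_fun setT (u n : borelX -> R).
  by apply: LipLoc_borel; exact: LipB_LipLoc.
apply: ge0_le_integral => //.
- by apply/measurable_EFinP; apply: measurableT_comp => //; exact: measurable_funB.
- apply/measurable_EFinP; apply: measurable_funM => //.
  by apply: measurable_indic; exact: Db.
- move=> x _; rewrite -EFinM lee_fin indicE.
  have [Dx|nDx] := pselect (D n x); first by rewrite mem_set// mulr1.
  by rewrite memNset// mulr0 uD// subrr normr0.
Qed.

End limit.

Section approximation.
Variables T1 T2 : functional X k.
Hypotheses (HT1 : MLoc T1) (HT2 : MLoc T2).

Lemma mass_outer_regular T (HT : MLoc T) (B : set X) (e : R) : borel B ->
  mbounded B -> 0 < e ->
  exists O, [/\ open O, B `<=` O & (mass T (O `\` B) <= e%:E)%E].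
Proof.
move=> Bm Bb e0; have Bf := mass_fin_num HT Bb.
have [_ [V [Vo BV] <-] Ve] := lb_ereal_inf_adherent e0 Bf.
exists V; split => //; rewrite -(mass_openE _ Vo) in Ve.
have Vfin : (mass T V < +oo)%E by apply: (lt_trans Ve); rewrite -/(mass T B) -(fineK Bf) -EFinD ltry.
rewrite -[mass T _]/(mass_measure HT _) measureD//; last by exact: borel_open.
rewrite setIC (setIidl BV) leeBlDr; last exact: Bf.
by rewrite addeC ltW.
Qed.

Lemma mass_shrink T (HT : MLoc T) (F : nat -> set X) (e : R) : (forall n, borel (F n)) ->
  mbounded (F 0%N) -> {homo F : n m / (n <= m)%N >-> (m `<=` n)%classic} ->
  \bigcap_n F n = set0 -> 0 < e -> \forall n \near \oo, (mass T (F n) <= e%:E)%E.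
Proof.
move=> Fm Fb Fd F0 e0.
have : mass_measure HT (F n) @[n --> \oo] --> mass_measure HT (\bigcap_n F n).
  apply: (@nonincreasing_cvg_mu _ _ _ (mass_measure HT) F) => //.
  - exact: mass_finite.
  - by rewrite F0; exact: (@measurable0 _ borelX).
  - by move=> n m nm; apply/subsetPset; exact: Fd.
rewrite F0 measure0 => /(ge0_cvge0P (fun n => mass_ge0 _ _)).
exact.
Qed.

(** [g] is cut off by [min 1 (n * c)], where [c] is the distance to the complement
    of an open set [V] that contains [B] and has almost the same masses.  The
    error lives on [V `\` B] and on the strip where [c] is below [1 / n], which
    shrinks to the empty set. *)
Lemma approx_eps (B : set X) (g : X -> R) (M r e : R) : borel B ->
  (forall x, B x -> mdist (point : X) x <= r) ->
  LipLoc g -> (forall x, `|g x| <= M) -> 0 < e ->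
  exists u D, [/\ LipB u, spt u `<=` [set x | mdist (point : X) x <= r + 1],
    forall x, `|u x - \1_B x * g x| <= M,
    forall x, ~ D x -> u x = \1_B x * g x &
    [/\ borel D, (mass T1 D <= e%:E)%E & (mass T2 D <= e%:E)%E]].
Proof.
move=> Bm Br gl gM e0.
have Bb : mbounded B by apply/(mboundedP (point : X)); exists r.
have e20 : 0 < e / 2 by rewrite divr_gt0.
have [V1 [V1o BV1 V1e]] := mass_outer_regular HT1 Bm Bb e20.
have [V2 [V2o BV2 V2e]] := mass_outer_regular HT2 Bm Bb e20.
pose W := [set x : X | mdist point x < r + 1].
pose V := V1 `&` V2 `&` W.
have Vo : open V by apply: openI; [exact: openI|exact: open_mball].
have BV : B `<=` V.
  move=> x Bx; split; first by split; [exact: BV1|exact: BV2].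
  by rewrite /W/= (le_lt_trans (Br _ Bx))// ltrDl.
have Vb : mbounded V.
  by apply/(mboundedP (point : X)); exists (r + 1) => x [_ /ltW].
pose c := cdist (~` V).
have cl : LipLoc c by exact: LipLoc_cdist.
pose E n := V `&` [set x | c x < n.+1%:R^-1].
have Em n : borel (E n).
  apply: borel_open; apply: openI => //; apply: open_clt.
  exact: LipLoc_continuous.
have Eb : mbounded (E 0%N) by apply: mboundedS Vb; exact: subIsetl.
have Ed : {homo E : n m / (n <= m)%N >-> (m `<=` n)%classic}.
  move=> n m nm x [Vx /= cx]; split => //=; apply: (lt_le_trans cx).
  by rewrite lef_pV2 ?posrE// ler_nat.
have E0 : \bigcap_n E n = set0.
  rewrite -subset0 => x h; have [Vx _] := h 0%N I.
  have c0 : 0 < c x by apply: cdist_gt0; [exact: open_closedC|by apply].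
  have [N /(_ N (leqnn N)) hN] := natSinv_lt c0.
  by have [_ /=] := h N I; rewrite ltNge (ltW hN).
near \oo => n.
have E1 : (mass T1 (E n) <= (e / 2)%:E)%E by near: n; exact: mass_shrink.
have E2 : (mass T2 (E n) <= (e / 2)%:E)%E by near: n; exact: mass_shrink.
pose q x := Num.min 1 (n.+1%:R * c x).
have ql : LipLoc q by apply: LipLoc_min; [exact: LipLoc_cst|exact: LipLocZ].
have c0 x : 0 <= c x by exact: cdist_ge0.
have q01 x : 0 <= q x <= 1 by rewrite le_min ler01/= mulr_ge0//= ge_min lexx.
have qV x : ~ V x -> q x = 0.
  by move=> Vx; rewrite /q /c cdist0// mulr0 min_r.
have qD x : V x -> ~ E n x -> q x = 1.
  move=> Vx nEx; rewrite /q min_l// -ler_pdivrMl// mulr1 leNgt; apply/negP => h.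
  by apply: nEx.
pose D := (V `\` B) `|` E n.
have uB : LipB (fun x => g x * q x).
  apply/LipBP; split; first exact: LipLocM.
  by apply: mboundedS Vb => x /=; apply: contra_neqP => /qV ->; rewrite mulr0.
have mB : borel (V `\` B).
  by apply: (@measurableD _ borelX) => //; exact: borel_open.
exists (fun x => g x * q x), D; split => //.
- apply: (@sptS _ _ _ [set x | mdist point x <= r + 1]) => [|x].
    by apply: closed_cle; apply: LipLoc_continuous; exact: LipLoc_mdist.
  apply: contra_neqP => xr; rewrite qV ?mulr0// => -[_ /= h]; apply: xr.
  exact: ltW.
- move=> x; rewrite [_ * g x]mulrC -mulrBr normrM -[leRHS]mulr1 ler_pM//.
  have /andP[h1 h2] := q01 x; rewrite indicE.
  by case: (x \in B); rewrite ler_norml; apply/andP; split; rewrite /=; lra.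
- move=> x nDx; rewrite [RHS]mulrC; congr (_ * _); rewrite indicE.
  have [Bx|nBx] := pselect (B x).
    by rewrite mem_set// qD//; [exact: BV|move=> Ex; apply: nDx; right].
  rewrite memNset// qV// => Vx; apply: nDx; left; by split.
- have eE : e%:E = ((e / 2)%:E + (e / 2)%:E)%E by rewrite -EFinD -splitr.
  split; first exact: (@measurableU _ borelX _ _ mB (Em n)).
    rewrite eE (le_trans (outer_measureU2 (mass_outer HT1) _ _))//.
    apply: leeD => //; apply: le_trans V1e; apply: mass_mono.
    by apply: setSD => x [[]].
  rewrite eE (le_trans (outer_measureU2 (mass_outer HT2) _ _))//.
  apply: leeD => //; apply: le_trans V2e; apply: mass_mono.
  by apply: setSD => x [[]].
Unshelve. all: by end_near. Qed.

(** One sequence serves two functionals, so that their extensions and that of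
    their difference are limits along the same sequence. *)
Lemma approx_exists (B : set X) (g : X -> R) (M : R) : borel B -> mbounded B ->
  LipLoc g -> (forall x, `|g x| <= M) ->
  exists u D N, [/\ forall n, LipB (u n),
    [/\ mbounded N, closure B `<=` interior N & forall n, spt (u n) `<=` N],
    forall n x, `|u n x - \1_B x * g x| <= M,
    forall n x, ~ D n x -> u n x = \1_B x * g x &
    [/\ forall n, borel (D n), mass T1 (D n) @[n --> \oo] --> 0%E &
        mass T2 (D n) @[n --> \oo] --> 0%E]].
Proof.
move=> Bm Bb gl gM; have [r Br] := (mboundedP (point : X) _).1 Bb.
have h n := approx_eps Bm Br gl gM (harmonic_gt0 n).
have /choice[uD huD] n : exists p : (X -> R) * set X, [/\ LipB p.1,
    spt p.1 `<=` [set x | mdist (point : X) x <= r + 1],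
    forall x, `|p.1 x - \1_B x * g x| <= M,
    forall x, ~ p.2 x -> p.1 x = \1_B x * g x &
    [/\ borel p.2, (mass T1 p.2 <= (harmonic n)%:E)%E & (mass T2 p.2 <= (harmonic n)%:E)%E]].
  by have [u [D hD]] := h n; exists (u, D).
have cvg0 T : (forall n, (mass T (uD n).2 <= (harmonic n)%:E)%E) ->
    mass T (uD n).2 @[n --> \oo] --> 0%E.
  move=> hT; apply: (@squeeze_cvge _ _ _ _ (fun=> 0%E) _ (fun n => (@harmonic R n)%:E)).
  - by apply: nearW => n; rewrite mass_ge0 hT.
  - exact: cvg_cst.
  - by apply: cvg_EFin; [exact: nearW|exact: cvg_harmonic].
exists (fun n => (uD n).1), (fun n => (uD n).2), [set x | mdist (point : X) x < r + 2].
split; [by move=> n; case: (huD n)|split|by move=> n; case: (huD n)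
  |by move=> n; case: (huD n)|split].
- by apply/(mboundedP (point : X)); exists (r + 2) => x /ltW.
- rewrite (interior_id _).1; last exact: open_mball.
  move=> x /(closure_mdist (ltr01 : 0 < 1 :> R))[y /Br yr xy] /=.
  rewrite (le_lt_trans (metric_triangle _ y _))// (metric_sym y).
  by lra.
- move=> n x; have [_ /(_ x) h' _ _ _] := huD n => /h' /= xr.
  by apply: (le_lt_trans xr); lra.
- by move=> n; case: (huD n) => _ _ _ _ [].
- by apply: cvg0 => n; case: (huD n) => _ _ _ _ [].
- by apply: cvg0 => n; case: (huD n) => _ _ _ _ [].
Qed.

End approximation.

End borel_extension.

(** * Functionals that agree on test forms *)

Section congruence.
Variables (R : realType) (X : completeMetricType R) (k : nat).
Implicit Types (T : functional X k).

Lemma eq_functional_sym T T' : eq_functional T T' -> eq_functional T' T.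
Proof. by move=> h f pi fp; rewrite h. Qed.

Lemma metric_functional_eq T T' : eq_functional T T' ->
  metric_functional T -> metric_functional T'.
Proof.
move=> E [[h1 h2] h3 h4]; split; first split.
- move=> a f g pi [fB pl] gB; rewrite -!E//; first by apply: h1.
  by split => //; apply: LipBD => //; exact: LipBZ.
- move=> a f pi i u v [fB pl] ul vl; rewrite -!E//; first by apply: h2.
  + by split => //; exact: LipLoc_set_coord.
  + by split => //; exact: LipLoc_set_coord.
  + split => //; apply: LipLoc_set_coord => //; apply: LipLocD => //.
    exact: LipLocZ.
- move=> f pi pi_ fp fp_ c1 c2; rewrite -E//.
  under eq_fun do rewrite -E//.
  exact: h3.
- by move=> f pi fp h; rewrite -E//; exact: h4.
Qed.

Lemma MLoc_eq T T' : eq_functional T T' -> MLoc T -> MLoc T'.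
Proof.
move=> E [h1 h2 h3]; rewrite /MLoc -(mass_eq E); split => //.
exact: metric_functional_eq E h1.
Qed.

Lemma borel_ext_eq T T' f pi : eq_functional T T' ->
  (forall i, LipLoc (pi i)) -> borel_ext T f pi = borel_ext T' f pi.
Proof.
move=> E pl; rewrite /borel_ext /ext_approx (mass_eq E); congr xget.
apply/seteqP; split => l /= [u [uB h1 h2] ul]; exists u => //;
  move: ul; (rewrite (_ : (fun n => T (u n) pi) = (fun n => T' (u n) pi)) //;
  by apply/funext => n; rewrite E).
Qed.

Lemma LipLoc_pullback (Y : metricType R) (p : X -> Y) (f : Y -> R) :
  lip_on setT p -> LipLoc f -> LipLoc (f \o p).
Proof.
move=> /lip_on_gt0[L L0 pL] fl; apply: LipLocP => B [M hM].
have pBb : mbounded (p @` B).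
  exists (L * M) => _ _ [x Bx <-] [y By <-]; rewrite (le_trans (pL _ _ _ _))//.
  by apply: ler_wpM2l; [exact: ltW|exact: hM].
have [K K0 hK] := LipLoc_klip fl pBb.
exists (K * L) => x y Bx By /=.
apply: (le_trans (hK _ _ (imageP p Bx) (imageP p By))).
by rewrite -mulrA; apply: ler_wpM2l; [exact: ltW|exact: pL].
Qed.

Lemma IRLoc_eq T T' : eq_functional T T' -> IRLoc T -> IRLoc T'.
Proof.
move=> E [h1 h2 h3]; split; first exact: MLoc_eq E h1.
  by rewrite -(mass_eq E).
move=> B p Bm Bb pl; have [th th1 hth] := h3 B p Bm Bb pl.
exists th => // f tau ft; rewrite -hth// /push_restr; apply: borel_ext_eq.
  exact: eq_functional_sym.
by move=> i; apply: LipLoc_pullback => //; case: ft.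
Qed.

End congruence.

(** * Isometric embeddings *)

Section isometry.
Variables (R : realType) (Y X : completeMetricType R) (j : Y -> X).
Hypothesis ij : isometric_embedding j.

Lemma iso_inj : injective j.
Proof.
by move=> y y' h; apply: mdist_positivity; rewrite -ij h mdistxx.
Qed.

Lemma iso_retraction : exists v : X -> Y, cancel j v.
Proof.
exists (fun x => xget (point : Y) [set y | j y = x]) => y; apply: iso_inj.
exact: (@xgetPex _ point [set z | j z = j y] (ex_intro _ y erefl)).
Qed.

Lemma iso_lip : lip_on setT j.
Proof. by exists 1 => x y _ _; rewrite ij mul1r. Qed.

Lemma iso_continuous : continuous j.
Proof.
move=> y; apply/metricType_numDomainType.cvgrPdist_lt => e e0.
by apply/nbhs_mdistP; exists e => // z; rewrite ij.
Qed.

Lemma iso_mbounded (A : set X) : mbounded A -> mbounded (j @^-1` A).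
Proof. by move=> [M h]; exists M => x y Ax Ay; rewrite -ij; exact: h. Qed.

Lemma iso_mbounded_image (B : set Y) : mbounded B -> mbounded (j @` B).
Proof. by move=> [M h]; exists M => _ _ [x Bx <-] [y By <-]; rewrite ij; exact: h. Qed.

Lemma iso_open (O : set X) : open O -> open (j @^-1` O).
Proof. by move=> Oo; apply: open_comp => // x _; exact: iso_continuous. Qed.

Lemma iso_closed (C : set X) : closed C -> closed (j @^-1` C).
Proof. by move=> Cc; apply: closed_comp => // x _; exact: iso_continuous. Qed.

(** The image is complete, hence closed. *)
Lemma iso_closed_image (C : set Y) : closed C -> closed (j @` C).
Proof.
move=> Cc x xC.
have /choice[c hc] (n : nat) : exists y, C y /\ mdist x (j y) < n.+1%:R^-1.
  have n0 : 0 < n.+1%:R^-1 :> R by rewrite invr_gt0.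
  by have [_ [y Cy <-] h] := closure_mdist n0 xC; exists y.
have cx : forall e, 0 < e -> \forall n \near \oo, mdist x (j (c n)) < e.
  move=> e e0; near=> n; apply: (lt_trans (hc n).2).
  by near: n; exact: near_infty_natSinv_lt (PosNum e0).
have cc : cvg (c @ \oo).
  apply: cauchy_cvg; apply: cauchy_exP => e e0.
  have [N _ hN] := cx (e / 2) (divr_gt0 e0 (ltr0Sn R 1)).
  exists (c N); exists N => // n /= Nn; rewrite ballEmdist /=.
  rewrite -ij (le_lt_trans (metric_triangle _ x _))// [ltRHS]splitr.
  by rewrite ltrD// ?hN//= metric_sym hN/=.
exists (lim (c @ \oo)).
  apply: (closed_cvg C) cc => //; apply: nearW => n; exact: (hc n).1.
apply/esym/mdist_positivity/eqP; rewrite eq_le mdist_ge0 andbT.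
apply/ler_addgt0Pr => e e0; rewrite add0r.
near \oo => n; rewrite (le_trans (metric_triangle _ (j (c n)) _))//.
rewrite [leRHS]splitr lerD//; first by near: n; apply/filterS: (cx _ (divr_gt0 e0 (ltr0Sn R 1))) => n /ltW.
rewrite ij metric_sym; near: n.
exact: (metricType_numDomainType.cvgr_dist_le cc (divr_gt0 e0 (ltr0Sn R 1))).
Unshelve. all: by end_near. Qed.

Lemma iso_range_closed : closed (range j).
Proof. by apply: iso_closed_image; exact: closedT. Qed.

Lemma iso_open_trace (O : set Y) : open O -> exists2 V, open V & j @^-1` V = O.
Proof.
move=> Oo; exists (~` (j @` (~` O))).
  by apply: closed_openC; apply: iso_closed_image; exact: open_closedC.
apply/seteqP; split => y /=.
  by move=> h; apply: contrapT => nOy; apply: h; exists y.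
by move=> Oy [z nOz /iso_inj zy]; apply: nOz; rewrite zy.
Qed.

Lemma iso_trace_bounded (V : set X) : mbounded (j @^-1` V) ->
  exists O, [/\ open O, mbounded O & j @^-1` (V `&` O) = j @^-1` V].
Proof.
move=> /iso_mbounded_image/mbounded_open[W [Wo Wb VW]]; exists W; split => //.
apply/seteqP; split => y; first by case.
by move=> Vy; split => //; apply: VW; exists y.
Qed.

Lemma iso_LipLoc (f : X -> R) : LipLoc f -> LipLoc (f \o j).
Proof. by apply: LipLoc_pullback; exact: iso_lip. Qed.

Lemma iso_spt (f : X -> R) : spt (f \o j) `<=` j @^-1` spt f.
Proof.
apply: sptS => [|x fx]; last exact: spt_nz.
by apply: iso_closed; exact: closed_spt.
Qed.

Lemma iso_LipB (f : X -> R) : LipB f -> LipB (f \o j).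
Proof.
move=> /LipBP[fl fb]; apply/LipBP; split; first exact: iso_LipLoc.
exact: (iso_mbounded fb).
Qed.

Lemma iso_closed_nbhd r s (A : set Y) (B : set X) y : 0 < s -> r < s ->
  A `<=` j @^-1` B -> closed_nbhd r A y -> closed_nbhd s B (j y).
Proof.
move=> s0 rs AB /(closed_nbhd_lt rs)[z /AB Bz yz].
by apply: (closed_nbhd_mdist s0 (Bz : B (j z))); rewrite ij ltW.
Qed.

Lemma klip_extend (L : R) (S : set Y) (f : Y -> R) : 0 <= L ->
  (forall y z, S y -> S z -> `|f y - f z| <= L * mdist y z) ->
  exists F : X -> R, (forall x x', `|F x - F x'| <= L * mdist x x') /\
    forall y, S y -> F (j y) = f y.
Proof.
move=> L0 fL; have [g gj] := iso_retraction.
have h x x' : (j @` S) x -> (j @` S) x' ->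
    `|f (g x) - f (g x')| <= L * mdist x x'.
  by move=> [y Sy <-] [z Sz <-]; rewrite !gj ij; exact: fL.
exists (mcshane L (j @` S) (f \o g)); split.
  by move=> x x'; apply: mcshane_lip.
by move=> y Sy; rewrite (mcshaneE L0 h) /= ?gj//; exists y.
Qed.

Lemma LipB_extend (f : Y -> R) : LipB f -> exists F : X -> R,
  LipB F /\ F \o j = f.
Proof.
move=> fB; have [[L0 hL] _ _] := fB; have [L L0' fL] := lip_on_gt0 (ex_intro _ L0 hL).
have [F [FL Fj]] : exists F : X -> R, (forall x x', `|F x - F x'| <= L * mdist x x') /\
    forall y, setT y -> F (j y) = f y.
  by apply: klip_extend; [exact: ltW|exact/klipP].
have [_ fb] := (LipBP _).1 fB.
have [s [sB s01 s1]] := cutoff_exists (iso_mbounded_image fb).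
exists (fun x => s x * F x); split.
  by apply: LipBM => //; exact: LipLoc_lip FL.
apply/funext => y /=; rewrite Fj//.
have [->|fy] := eqVneq (f y) 0; first by rewrite mulr0.
by rewrite s1 ?mul1r//; exists y.
Qed.

Lemma Lip1_extend (f : Y -> R) : Lip1 f -> exists F : X -> R,
  Lip1 F /\ F \o j = f.
Proof.
move=> /klipP f1; have [F [FL Fj]] := klip_extend ler01 f1.
exists F; split; first by apply/klipP => x y _ _; exact: FL.
by apply/funext => y; exact: Fj.
Qed.

Lemma borel_iso (B : set X) : borel B -> borel (j @^-1` B).
Proof.
suff : <<s @open X >> `<=` [set B | borel (j @^-1` B)] by exact.
apply: smallest_sub; last by move=> V Vo; apply: borel_open; exact: iso_open.
split => /=.
- by rewrite preimage_set0; exact: (@measurable0 _ (g_sigma_algebraType (@open Y))).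
- move=> A Am; rewrite setTD preimage_setC.
  exact: (@measurableC _ (g_sigma_algebraType (@open Y))).
- move=> F Fm; rewrite preimage_bigcup.
  apply: (@bigcup_measurable _ (g_sigma_algebraType (@open Y))) => n _.
  exact: Fm.
Qed.

(** Traces of Borel sets form a sigma-algebra that contains the open sets. *)
Lemma borel_trace (A : set Y) : borel A -> exists2 B, borel B & j @^-1` B = A.
Proof.
suff : <<s @open Y >> `<=` [set A | exists2 B, borel B & j @^-1` B = A].
  by move=> /(_ A) h /h.
apply: smallest_sub; last first.
  by move=> O /iso_open_trace[V Vo <-]; exists V => //; exact: borel_open.
split => /=.
- by exists set0; [exact: (@measurable0 _ (g_sigma_algebraType (@open X)))|exact: preimage_set0].
- move=> A' [B Bm <-]; exists (~` B); last by rewrite setTD preimage_setC.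
  exact: (@measurableC _ (g_sigma_algebraType (@open X))).
- move=> F h; have /choice[G hG] : forall n, exists B, borel B /\ j @^-1` B = F n.
    by move=> n; have [B ? ?] := h n; exists B.
  exists (\bigcup_n G n).
    apply: (@bigcup_measurable _ (g_sigma_algebraType (@open X))) => n _.
    exact: (hG n).1.
  by rewrite preimage_bigcup; apply: eq_bigcupr => n _; exact: (hG n).2.
Qed.

End isometry.

Lemma klip_within (R : realType) (X Y : metricType R) (A : set X) (f : X -> Y) :
  lip_on A f -> {within A, continuous f}.
Proof.
move=> /lip_on_gt0[L L0 fL]; apply/subspace_continuousP => x Ax.
apply/metricType_numDomainType.cvgrPdist_lt => e e0.
apply/nbhs_mdistP; exists (e / L); first by rewrite divr_gt0.
move=> y xy Ay; rewrite (le_lt_trans (fL _ _ Ax Ay))//.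
by rewrite mulrC -ltr_pdivlMr.
Qed.

Lemma compact_klip_preimage (R : realType) (X Y : metricType R) (A : set X) (C : set Y)
  (f : X -> Y) : compact A -> lip_on A f -> closed C -> compact (A `&` f @^-1` C).
Proof.
move=> Ac /lip_on_gt0[L L0 fL] Cc; apply: (subclosed_compact _ Ac); last exact: subIsetl.
have Acl : closed A by apply: compact_closed => //; exact: metric_hausdorff.
move=> x xAC; have Ax : A x by apply: Acl; apply: closureS xAC; exact: subIsetl.
split => //; apply: Cc => V /nbhs_mdistP[e e0 eV].
have [y [Ay Cy] xy] := closure_mdist (divr_gt0 e0 L0) xAC.
exists (f y); split => //; apply: eV; rewrite (le_lt_trans (fL _ _ Ax Ay))//.
by rewrite mulrC -ltr_pdivlMr.
Qed.

(** * Currents under isometric embeddings *)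

Lemma iso_compact_preimage (R : realType) (Y X : completeMetricType R) (j : Y -> X)
  (K : set X) : isometric_embedding j -> compact K -> compact (j @^-1` K).
Proof.
move=> ij Kc; have [g gj] := iso_retraction ij.
have Kr : compact (K `&` range j) by apply: compact_closedI => //; exact: iso_range_closed.
rewrite (_ : _ @^-1` _ = g @` (K `&` range j)); last first.
  apply/seteqP; split => y.
    by move=> Ky; exists (j y); rewrite ?gj//; split => //; exists y.
  by move=> [x [Kx [z _ zx]] <-]; rewrite -zx gj /= zx.
apply: continuous_compact => //; apply: klip_within; exists 1.
by move=> _ _ [_ [y _ <-]] [_ [z _ <-]]; rewrite !gj ij mul1r.
Qed.

Section transfer.
Variables (R : realType) (Y X : completeMetricType R) (j : Y -> X).
Hypothesis ij : isometric_embedding j.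
Variables (k : nat) (S : functional Y k).
Local Notation T := (push_functional j S).
Local Notation borelX := (g_sigma_algebraType (@open X)).

Lemma push_metric_functional : metric_functional S -> metric_functional T.
Proof.
move=> HS; have [[h1 h2] h3 h4] := HS.
have lj f : LipLoc f -> LipLoc (f \o j) by exact: iso_LipLoc.
have bj f : LipB f -> LipB (f \o j) by exact: iso_LipB.
split; first split.
- move=> a f g pi [fB pl] gB; apply: (h1 a (f \o j) (g \o j)); last exact: bj.
  by split; [exact: bj|move=> i; exact: lj].
- move=> a f pi i u v [fB pl] ul vl.
  have E w : (fun l => set_coord pi i w l \o j) =
      set_coord (fun l => pi l \o j) i (w \o j).
    by apply/funext => l; rewrite /set_coord; case: ifP.
  rewrite /push_functional !E; apply: h2; [|exact: lj|exact: lj].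
  by split; [exact: bj|move=> l; exact: lj].
- move=> f pi pi_ [fB pl] fp_ c1 c2; apply: h3.
  + by split; [exact: bj|move=> l; exact: lj].
  + by move=> n; split; [exact: bj|move=> l; apply: lj; case: (fp_ n)].
  + by move=> i y; exact: c1.
  + move=> i B Bb; have [L hL] := c2 i _ (iso_mbounded_image ij Bb).
    exists L => n y z By Bz /=; rewrite -[mdist y z]ij; exact: hL (imageP j By) (imageP j Bz).
- move=> f pi [fB pl] [i [d [c [d0 hc]]]]; apply: h4.
    by split; [exact: bj|move=> l; exact: lj].
  exists i, (d / 2), c; split; first by rewrite divr_gt0.
  move=> y hy; apply: hc; apply: (iso_closed_nbhd ij d0 _ _ hy).
    by lra.
  exact: iso_spt.
Qed.

Lemma mass_open_push O : (mass_open T O <= mass_open S (j @^-1` O))%E.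
Proof.
apply: ge_ereal_sup => _ [N [f [pi [fp fO f1 ->]]]].
apply: ereal_sup_ubound => /=.
exists N, (fun l => f l \o j), (fun l i => pi l i \o j); split => //.
- move=> l; have [fB pl] := fp l; split; first exact: iso_LipB.
  move=> i; apply/klipP => y z _ _ /=; rewrite -ij.
  by have /klipP := pl i; apply.
- by move=> l y /(iso_spt ij) /(fO l).
- by move=> y; exact: f1.
Qed.

Lemma mass_push O : open O -> (mass T O <= mass S (j @^-1` O))%E.
Proof.
by move=> Oo; rewrite !mass_openE//; [exact: mass_open_push|exact: iso_open].
Qed.

Lemma iso_compl_range : open (~` range j).
Proof. by apply: closed_openC; exact: iso_range_closed. Qed.

Lemma mass_push_range : MLoc S -> mass T (~` range j) = 0%E.
Proof.
move=> HS; apply/eqP; rewrite eq_le mass_ge0 andbT (le_trans (mass_push iso_compl_range))//.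
rewrite (_ : _ @^-1` _ = set0); first by rewrite (mass_set0 HS).
by rewrite -subset0 => y /= h; apply: h; exists y.
Qed.

Lemma push_compact_remainder O (K : set Y) : open O -> compact K ->
  (mass T (O `\` (j @` K)) <= mass S ((j @^-1` O) `\` K))%E.
Proof.
move=> Oo Kc; have Kcl : closed K by apply: compact_closed => //; exact: metric_hausdorff.
rewrite (le_trans (mass_push _))//.
  by rewrite setDE; apply: openI => //; apply/closed_openC/iso_closed_image.
apply: mass_mono => y [/= Oy nKy]; split => // Ky; apply: nKy; by exists y.
Qed.

Lemma push_MLoc : MLoc S -> MLoc T.
Proof.
move=> HS; have [h1 h2 h3] := HS; split; first exact: push_metric_functional.
- move=> O Oo Ob; apply: le_lt_trans (mass_push Oo) _.
  by apply: mass_finite => //; exact: iso_mbounded.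
- move=> O e Oo Ob e0; have [K [Kc KO] Ke] := h3 _ e (iso_open ij Oo) (iso_mbounded ij Ob) e0.
  exists (j @` K); last exact: le_lt_trans (push_compact_remainder Oo Kc) Ke.
  split; last by move=> _ [y /KO Oy <-].
  apply: continuous_compact => //; apply: continuous_subspaceT.
  exact: iso_continuous.
Qed.

Section pull.
Hypotheses (HS : metric_functional S) (HT : MLoc T) (T0 : mass T (~` range j) = 0%E).
Local Notation mu := (mass_measure HT).

(** Forms on the subspace extend without increasing the Lipschitz constants.  The
    extended first components add up to at most 1 on the range only, so that
    their values are estimated by integrals, which ignore the complement of the
    range. *)
Lemma mass_pull_open V : open V -> (mass_open S (j @^-1` V) <= mass T V)%E.
Proof.
move=> Vo; apply: ge_ereal_sup => _ [N [f [pi [fp fV f1 ->]]]].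
have /choice[F hF] l : exists F : X -> R, LipB F /\ F \o j = f l.
  by apply: LipB_extend => //; case: (fp l).
have /choice[P hP] l : exists P : 'I_k -> X -> R, forall i, Lip1 (P i) /\ P i \o j = pi l i.
  have /choice[P hP] i : exists P : X -> R, Lip1 P /\ P \o j = pi l i.
    by apply: Lip1_extend => //; case: (fp l).
  by exists P.
have Fm l : measurable_fun setT (fun x : borelX => `|F l x|%:E).
  apply/measurable_EFinP; apply: LipLoc_borel; apply: LipLoc_norm.
  by apply: LipB_LipLoc; case: (hF l).
have le1 l : (`|S (f l) (pi l)|%:E <= \int[mu]_x `|F l x|%:E)%E.
  have -> : S (f l) (pi l) = T (F l) (P l).
    rewrite /push_functional (hF l).2; congr (S _ _).
    by apply/funext => i; rewrite (hP l i).2.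
  have pl i : LipLoc (P l i) by apply: Lip1_LipLoc; case: (hP l i).
  have := @mf_le_integral _ _ _ _ HT 1 (F l) (P l) (hF l).1 pl ltr01.
  rewrite expr1n mul1e; apply => i; have /klipP h := (hP l i).1.
  by apply/klipP => x y _ _; exact: h.
apply: (@le_trans _ _ (\sum_l \int[mu]_x `|F l x|%:E)%E).
  rewrite -sumEFin; apply: lee_sum => l _; apply: le_trans (le1 l).
  by rewrite lee_fin ler_norm.
rewrite -ge0_integral_sum//.
have [C C0 hC] : exists2 C, 0 <= C & forall x, \sum_l `|F l x| <= C.
  have /choice[M hM] l : exists M, 0 < M /\ forall x, `|F l x| <= M.
    by have [M ? ?] := LipB_bounded (hF l).1; exists M.
  exists (\sum_l M l); first by apply: sumr_ge0 => l _; apply: ltW; case: (hM l).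
  by move=> x; apply: ler_sum => l _; case: (hM l).
have Vm : measurable (V : set borelX) by exact: borel_open.
have Rm : measurable (~` range j : set borelX) by apply: borel_open; exact: iso_compl_range.
have -> : mass T V = (\int[mu]_x ((\1_V x)%:E + (C * \1_(~` range j) x)%:E))%E.
  rewrite ge0_integralD//.
  - under [X in (_ = _ + X)%E]eq_integral do rewrite EFinM.
    rewrite ge0_integralZl_EFin ?integral_indic//; last first.
      by apply/measurable_EFinP; exact: measurable_indic.
    by rewrite !setIT [X in (_ = _ + _ * X)%E]T0 mule0 adde0.
  - by apply/measurable_EFinP; exact: measurable_indic.
  - by move=> x _; rewrite lee_fin mulr_ge0.
  - by apply/measurable_EFinP; apply: measurable_funM.
apply: ge0_le_integral => //.
- by move=> x _; apply: sume_ge0 => l _; rewrite lee_fin.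
- exact: emeasurable_sum.
- apply: emeasurable_funD.
    by apply/measurable_EFinP; exact: measurable_indic.
  by apply/measurable_EFinP; apply: measurable_funM.
- move=> x _; rewrite sumEFin -EFinD lee_fin.
  have [[y _ yx]|nx] := pselect (range j x); last first.
    rewrite [\1_(~` _) x]indicE mem_set// mulr1.
    by rewrite (le_trans (hC x))// lerDr.
  rewrite -yx [\1_(~` _) _]indicE memNset; last by apply; exists y.
  rewrite mulr0 addr0 indicE.
  have [Vx|nVx] := pselect (V (j y)).
    rewrite mem_set//; apply: le_trans (f1 y); rewrite le_eqVlt; apply/orP; left.
    by apply/eqP; apply: eq_bigr => l _; rewrite -(hF l).2.
  rewrite memNset// big1// => l _.
  rewrite -[F l (j y)]/((F l \o j) y) (hF l).2 (@spt_out _ _ (f l)) ?normr0//.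
  by move=> /(fV l).
Qed.

Lemma mass_pull A : (mass S (j @^-1` A) <= mass T A)%E.
Proof.
apply: le_ereal_inf_tmp => _ [V [Vo AV] <-].
rewrite -(mass_openE T Vo); apply: le_trans (mass_pull_open Vo).
by apply: mass_le_open => [|y /AV//]; exact: iso_open.
Qed.

Lemma pull_MLoc : MLoc S.
Proof.
have [_ h2 h3] := HT; split => //.
- move=> O Oo Ob; rewrite -(_ : j @^-1` (j @` O) = O); last first.
    apply/seteqP; split => y; last by exists y.
    by move=> [z Oz /(iso_inj ij) <-].
  apply: le_lt_trans (mass_pull _) _; apply: mass_finite => //.
  exact: iso_mbounded_image.
- move=> O e /(iso_open_trace ij)[V Vo <-] /(iso_trace_bounded ij)[V' [V'o V'b VE]] e0.
  have [K [Kc KW] Ke] := h3 _ e (openI Vo V'o) (mboundedS (@subIsetr _ _ _) V'b) e0.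
  exists (j @^-1` K).
    by split; [exact: iso_compact_preimage ij Kc|rewrite -VE => y /= /KW].
  rewrite -VE -[X in mass S X]/(j @^-1` ((V `&` V') `\` K)).
  exact: le_lt_trans (mass_pull _) Ke.
Qed.

End pull.

Lemma LipLoc_indic_mul (Z : completeMetricType R) (B : set Z) (g : Z -> R) : borel B ->
  LipLoc g -> measurable_fun setT
    ((fun x => \1_B x * g x) : g_sigma_algebraType (@open Z) -> R).
Proof.
move=> Bm gl; apply: measurable_funM; first exact: measurable_indic.
exact: LipLoc_borel.
Qed.

Lemma spt_indic_mul (Z : completeMetricType R) (B : set Z) (g : Z -> R) :
  spt (fun x => \1_B x * g x) `<=` closure B.
Proof.
apply: closureS => x /=; apply: contra_neqP => nBx.
by rewrite indicE memNset// mul0r.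
Qed.

(** Approximants on the ambient space restrict to approximants on the subspace:
    the sets where they are wrong have vanishing mass there too. *)
Lemma borel_ext_push (B : set X) (g : X -> R) (M : R) (pi : 'I_k -> X -> R) :
  MLoc S -> MLoc T -> mass T (~` range j) = 0%E -> borel B -> mbounded B ->
  LipLoc g -> (forall x, `|g x| <= M) -> (forall i, LipLoc (pi i)) ->
  borel_ext T (fun x => \1_B x * g x) pi =
  borel_ext S (fun y => \1_(j @^-1` B) y * g (j y)) (fun i => pi i \o j).
Proof.
move=> HS HT T0 Bm Bb gl gM pl; have [mS _ _] := HS.
have M0 : 0 <= M := le_trans (normr_ge0 _) (gM point).
have [u [D [N [uB [Nb BN uN] uM uD [Dm D0 _]]]]] := approx_exists HT HT Bm Bb gl gM.
have fm := LipLoc_indic_mul Bm gl.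
have gjl : LipLoc (g \o j) by exact: iso_LipLoc.
have fjm := LipLoc_indic_mul (borel_iso ij Bm) gjl.
have ux : ext_approx T (fun x => \1_B x * g x) u.
  apply: (ext_approx_sets HT fm uB Nb _ uN M0 uM uD Dm D0).
  by apply: subset_trans BN; exact: spt_indic_mul.
have cT := ext_approx_cvg HT fm ux pl.
have iE y : \1_(j @^-1` B) y = \1_B (j y) :> R by rewrite !indicE; congr (_%:R).
have uy : ext_approx S (fun y => \1_(j @^-1` B) y * g (j y)) (fun n => u n \o j).
  apply: (ext_approx_sets (M := M) (N := j @^-1` N) (D := fun n => j @^-1` D n) HS fjm) => //.
  - by move=> n; exact: iso_LipB.
  - exact: iso_mbounded.
  - apply: (@subset_trans _ (j @^-1` interior N)).
      apply: (@subset_trans _ (j @^-1` closure B)); last by move=> y /BN.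
      apply: sptS => [|y]; first by apply: iso_closed => //; exact: closed_closure.
      apply: contra_neqP => nBy; rewrite iE indicE memNset ?mul0r// => By.
      by apply: nBy; exact: subset_closure.
    rewrite -open_subsetE; first by move=> y /interior_subset.
    by apply: iso_open => //; exact: open_interior.
  - by move=> n y /(iso_spt ij) /(uN n).
  - by move=> n y /=; rewrite iE.
  - by move=> n y /= /uD; rewrite iE.
  - by move=> n; exact: borel_iso.
  - apply: squeeze_cvge (cvg_cst 0%E) D0; apply: nearW => n.
    by rewrite mass_ge0 /=; exact: mass_pull.
rewrite (borel_extE HT fm ux pl cT); apply/esym.
by apply: (borel_extE HS fjm uy) => // i; exact: iso_LipLoc.
Qed.

End transfer.

Section rectifiable_transfer.
Variables (R : realType) (Y X : completeMetricType R) (j : Y -> X).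
Hypothesis ij : isometric_embedding j.

Lemma compact_rectifiable_image k (K : set Y) : compact_rectifiable k K ->
  compact_rectifiable k (j @` K).
Proof.
move=> [N [C [g [h ->]]]]; exists N, C, (fun i => j \o g i); split.
  move=> i; have [Cc [L hL]] := h i; split => //; exists L => x y Cx Cy /=.
  by rewrite ij; exact: hL.
rewrite image_bigcup; apply: eq_bigcupr => i _; by rewrite image_comp.
Qed.

Lemma compact_rectifiable_preimage k (K : set X) : compact_rectifiable k K ->
  compact_rectifiable k (j @^-1` K).
Proof.
move=> [N [C [g [h ->]]]]; have [v vj] := iso_retraction ij.
exists N, (fun i => C i `&` g i @^-1` range j), (fun i => v \o g i); split.
  move=> i; have [Cc gL] := h i; split.
    by apply: compact_klip_preimage => //; exact: iso_range_closed.
  have [L hL] := gL; exists L => x y [Cx [a _ ax]] [Cy [b _ bY]] /=.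
  rewrite -ax -bY !vj -ij ax bY; exact: hL.
rewrite preimage_bigcup; apply: eq_bigcupr => i _; apply/seteqP; split => y.
  by move=> [x Cx gx]; exists x; rewrite /= ?gx ?vj//; split => //; exists y.
by move=> [x [Cx [z _ zx]] /= <-]; exists x => //; rewrite -zx vj.
Qed.

Lemma compact_rectifiable_compact (Z : completeMetricType R) k (K : set Z) :
  compact_rectifiable k K -> compact K.
Proof.
move=> [N [C [g [h ->]]]]; rewrite -bigsetU_fset_set; last exact: finite_finset.
apply: bigsetU_compact => i _; have [Cc gL] := h i; apply: continuous_compact => //.
exact: klip_within.
Qed.

Lemma rV_comp_bounded k (f : 'rV[R]_k -> R) (p : X -> 'rV[R]_k) : LipB f ->
  lip_on setT p -> LipLoc (f \o p) /\ exists M, forall x, `|(f \o p) x| <= M.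
Proof.
move=> fB pl; split; first by apply: LipLoc_pullback => //; exact: LipB_LipLoc.
by have [M _ hM] := LipB_bounded fB; exists M => x; exact: hM.
Qed.

Lemma rV_coord_le n (u : 'rV[R]_n) i : `|u 0 i| <= `|u|.
Proof.
by rewrite [leRHS]/Num.norm /= mx_normrE; apply/bigmax_geP; right; exists (0, i).
Qed.

Lemma rV_norm_le n (u : 'rV[R]_n) c : 0 <= c -> (forall i, `|u 0 i| <= c) -> `|u| <= c.
Proof.
move=> c0 h; rewrite /Num.norm /= mx_normrE; apply/bigmax_leP; split => // -[a b] _ /=.
by rewrite ord1.
Qed.

Lemma rV_extend k (p : Y -> 'rV[R]_k) : lip_on setT p ->
  exists2 q : X -> 'rV[R]_k, lip_on setT q & q \o j = p.
Proof.
move=> /lip_on_gt0[L L0 pL].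
have /choice[F hF] i : exists F : X -> R, (forall x x', `|F x - F x'| <= L * mdist x x') /\
    forall y, setT y -> F (j y) = p y 0 i.
  apply: klip_extend => //; first exact: ltW.
  move=> y z _ _; apply: le_trans (pL y z I I).
  by have := rV_coord_le (p y - p z) i; rewrite !mxE.
exists (fun x => \row_i F i x).
  exists L => x x' _ _; apply: rV_norm_le; first by rewrite mulr_ge0 ?mdist_ge0 ?ltW.
  by move=> i; rewrite !mxE; exact: (hF i).1.
apply/funext => y; apply/rowP => i; rewrite !mxE; exact: (hF i).2.
Qed.

Lemma IRLoc_push k (S : functional Y k) : IRLoc S -> IRLoc (push_functional j S).
Proof.
move=> [h1 h2 h3]; have HT := push_MLoc ij h1; split => //.
- move=> O e Oo Ob e0; have [K Kr Ke] := h2 _ e (iso_open ij Oo) (iso_mbounded ij Ob) e0.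
  exists (j @` K); first exact: compact_rectifiable_image.
  apply: le_lt_trans (push_compact_remainder ij _ Oo _) Ke.
  exact: compact_rectifiable_compact Kr.
- move=> B p Bm Bb pl.
  have [|th th1 hth] := h3 _ (p \o j) (borel_iso ij Bm) (iso_mbounded ij Bb).
    have [L hL] := pl; exists L => x y _ _ /=; rewrite -ij; exact: hL.
  exists th => // f tau ft; rewrite -hth//; have [fB tl] := ft.
  have [gl [M gM]] := rV_comp_bounded fB pl.
  apply: (borel_ext_push ij h1 HT _ Bm Bb gl gM); first exact: mass_push_range.
  by move=> i; apply: LipLoc_pullback.
Qed.

(** Borel sets of the subspace are traces, and its Lipschitz maps to [R^k] are
    restrictions, so integrality in the ambient space is enough. *)
Lemma IRLoc_pull k (S : functional Y k) : metric_functional S ->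
  IRLoc (push_functional j S) ->
  mass (push_functional j S) (~` range j) = 0%E -> IRLoc S.
Proof.
move=> mS [h1 h2 h3] T0; have HS := pull_MLoc ij mS h1 T0; split => //.
- move=> O e /(iso_open_trace ij)[V Vo <-] /(iso_trace_bounded ij)[V' [V'o V'b VE]] e0.
  have [K Kr Ke] := h2 _ e (openI Vo V'o) (mboundedS (@subIsetr _ _ _) V'b) e0.
  exists (j @^-1` K); first exact: compact_rectifiable_preimage.
  rewrite -VE -[X in mass S X]/(j @^-1` ((V `&` V') `\` K)).
  exact: le_lt_trans (mass_pull ij h1 T0 _) Ke.
- move=> A p /(borel_trace ij)[B' B'm <-] /(iso_trace_bounded ij)[V [Vo Vb BA]] pl.
  pose B := B' `&` V.
  have Bm : borel B.
    apply: (@measurableI _ (g_sigma_algebraType (@open X))) => //.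
    exact: borel_open.
  have Bb : mbounded B by apply: mboundedS Vb; exact: subIsetr.
  have [q ql qj] : exists2 q : X -> 'rV[R]_k, lip_on setT q & q \o j = p.
    exact: rV_extend.
  have [th th1 hth] := h3 B q Bm Bb ql.
  exists th => // f tau ft; rewrite -hth//; have [fB tl] := ft.
  have [gl [M gM]] := rV_comp_bounded fB ql.
  rewrite /push_restr (borel_ext_push ij HS h1 T0 Bm Bb gl gM); last first.
    by move=> i; apply: LipLoc_pullback.
  by rewrite BA -qj.
Qed.

End rectifiable_transfer.

(** * Currents of Euclidean space *)

Section euclidean_measurability.
Variables (R : realType) (n : nat).
Local Notation V := 'rV[R]_n.
Local Notation lebV := (caratheodory_type (lebesgue_outer_measure R n)).

Definition box_below (i : 'I_n) (c : R) (B : option (V * V)) : option (V * V) :=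
  if B is Some (a, b) then
    Some (a, \row_l if l == i then Num.min (b 0 l) c else b 0 l) else None.

Definition box_above (i : 'I_n) (c : R) (B : option (V * V)) : option (V * V) :=
  if B is Some (a, b) then
    Some (\row_l if l == i then Num.max (a 0 l) c else a 0 l, b) else None.

Lemma box_belowP i c B (x : V) : box B x -> x 0 i < c -> box (box_below i c B) x.
Proof.
case: B => [[a b]|//] /= h xc l; rewrite mxE; have /andP[-> /= xb] := h l.
by case: eqP => // ->; rewrite lt_min xc andbT; have /andP[] := h i.
Qed.

Lemma box_aboveP i c B (x : V) : box B x -> c <= x 0 i -> box (box_above i c B) x.
Proof.
case: B => [[a b]|//] /= h xc l; rewrite mxE; have /andP[xa ->] := h l.
by rewrite andbT; case: eqP xa => // ->; rewrite ge_max xc andbT.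
Qed.

Lemma box_volume_split i c B :
  (box_volume (box_below i c B) + box_volume (box_above i c B) = box_volume B :> R)%R.
Proof.
case: B => [[a b]|] /=; last by rewrite addr0.
rewrite (bigD1 i)//= [X in _ + X](bigD1 i)//= [RHS](bigD1 i)//= !mxE eqxx.
set P := \prod_(l | l != i) Num.max 0 (b 0 l - a 0 l).
rewrite (_ : \prod_(l < n | l != i) _ = P); last first.
  by apply: eq_bigr => l /negPf li; rewrite mxE li.
rewrite [X in _ + _ * X](_ : _ = P); last first.
  by apply: eq_bigr => l /negPf li; rewrite mxE li.
rewrite -mulrDl; congr (_ * _); set u := a 0 i; set v := b 0 i.
case: (lerP v c) => vc; case: (lerP u c) => uc.
- by case: (lerP 0 (v - c)) => ?; case: (lerP 0 (v - u)) => ?; lra.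
- by case: (lerP 0 (v - u)) => ?; lra.
- by case: (lerP 0 (c - u)) => ?; case: (lerP 0 (v - c)) => ?;
    case: (lerP 0 (v - u)) => ?; lra.
- by case: (lerP 0 (c - u)) => ?; case: (lerP 0 (v - u)) => ?; lra.
Qed.

(** A hyperplane cuts each box of a cover into two boxes with the same total
    volume, which is the Caratheodory criterion. *)
Lemma lebesgue_halfspace i c : measurable ([set x | x 0 i < c] : set lebV).
Proof.
apply: le_caratheodory_measurable => A; set H := [set x | _].
apply: le_ereal_inf_tmp => _ [F AF <-].
have vol0 B : (0 <= (box_volume B : R)%:E)%E.
  rewrite lee_fin; case: B => [[a b]|//]; apply: prodr_ge0 => l _.
  by rewrite le_max lexx.
have -> : (\sum_(l <oo) (box_volume (F l))%:E =
    \sum_(l <oo) (box_volume (box_below i c (F l)))%:E +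
    \sum_(l <oo) (box_volume (box_above i c (F l)))%:E)%E.
  rewrite -nneseriesD//; apply: eq_eseriesr => l _.
  by rewrite -EFinD box_volume_split.
apply: leeD; apply: ereal_inf_lbound.
- exists (fun l => box_below i c (F l)) => // x [/AF[l _ Flx] xc].
  by exists l => //; exact: box_belowP.
- exists (fun l => box_above i c (F l)) => // x [/AF[l _ Flx] /= xc].
  exists l => //; apply: box_aboveP => //.
  by rewrite leNgt; exact/negP.
Qed.

(** An open set is a countable union of cubes with rational data. *)
Lemma lebesgue_open (O : set V) : open O -> measurable (O : set lebV).
Proof.
move=> Oo; pose idx := ({ffun 'I_n -> rat} * rat)%type.
pose C (p : idx) : set V :=
  [set x | forall i, ratr (p.1 i) - ratr p.2 <= x 0 i < ratr (p.1 i) + ratr p.2].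
have Cm p : measurable (C p : set lebV).
  have -> : C p = \bigcap_(i in [set: 'I_n]) ([set x : V | x 0 i < ratr (p.1 i) + ratr p.2] `\`
      [set x : V | x 0 i < ratr (p.1 i) - ratr p.2]).
    apply/seteqP; split => x /= h i; last first.
      by have [h1 /negP h2] := h i I; rewrite h1 andbT leNgt.
    by move=> _; have /andP[h1 h2] := h i; split => //=; apply/negP; rewrite -leNgt.
  apply: fin_bigcap_measurable; first exact: finite_finset.
  by move=> i _; apply: measurableD; exact: lebesgue_halfspace.
rewrite (_ : O = \bigcup_p (if pselect (C p `<=` O) then C p else set0)).
  apply: countable_bigcupT_measurable; first exact: countableP.
  by move=> p; case: pselect => h /=; [exact: Cm|exact: measurable0].
apply/seteqP; split => x; last by move=> [p _]; case: pselect => //= CO; exact: CO.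
move=> /((openP O).1 Oo)[e e0 eO].
have [r r0 re] : exists2 r : rat, 0 < ratr r :> R & ratr r < e / 2 :> R.
  have [q] := rat_in_itvoo (divr_gt0 e0 (ltr0Sn R 1)).
  by rewrite in_itv/= => /andP[? ?]; exists q.
have /choice[q hq] i : exists q : rat, x 0 i - ratr r < ratr q < x 0 i + ratr r.
  have : x 0 i - ratr r < x 0 i + ratr r by lra.
  by move=> /rat_in_itvoo[q]; rewrite in_itv/= => ?; exists q.
exists ([ffun i => q i], r) => //.
case: pselect => [h i|nCO] /=; first by rewrite ffunE; have /andP[? ?] := hq i; apply/andP; split; lra.
exfalso; apply: nCO => y hy; apply: eO.
apply: (@le_lt_trans _ _ (2 * ratr r)); last by lra.
apply: rV_norm_le; first by lra.
move=> i; rewrite !mxE ler_norml; have := hy i; rewrite ffunE/= => /andP[? ?].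
by have /andP[? ?] := hq i; apply/andP; split; lra.
Qed.

Lemma lebesgue_continuous (f : V -> R) : continuous f ->
  measurable_fun setT (f : lebV -> R).
Proof.
move=> fc; apply: measurable_fun_gt => c; apply: lebesgue_open.
by apply: (@open_comp _ _ f [set y | c < y]) => [x _|]; [exact: fc|exact: open_gt].
Qed.

End euclidean_measurability.

Section gradient.
Variables (R : realType) (n : nat).
Local Notation V := 'rV[R]_n.
Local Notation lebV := (caratheodory_type (lebesgue_outer_measure R n)).
Implicit Types (tau : V -> R) (v : V).

Let quot tau v (x : V) (h : R) : R := h^-1 * (tau (h *: v + x) - tau x).

Let deriveE tau v x : 'D_v (tau : V -> R^o) x = lim (quot tau v x @ 0^').
Proof. by []. Qed.

Let quot_continuous tau v x h : continuous tau -> h != 0 ->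
  {for h, continuous (quot tau v x)}.
Proof.
move=> tc h0; apply: cvgM; first exact: cvgV.
apply: cvgB; last exact: cvg_cst.
apply: (@continuous_comp _ _ _ (fun h : R => h *: v + x) tau); last exact: tc.
by apply: cvgD; [exact: cvgZr_tmp|exact: cvg_cst].
Qed.

Let near0P (P : R -> Prop) : (\forall h \near 0^', P h) <->
  exists2 d, 0 < d & forall h, h != 0 -> `|h| < d -> P h.
Proof.
split=> [[d /= d0 hd]|[d d0 hd]].
  by exists d => // h h0 hh; apply: hd => //=; rewrite sub0r normrN.
by exists d => // h /=; rewrite sub0r normrN => hh h0; exact: hd.
Qed.

Let small (l : nat) (a : rat) : Prop := ratr a != 0 :> R /\ `|ratr a : R| < l.+1%:R^-1.

(** By continuity the Cauchy condition for the difference quotients may be tested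
    on rational increments, which leaves countably many conditions. *)
Let cvg_quotP tau v x : continuous tau -> cvg (quot tau v x @ 0^') <->
  forall m : nat, exists l : nat, forall a b, small l a -> small l b ->
    `|quot tau v x (ratr a) - quot tau v x (ratr b)| <= m.+1%:R^-1.
Proof.
move=> tc; split.
  move=> /cvg_ex[y /cvgrPdist_le cy] m.
  have m0 : 0 < m.+1%:R^-1 / 2 :> R by rewrite divr_gt0 ?invr_gt0.
  have [d d0 hd] := (near0P _).1 (cy _ m0).
  have [N hN] := natSinv_lt d0; have ld := ltW (hN N (leqnn N)).
  exists N => a b [a0 al] [b0 bl].
  have ha := hd _ a0 (lt_le_trans al ld); have hb := hd _ b0 (lt_le_trans bl ld).
  rewrite [leRHS]splitr (le_trans (ler_distD y _ _))// lerD//.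
  by rewrite distrC.
move=> h; apply: cauchy_cvg; apply: cauchy_exP => e e0.
have [m /(_ m (leqnn m)) me] := natSinv_lt (divr_gt0 e0 (ltr0Sn R 1)).
have [l hl] := h m.
have l0 : 0 < l.+1%:R^-1 :> R by rewrite invr_gt0.
have [a] := rat_in_itvoo l0; rewrite in_itv/= => /andP[a0 al].
have sa : small l a by split; rewrite ?gt_eqF// gtr0_norm.
exists (quot tau v x (ratr a)); apply/near0P; exists l.+1%:R^-1 => // t t0 tl.
rewrite -ball_normE /= distrC.
have /cvgrPdist_lt/(_ _ (divr_gt0 e0 (ltr0Sn R 1)))[d /= d0 hd] :=
  quot_continuous (v := v) (x := x) tc t0.
pose d' := Num.min d (Num.min `|t| (l.+1%:R^-1 - `|t|)).
have d'0 : 0 < d' by rewrite !lt_min d0 normr_gt0 t0 subr_gt0.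
have : t - d' < t + d' by lra.
move=> /rat_in_itvoo[b]; rewrite in_itv/= => /andP[b1 b2].
have tb : `|t - ratr b| < d' by rewrite ltr_norml; apply/andP; split; lra.
have := tb; rewrite !lt_min => /and3P[tb1 tb2 tb3].
have sb : small l b.
  split; first by apply: contraTneq tb2 => ->; rewrite subr0 ltxx.
  rewrite -(subrK t (ratr b)) (le_lt_trans (ler_normD _ _))// distrC.
  by rewrite -ltrBrDr.
rewrite (le_lt_trans (ler_distD (quot tau v x (ratr b)) _ _))// [ltRHS]splitr ltrD//.
  exact: hd.
by rewrite (le_lt_trans (hl _ _ sb sa)).
Qed.

Let quot_measurable tau v h : continuous tau -> h != 0 ->
  measurable_fun setT ((quot tau v)^~ h : lebV -> R).
Proof.
move=> tc h0.
suff qc : continuous (fun x : V => quot tau v x h) by exact: lebesgue_continuous.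
move=> x; have shift_cvg : tau (h *: v + y) @[y --> x] --> tau (h *: v + x).
  apply: (@continuous_comp _ _ _ (fun x => h *: v + x) tau); last exact: tc.
  by exact: (@cvgD _ _ _ (nbhs x) _ (fun=> h *: v) id (h *: v) x (cvg_cst _) cvg_id).
exact: (@cvgM _ _ (nbhs x) _ (fun=> h^-1) (fun y => tau (h *: v + y) - tau y) _ _ (cvg_cst _) (cvgB shift_cvg (tc x))).
Qed.

Let cvg_quot_measurable tau v : continuous tau ->
  measurable ([set x | cvg (quot tau v x @ 0^')] : set lebV).
Proof.
move=> tc; rewrite (_ : [set x | _] = \bigcap_(m in [set: nat]) \bigcup_(l in [set: nat])
  ~` \bigcup_(ab in [set: rat * rat]) [set x | small l ab.1 /\ small l ab.2 /\
    m.+1%:R^-1 < `|quot tau v x (ratr ab.1) - quot tau v x (ratr ab.2)|]); last first.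
  apply/seteqP; split => x /=.
    move=> /(cvg_quotP _ _ tc) h m _; have [l hl] := h m; exists l => // -[[a b] _ /=].
    by move=> [sa [sb]]; rewrite ltNge hl.
  move=> h; apply/(cvg_quotP _ _ tc) => m; have [l _ hl] := h m I.
  exists l => a b sa sb; rewrite leNgt; apply/negP => ab; apply: hl.
  by exists (a, b).
apply: bigcapT_measurable => m; apply: bigcupT_measurable => l; apply: measurableC.
apply: countable_bigcupT_measurable; first exact: countableP.
move=> [a b] /=.
have [sa|nsa] := pselect (small l a); last first.
  by rewrite (_ : [set x | _] = set0); [exact: measurable0|rewrite -subset0 => x []].
have [sb|nsb] := pselect (small l b); last first.
  by rewrite (_ : [set x | _] = set0); [exact: measurable0|rewrite -subset0 => x [_ []]].
pose q (x : lebV) := `|quot tau v x (ratr a) - quot tau v x (ratr b)|.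
have mq : measurable_fun setT q.
  have mab := measurable_funB (@quot_measurable tau v _ tc sa.1)
    (@quot_measurable tau v _ tc sb.1).
  exact: (@measurableT_comp _ _ _ _ _ _ _ _ _ (@normr_measurable R setT) mab).
rewrite (_ : [set x | _] = setT `&` q @^-1` `]m.+1%:R^-1, +oo[); first exact: mq.
apply/seteqP; split => x /=; first by move=> [_ [_ ?]]; rewrite in_itv/= andbT.
by move=> [_]; rewrite in_itv/= andbT.
Qed.

(** Difference quotients along a sequence of increments converge to the derivative
    where it exists; elsewhere [lim] takes its default value [point]. *)
Lemma measurable_derive tau v : LipLoc tau ->
  measurable_fun setT ((fun x => 'D_v (tau : V -> R^o) x) : lebV -> R).
Proof.
move=> tl; have tc := LipLoc_continuous tl.
pose D := [set x : lebV | cvg (quot tau v x @ 0^')].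
have Dm : measurable D by exact: cvg_quot_measurable.
pose g m (x : lebV) : R := \1_D x * quot tau v x m.+1%:R^-1 + \1_(~` D) x * (point : R^o).
apply: (@measurable_fun_cvg _ _ _ setT g) => [m|x _].
  apply: measurable_funD.
    apply: measurable_funM; first exact: measurable_indic.
    by apply: quot_measurable => //; rewrite gt_eqF.
  apply: measurable_funM; last exact: measurable_cst.
  by apply: measurable_indic; exact: measurableC.
rewrite deriveE /g !indicE.
have [Dx|nDx] := pselect (D x).
  rewrite mem_set// memNset; last by apply.
  under eq_fun do rewrite mul1r mul0r addr0.
  have cx : quot tau v x h @[h --> 0^'] --> lim (quot tau v x @ 0^') by exact: Dx.
  apply: (@cvg_comp _ _ _ (fun m => m.+1%:R^-1) (quot tau v x) _ 0^' _ _ cx).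
  move=> P /near0P[d d0 hd].
  have [N hN] := natSinv_lt d0; exists N => // m /= Nm.
  by apply: hd; [rewrite gt_eqF|rewrite ger0_norm//; exact: hN].
rewrite memNset// mem_set//.
under eq_fun do rewrite mul0r add0r mul1r.
rewrite (_ : lim _ = point); first exact: cvg_cst.
exact: dvgP.
Qed.

Lemma derive_bounded tau v (B : set V) : LipLoc tau -> mbounded B ->
  exists C, forall x, B x -> `|'D_v (tau : V -> R^o) x| <= C.
Proof.
move=> tl Bb.
have [L L0 hL] := LipLoc_klip tl (mbounded_closed_nbhd 1 Bb).
(* The second bound covers the points where the derivative does not exist. *)
exists (Num.max (L * `|v|) `|point : R^o|) => x Bx; rewrite le_max deriveE.
have [cx|ncx] := pselect (cvg (quot tau v x @ 0^')); last first.
  by rewrite (_ : lim _ = point) ?lexx ?orbT//; exact: dvgP.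
apply/orP; left.
have cx' : quot tau v x h @[h --> 0^'] --> lim (quot tau v x @ 0^') by exact: cx.
apply: (cvgr_to_le (cvg_norm cx')); apply/near0P.
exists (1 + `|v|)^-1; first by rewrite invr_gt0 ltr_pwDl.
move=> h h0 hv; rewrite normrM normfV ler_pdivrMl ?normr_gt0//.
have hd : mdist (h *: v + x) x = `|h| * `|v|.
  by rewrite /mdist/= addrK normrZ.
rewrite mulrCA -hd; apply: hL; last exact: (sub_closed_nbhd ltr01).
apply: (closed_nbhd_mdist ltr01 Bx); rewrite hd.
have v0 : 0 < 1 + `|v| by rewrite ltr_pwDl.
move: hv; rewrite -[X in _ < X]mul1r ltr_pdivlMr// => /ltW hv.
by apply: le_trans hv; rewrite ler_wpM2l// lerDr.
Qed.

End gradient.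

Section euclidean_current.
Variables (R : realType) (k : nat).
Local Notation V := 'rV[R]_k.
Local Notation lebV := (caratheodory_type (lebesgue_outer_measure R k)).
Implicit Types (theta : V -> int).

Lemma det_bounded (A : 'M[R]_k) c : (forall i j, `|A i j| <= c) ->
  `|\det A| <= \sum_(s : 'S_k) \prod_(i < k) c.
Proof.
move=> Ac; rewrite /determinant (le_trans (ler_norm_sum _ _ _))//.
apply: ler_sum => s _; rewrite normrM normrX normrN1 expr1n mul1r normr_prod.
by apply: ler_prod => i _; rewrite normr_ge0 Ac.
Qed.

Lemma measurable_det_gradient (tau : 'I_k -> V -> R) : (forall i, LipLoc (tau i)) ->
  measurable_fun setT ((fun x => \det (gradient tau x)) : lebV -> R).
Proof.
move=> tl; rewrite /determinant; apply: measurable_sum => s.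
apply: measurable_funM; first exact: measurable_cst.
apply: measurable_prod => i _; rewrite /gradient.
under eq_fun do rewrite mxE.
exact: measurable_derive.
Qed.

(** [f] has bounded support, where the partial derivatives are bounded, so that the
    integrand is dominated by a multiple of [theta]. *)
Lemma integrable_form theta (f : V -> R) (tau : 'I_k -> V -> R) :
  L1_int theta -> test_form f tau ->
  (lebesgue_rV R k).-integrable setT
    (fun x => (f x * (theta x)%:~R * \det (gradient tau x))%:E).
Proof.
move=> th [fB tl]; have [M M0 fM] := LipB_bounded fB.
have fl := LipB_LipLoc fB; have [_ fb] := (LipBP _).1 fB.
have [C hC] : exists C, forall x, f x != 0 -> `|\det (gradient tau x)| <= C.
  have /choice[c hc] (ij : 'I_k * 'I_k) : exists c, forall x, f x != 0 ->
      `|gradient tau x ij.1 ij.2| <= c.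
    have [c hc] := derive_bounded (delta_mx 0 ij.2) (tl ij.1) fb.
    by exists c => x fx; rewrite mxE; exact: hc.
  have c0 ij x : f x != 0 -> 0 <= c ij by move=> fx; apply: le_trans (hc ij _ fx).
  exists (\sum_(s : 'S_k) \prod_(i < k) \sum_ij c ij) => x fx.
  apply: det_bounded => a b; apply: (le_trans (hc (a, b) x fx)).
  rewrite (bigD1 (a, b))//= lerDl; apply: sumr_ge0 => ij _; exact: c0 fx.
have mth : measurable_fun setT ((fun x => (theta x)%:~R) : lebV -> R).
  by apply/measurable_EFinP; exact: measurable_int th.
apply: (@le_integrable _ lebV R (lebesgue_rV R k) setT measurableT _ (fun x => (M * C)%:E * (theta x)%:~R%:E)%E).
- apply/measurable_EFinP; apply: measurable_funM; last exact: measurable_det_gradient.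
  apply: measurable_funM => //; apply: lebesgue_continuous.
  exact: LipLoc_continuous.
- move=> x _; rewrite -EFinM !abse_EFin lee_fin !normrM.
  have [->|fx] := eqVneq (f x) 0; first by rewrite normr0 !mul0r !mulr_ge0.
  rewrite mulrAC ler_wpM2r// (ger0_norm (ltW M0)); apply: ler_pM => //.
  by rewrite (le_trans (hC x fx))// ler_norm.
- exact: integrableZl.
Qed.

Lemma L1_intB theta1 theta2 : L1_int theta1 -> L1_int theta2 ->
  L1_int (fun x => theta1 x - theta2 x).
Proof.
move=> h1 h2; rewrite /L1_int.
under eq_fun do rewrite intrB EFinB.
exact: integrableB.
Qed.

Lemma euclidean_currentB theta1 theta2 : L1_int theta1 -> L1_int theta2 ->
  eq_functional (fun f tau => euclidean_current theta1 f tau - euclidean_current theta2 f tau)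
    (euclidean_current (fun x => theta1 x - theta2 x)).
Proof.
move=> h1 h2 f tau ft; rewrite /euclidean_current -RintegralB//.
- by apply: eq_Rintegral => x _; rewrite intrB mulrBr mulrBl.
- exact: integrable_form.
- exact: integrable_form.
Qed.

Lemma L1_int0 : L1_int (fun _ : V => 0).
Proof. exact: integrable0. Qed.

Lemma euclidean_current0 f tau : euclidean_current (fun _ : V => 0) f tau = 0 :> R.
Proof.
rewrite /euclidean_current; under eq_Rintegral do rewrite mulr0 mul0r.
by rewrite Rintegral_cst// mul0r.
Qed.

End euclidean_current.

(** * Differences of currents *)

Section difference.
Variables (R : realType) (X : completeMetricType R).
Local Notation borelX := (g_sigma_algebraType (@open X)).

Definition functionalB k (S T : functional X k) : functional X k :=
  fun f pi => S f pi - T f pi.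

Definition functional0 k : functional X k := fun _ _ => 0.

Section fixed_dimension.
Variable k : nat.
Implicit Types (S T : functional X k).

Lemma metric_functionalB S T : metric_functional S -> metric_functional T ->
  metric_functional (functionalB S T).
Proof.
move=> HS HT; split; first split.
- move=> a f g pi [fB pl] gB; rewrite /functionalB !mfDZ//; ring.
- move=> a f pi i u v [fB pl] ul vl; rewrite /functionalB !mf_coordDZ//; ring.
- move=> f pi pi_ fp fp_ c1 c2; case: HS HT => [_ hS _] [_ hT _].
  by apply: cvgB; [exact: hS|exact: hT].
- move=> f pi fp h; case: HS HT => [_ _ hS] [_ _ hT].
  by rewrite /functionalB hS// hT// subrr.
Qed.

Lemma mass_openB S T O : metric_functional T ->
  (mass_open (functionalB S T) O <= mass_open S O + mass_open T O)%E.
Proof.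
move=> HT; apply: ge_ereal_sup => _ [N [f [pi [fp fO f1 ->]]]].
rewrite /functionalB sumrB EFinB; apply: leeD.
  by apply: ereal_sup_ubound => /=; exists N, f, pi.
apply: ereal_sup_ubound => /=; exists N, (fun l x => - f l x), pi; split.
- by move=> l; have [fB ?] := fp l; split => //; exact: LipBN.
- move=> l; apply: subset_trans (fO l); apply: spt_sub => x ->.
  by rewrite oppr0.
- by move=> x; under eq_bigr do rewrite normrN.
- rewrite -?EFinN -sumrN; congr (_%:E); apply: eq_bigr => l _; rewrite mfN//.
    by case: (fp l).
  by move=> i; apply: Lip1_LipLoc; case: (fp l).
Qed.

Lemma massB S T A : metric_functional T ->
  (mass (functionalB S T) A <= mass S A + mass T A)%E.
Proof.
move=> HT; have [Soo|Sf] := eqVneq (mass S A) +oo%E.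
  by rewrite Soo addye ?leey// -ltNye (lt_le_trans _ (mass_ge0 _ _))// ltNy0.
have [Too|Tf] := eqVneq (mass T A) +oo%E.
  by rewrite Too addey ?leey// -ltNye (lt_le_trans _ (mass_ge0 _ _))// ltNy0.
have Sf' : mass S A \is a fin_num by rewrite ge0_fin_numE ?mass_ge0// ltey.
have Tf' : mass T A \is a fin_num by rewrite ge0_fin_numE ?mass_ge0// ltey.
apply/lee_addgt0Pr => e e0; have e20 : 0 < e / 2 by rewrite divr_gt0.
have [_ [V [Vo AV] <-] /ltW Ve] := lb_ereal_inf_adherent e20 Sf'.
have [_ [W [Wo AW] <-] /ltW We] := lb_ereal_inf_adherent e20 Tf'.
apply: (@le_trans _ _ (mass_open (functionalB S T) (V `&` W))).
  by apply: mass_le_open; [exact: openI|move=> x Ax; split; [exact: AV|exact: AW]].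
apply: (le_trans (mass_openB _ _ HT)).
rewrite [e]splitr EFinD addeACA; apply: leeD.
  by apply: le_trans Ve; apply: mass_open_mono; exact: subIsetl.
by apply: le_trans We; apply: mass_open_mono; exact: subIsetr.
Qed.

Lemma MLocB S T : MLoc S -> MLoc T -> MLoc (functionalB S T).
Proof.
move=> HS HT; have [mS _ tS] := HS; have [mT _ tT] := HT; split.
- exact: metric_functionalB.
- move=> O Oo Ob; apply: le_lt_trans (massB _ _ mT) _.
  by rewrite lte_add_pinfty//; exact: mass_finite.
- move=> O e Oo Ob e0; have e20 : 0 < e / 2 by rewrite divr_gt0.
  have [K [Kc KO] Ke] := tS O _ Oo Ob e20.
  have [L [Lc LO] Le] := tT O _ Oo Ob e20.
  exists (K `|` L); first by split; [exact: compactU|rewrite subUset].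
  apply: le_lt_trans (massB _ _ mT) _.
  rewrite [e]splitr EFinD; apply: lteD.
    by apply: le_lt_trans Ke; apply: mass_mono; apply: setDS; exact: subsetUl.
  by apply: le_lt_trans Le; apply: mass_mono; apply: setDS; exact: subsetUr.
Qed.

Lemma borel_extB S T (B : set X) (g : X -> R) (M : R) (pi : 'I_k -> X -> R) :
  MLoc S -> MLoc T -> borel B -> mbounded B -> LipLoc g ->
  (forall x, `|g x| <= M) -> (forall i, LipLoc (pi i)) ->
  borel_ext (functionalB S T) (fun x => \1_B x * g x) pi =
  borel_ext S (fun x => \1_B x * g x) pi - borel_ext T (fun x => \1_B x * g x) pi.
Proof.
move=> HS HT Bm Bb gl gM pl; have [mT _ _] := HT.
have M0 : 0 <= M := le_trans (normr_ge0 _) (gM point).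
have [u [D [N [uB [Nb BN uN] uM uD [Dm S0 T0]]]]] := approx_exists HS HT Bm Bb gl gM.
have fm := LipLoc_indic_mul Bm gl.
have fN : spt (fun x => \1_B x * g x) `<=` interior N.
  by apply: subset_trans BN; exact: spt_indic_mul.
have uS := ext_approx_sets HS fm uB Nb fN uN M0 uM uD Dm S0.
have uT := ext_approx_sets HT fm uB Nb fN uN M0 uM uD Dm T0.
have HB := MLocB HS HT.
have B0 : mass (functionalB S T) (D n) @[n --> \oo] --> 0%E.
  have ST0 : (mass S (D n) + mass T (D n))%E @[n --> \oo] --> 0%E.
    by rewrite -[X in _ --> X]adde0; apply: cvgeD.
  apply: squeeze_cvge (cvg_cst 0%E) ST0; apply: nearW => n.
  by rewrite mass_ge0/=; exact: massB.
have uST := ext_approx_sets HB fm uB Nb fN uN M0 uM uD Dm B0.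
have cS := ext_approx_cvg HS fm uS pl; have cT := ext_approx_cvg HT fm uT pl.
rewrite (borel_extE HS fm uS pl cS) (borel_extE HT fm uT pl cT).
by apply: (borel_extE HB fm uST pl); exact: cvgB.
Qed.

Lemma compact_rectifiableU n (K L : set X) : compact_rectifiable n K ->
  compact_rectifiable n L -> compact_rectifiable n (K `|` L).
Proof.
move=> [N [C [g [h ->]]]] [N' [C' [g' [h' ->]]]].
exists (N + N')%N, (fun i => match fintype.split i with inl a => C a | inr b => C' b end),
  (fun i => match fintype.split i with inl a => g a | inr b => g' b end); split.
  by move=> i; case: (fintype.split i).
apply/seteqP; split => x.
  move=> [[a _ ax]|[b _ bx]].
    by exists (lshift N' a) => //; rewrite (unsplitK (inl a)).
  by exists (rshift N b) => //; rewrite (unsplitK (inr b)).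
move=> [i _]; case: (fintype.split i) => [a|b] h0; [left|right].
  by exists a.
by exists b.
Qed.

Lemma IRLocB S T : IRLoc S -> IRLoc T -> IRLoc (functionalB S T).
Proof.
move=> [HS rS iS] [HT rT iT]; have [mT _ _] := HT; split; first exact: MLocB.
- move=> O e Oo Ob e0; have e20 : 0 < e / 2 by rewrite divr_gt0.
  have [K Kr Ke] := rS O _ Oo Ob e20; have [L Lr Le] := rT O _ Oo Ob e20.
  exists (K `|` L); first exact: compact_rectifiableU.
  apply: le_lt_trans (massB _ _ mT) _.
  rewrite [e]splitr EFinD; apply: lteD.
    by apply: le_lt_trans Ke; apply: mass_mono; apply: setDS; exact: subsetUl.
  by apply: le_lt_trans Le; apply: mass_mono; apply: setDS; exact: subsetUr.
- move=> B p Bm Bb pl; have [th1 L1 h1] := iS B p Bm Bb pl.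
  have [th2 L2 h2] := iT B p Bm Bb pl.
  exists (fun x => th1 x - th2 x); first exact: L1_intB.
  move=> f tau ft; rewrite -euclidean_currentB// -h1// -h2//.
  have [fB tl] := ft; have [gl [M gM]] := rV_comp_bounded fB pl.
  rewrite /push_restr (borel_extB HS HT Bm Bb gl gM)//.
  by move=> i; exact: LipLoc_pullback.
Qed.

Lemma mass_functional0 A : mass (@functional0 k) A = 0%E.
Proof.
apply/eqP; rewrite eq_le mass_ge0 andbT (le_trans (mass_le_open _ openT _))//.
by apply: ge_ereal_sup => _ [N [f [pi [_ _ _ ->]]]]; rewrite big1.
Qed.

Lemma compact_rectifiable0 n : compact_rectifiable n (set0 : set X).
Proof.
exists 0%N, (fun=> set0), (fun _ _ => point); split; first by case.
by apply/esym; rewrite -subset0 => x [[]].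
Qed.

Lemma IRLoc0 : IRLoc (@functional0 k).
Proof.
have m0 := mass_functional0.
split; first split.
- split; first split.
  + by move=> *; rewrite /functional0 mulr0 addr0.
  + by move=> *; rewrite /functional0 mulr0 addr0.
  + by move=> *; exact: cvg_cst.
  + by [].
- by move=> O _ _; rewrite m0 ltry.
- move=> O e _ _ e0; exists set0; last by rewrite m0 lte_fin.
  by split => //; exact: compact0.
- move=> O e _ _ e0; exists set0; last by rewrite m0 lte_fin.
  exact: compact_rectifiable0.
- move=> B p _ _ _; exists (fun=> 0); first exact: L1_int0.
  move=> f tau _; rewrite euclidean_current0 /push_restr /borel_ext.
  case: xgetP => // l _ [u _]; rewrite /functional0 => /cvg_lim <-//.
  exact: lim_cst.
Qed.

End fixed_dimension.

Lemma ILocB k (S T : functional X k) : ILoc S -> ILoc T -> ILoc (functionalB S T).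
Proof.
case: k S T => [|k] S T /=; first exact: IRLocB.
by move=> [? ?] [? ?]; split; [exact: IRLocB|exact: (IRLocB (k := k))].
Qed.

Lemma ILoc0 k : ILoc (@functional0 k).
Proof. by case: k => [|k] /=; [exact: IRLoc0|split; exact: IRLoc0]. Qed.

End difference.

(** * Boundaries and cutoffs *)

Section boundary.
Variables (R : realType) (X : completeMetricType R) (k : nat).
Implicit Types (f s : X -> R) (pi : 'I_k -> X -> R) (T : functional X k.+1).

Definition cons_coord f pi : 'I_k.+1 -> X -> R :=
  fun i => if unlift ord0 i is Some l then pi l else f.

Lemma cons_coord0 f pi : cons_coord f pi ord0 = f.
Proof. by rewrite /cons_coord unlift_none. Qed.

Lemma LipLoc_cons_coord f pi : LipLoc f -> (forall i, LipLoc (pi i)) ->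
  forall i, LipLoc (cons_coord f pi i).
Proof. by move=> fl pl i; rewrite /cons_coord; case: unlift. Qed.

Lemma cutoff_spt_exists f : LipB f -> exists s, cutoff f s.
Proof.
move=> fB; have [s [sB _ s1]] := cutoff_exists (mbounded_closed_nbhd 1 (LipB_mbounded fB)).
by exists s; split => //; exists 1.
Qed.

(** [f] vanishes near any point where two cutoffs of [f] differ, so that their
    difference is killed by locality in the coordinate [f]. *)
Lemma cutoff_eq T f s s' pi : metric_functional T -> LipB f ->
  cutoff f s -> cutoff f s' -> (forall i, LipLoc (pi i)) ->
  T s (cons_coord f pi) = T s' (cons_coord f pi).
Proof.
move=> HT fB [sB [d d0 sd]] [sB' [d' d'0 sd']] pl.
have cl := LipLoc_cons_coord (LipB_LipLoc fB) pl.
apply/eqP; rewrite -subr_eq0 -mfB//; apply/eqP.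
pose t := Num.min d d'; have t0 : 0 < t by rewrite lt_min d0.
apply: (@mf_local _ _ _ _ HT _ _ ord0 (t / 4) 0) => //.
- exact: LipBB.
- by rewrite divr_gt0.
move=> x hx; rewrite cons_coord0; apply: contrapT => /eqP fx.
have t42 : t / 4 < t / 2 by lra.
have t20 : 0 < t / 2 by rewrite divr_gt0.
have [y sy xy] := closed_nbhd_lt t42 hx.
have [z /= sz yz] := closure_mdist t20 sy.
have xz : mdist z x <= t.
  by rewrite metric_sym (le_trans (metric_triangle _ y _))// [leRHS]splitr lerD ?ltW.
have fz r : t <= r -> closed_nbhd r (spt f) z.
  move=> tr; apply: (closed_nbhd_le tr).
  by apply: (closed_nbhd_mdist t0 (spt_nz fx)).
move: sz; rewrite sd ?sd' ?subrr ?eqxx//; apply: fz; by rewrite ge_min lexx ?orbT.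
Qed.

Lemma boundaryE T f s pi : metric_functional T -> test_form f pi -> cutoff f s ->
  boundary T f pi = T s (cons_coord f pi).
Proof.
move=> HT [fB pl] sf; apply: cutoff_eq => //.
exact: (@xgetPex _ (cst 0) (cutoff f) (ex_intro _ s sf)).
Qed.

End boundary.

Section boundary_push.
Variables (R : realType) (Y X : completeMetricType R) (j : Y -> X).
Hypothesis ij : isometric_embedding j.

Lemma cutoff_push (F s : X -> R) : cutoff F s -> cutoff (F \o j) (s \o j).
Proof.
move=> [sB [d d0 sd]]; split; first exact: iso_LipB.
exists (d / 2); first by rewrite divr_gt0.
move=> y hy; apply: sd; apply: (iso_closed_nbhd ij d0 _ _ hy); first by lra.
exact: iso_spt.
Qed.

Lemma cons_coord_comp k (f : X -> R) (pi : 'I_k -> X -> R) :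
  (fun i => cons_coord f pi i \o j) = cons_coord (f \o j) (fun i => pi i \o j).
Proof. by apply/funext => i; rewrite /cons_coord; case: unlift. Qed.

Lemma boundary_push k (T : functional Y k.+1) : metric_functional T ->
  eq_functional (push_functional j (boundary T)) (boundary (push_functional j T)).
Proof.
move=> HT f pi [fB pl]; have [s sf] := cutoff_spt_exists fB.
have pT := push_metric_functional ij HT.
rewrite (boundaryE pT _ sf)// /push_functional cons_coord_comp.
rewrite (boundaryE HT _ (cutoff_push sf))//; split; first exact: iso_LipB.
by move=> i; exact: iso_LipLoc.
Qed.

Lemma ILoc_push k (T : functional Y k) : ILoc T -> ILoc (push_functional j T).
Proof.
case: k T => [|k] T /=; first exact: IRLoc_push.
move=> [hT hB]; split; first exact: IRLoc_push.
have [[mT _ _] _ _] := hT.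
by apply: (IRLoc_eq (boundary_push mT)); exact: IRLoc_push.
Qed.

End boundary_push.

(** * Restriction to a subspace carrying the mass *)

Section restriction.
Variables (R : realType) (Y X : completeMetricType R) (j : Y -> X).
Hypothesis ij : isometric_embedding j.

(** The coordinates of a form only matter where its first component is nonzero.
    This is a bounded set, from which McShane extensions exist. *)
Definition ext_form k (f : Y -> R) (pi : 'I_k -> Y -> R) (F : X -> R)
    (P : 'I_k -> X -> R) : Prop :=
  [/\ LipB F, F \o j = f, forall i, LipLoc (P i) &
      forall i y, f y != 0 -> P i (j y) = pi i y].

(** The value is the same for all extensions when the range of [j] carries the
    mass of [T], see [ext_form_eq]. *)
Definition restr k (T : functional X k) : functional Y k :=
  fun f pi => xget 0 [set t | exists F P, ext_form f pi F P /\ t = T F P].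

Lemma coords_extend k (S : set Y) (pi : 'I_k -> Y -> R) : mbounded S ->
  (forall i, LipLoc (pi i)) -> exists P : 'I_k -> X -> R,
    (forall i, LipLoc (P i)) /\ forall i y, S y -> P i (j y) = pi i y.
Proof.
move=> Sb pl.
have /choice[P hP] i : exists P : X -> R, LipLoc P /\ forall y, S y -> P (j y) = pi i y.
  have [L L0 hL] := LipLoc_klip (pl i) Sb.
  have [F [FL Fj]] := klip_extend ij (ltW L0) hL.
  by exists F; split => //; exact: LipLoc_lip FL.
by exists P; split => i; case: (hP i).
Qed.

Lemma LipB_nz_mbounded (Z : metricType R) (f : Z -> R) : LipB f -> mbounded [set x | f x != 0].
Proof. by case/LipBP. Qed.

Section fixed.
Variables (k : nat) (T : functional X k).
Hypotheses (HT : MLoc T) (T0 : mass T (~` range j) = 0%E).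

Let mT : metric_functional T. Proof. by case: HT. Qed.

Let null A : (forall x, A x -> ~ range j x) -> mass T A = 0%E.
Proof.
by move=> h; apply/eqP; rewrite eq_le mass_ge0 andbT -[leRHS]T0; exact: mass_mono.
Qed.

Lemma ext_form_eq f pi F P F' P' : ext_form f pi F P -> ext_form f pi F' P' ->
  T F P = T F' P'.
Proof.
move=> [FB Fj Pl Pp] [FB' Fj' Pl' Pp'].
transitivity (T F' P).
  apply: (mf_null_eq HT) => //; apply: null => x /= FF [y _ yx]; move/eqP: FF; apply.
  by rewrite -yx -[LHS]/((F \o j) y) -[RHS]/((F' \o j) y) Fj Fj'.
apply: (mf_null_congr HT) => // i; apply: null => x /= [Fx /eqP PP] [y _ yx]; apply: PP.
have fy : f y != 0 by rewrite -Fj' /= yx.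
by rewrite -yx Pp// Pp'.
Qed.

Lemma restrE f pi F P : ext_form f pi F P -> restr T f pi = T F P.
Proof.
move=> h; apply: xget_unique; first by exists F, P.
by move=> _ [F' [P' [h' ->]]]; exact: ext_form_eq h' h.
Qed.

Lemma restr_push : eq_functional (push_functional j (restr T)) T.
Proof. by move=> f pi [fB pl]; apply: restrE; split. Qed.

(** Convergence of the coordinates on the subspace says nothing about their
    extensions off the range.  By tightness the mass outside a compact set [K] is
    small, so the coordinates may be changed off [K] at a small cost by strong
    locality.  On the part of [K] in question equi-Lipschitz functions that
    converge pointwise converge uniformly, and then so do their McShane
    extensions to the whole space. *)
Lemma restr_continuous : fun_continuous (restr T).
Proof.
move=> f pi pi_ [fB pl] fp_ cpi hL.
have Sb := LipB_nz_mbounded fB; set S := [set y | f y != 0] in Sb.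
have [F [FB Fj]] := LipB_extend ij fB.
have [M M0 FM] := LipB_bounded FB.
have /choice[l hl] i : exists L, 0 < L /\ forall n y z, S y -> S z ->
    `|pi_ n i y - pi_ n i z| <= L * mdist y z.
  have [L h] := hL i S Sb; exists (Num.max L 1); split; first by rewrite lt_max ltr01 orbT.
  move=> n y z Sy Sz; apply: (le_trans ((klipP _ _ _).1 (h n) y z Sy Sz)).
  by rewrite ler_wpM2r ?mdist_ge0// le_max lexx.
pose L := 1 + \sum_i l i.
have l0 i : 0 <= l i by apply: ltW; case: (hl i).
have L0 : 0 < L by rewrite ltr_pwDl// sumr_ge0.
have lL i : l i <= L by rewrite /L (bigD1 i)//= addrCA lerDl addr_ge0// sumr_ge0.
have piL n i y z : S y -> S z -> `|pi_ n i y - pi_ n i z| <= L * mdist y z.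
  move=> Sy Sz; apply: (le_trans ((hl i).2 n y z Sy Sz)).
  by rewrite ler_wpM2r// mdist_ge0.
have piL' i y z : S y -> S z -> `|pi i y - pi i z| <= L * mdist y z.
  move=> Sy Sz; apply: (cvgr_to_le (cvg_norm (cvgB (cpi i y) (cpi i z)))).
  by apply: nearW => n; exact: piL.
have /choice[P hP] (n : nat) : exists P : 'I_k -> X -> R,
    (forall i x x', `|P i x - P i x'| <= L * mdist x x') /\
    forall i y, S y -> P i (j y) = pi_ n i y.
  have /choice[P hP] i := klip_extend ij (ltW L0) (piL n i).
  by exists P; split => i; case: (hP i).
have /choice[P' hP'] i := klip_extend ij (ltW L0) (piL' i).
have Pl n i : LipLoc (P n i) by exact: LipLoc_lip ((hP n).1 i).
have Pl' i : LipLoc (P' i) by exact: LipLoc_lip (hP' i).1.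
have eF n : ext_form f (pi_ n) F (P n) by split => // i y Sy; exact: (hP n).2.
have eF' : ext_form f pi F P' by split => // i y Sy; exact: (hP' i).2.
rewrite (restrE eF'); under eq_fun do rewrite (restrE (eF _)).
apply/cvgrPdist_le => e e0.
pose c := (2 * L) ^+ k * M.
have c0 : 0 < c by rewrite mulr_gt0// exprn_gt0// mulr_gt0.
pose d := e / (4 * (k%:R + 1) * c).
have k1 : 0 < k%:R + 1 :> R by rewrite ltr_wpDl.
have d0 : 0 < d by rewrite divr_gt0// mulr_gt0// mulr_gt0.
have dk : k%:R * (c * d) <= e / 4.
  have -> : k%:R * (c * d) = e / 4 * (k%:R / (k%:R + 1)).
    by rewrite /d; field; rewrite !gt_eqF.
  rewrite ler_piMr ?divr_ge0 ?(ltW e0)//.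
  by rewrite ler_pdivrMr// mul1r lerDl.
have [W [Wo Wb sW]] := mbounded_open (LipB_mbounded FB).
have FW x : F x != 0 -> W x by move=> /spt_nz/sW.
have [_ _ /(_ W d Wo Wb d0)[K [Kc KW] Kd]] := HT.
pose A := K `&` (j @` S).
pose Q n i := mcshane L A (P n i); pose Q' i := mcshane L A (P' i).
have PA n i x y : A x -> A y -> `|P n i x - P n i y| <= L * mdist x y.
  by move=> _ _; exact: (hP n).1.
have PA' i x y : A x -> A y -> `|P' i x - P' i y| <= L * mdist x y.
  by move=> _ _; exact: (hP' i).1.
have QL n i x y : `|Q n i x - Q n i y| <= L * mdist x y.
  by apply: mcshane_lip; [exact: ltW|exact: PA].
have QL' i x y : `|Q' i x - Q' i y| <= L * mdist x y.
  by apply: mcshane_lip; [exact: ltW|exact: PA'].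
have Ql n i : LipLoc (Q n i) by exact: LipLoc_lip (QL n i).
have Ql' i : LipLoc (Q' i) by exact: LipLoc_lip (QL' i).
have LL : L <= 2 * L by lra.
have close (p q : 'I_k -> X -> R) :
    (forall i x y, `|p i x - p i y| <= L * mdist x y) ->
    (forall i x y, `|q i x - q i y| <= L * mdist x y) ->
    (forall i x, A x -> p i x = q i x) -> `|T F p - T F q| <= e / 4.
  move=> pL qL pq; apply: (le_trans _ dk).
  have pl' i : LipLoc (p i) by exact: LipLoc_lip (pL i).
  have ql' i : LipLoc (q i) by exact: LipLoc_lip (qL i).
  apply: (mf_telescope mT) => // s i hs; rewrite /c -mulrA.
  have sl a : LipLoc (set_coord s i (fun x => p i x - q i x) a).
    apply: LipLoc_set_coord; last exact: LipLocB.
    by move=> b; case: (hs b) => ->.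
  apply: (mf_strong_le_mass HT (i := i)) => //; [exact: ltW|by rewrite mulr_gt0| |].
  - move=> a; apply/klipP => x y _ _; rewrite /set_coord; case: eqP => _.
      have -> : p i x - q i x - (p i y - q i y) = (p i x - p i y) - (q i x - q i y) by ring.
      rewrite (le_trans (ler_normB _ _))// -mulrA mulr2n mulrDl !mul1r lerD//.
    case: (hs a) => ->; [apply: (le_trans (pL _ _ _))|apply: (le_trans (qL _ _ _))];
      by rewrite ler_wpM2r// mdist_ge0.
  - apply: le_trans (ltW Kd).
    apply: (@le_trans _ _ (mass T ((W `\` K) `|` ~` range j))).
      apply: mass_mono => x [Fx]; rewrite set_coordE subr_eq0 => /eqP pqx.
      have [[y _ yx]|nx] := pselect (range j x); last by right.
      left; split; first exact: FW.
      move=> Kx; apply: pqx; apply: pq; split => //; exists y => //.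
      by rewrite /S/= -Fj /= yx.
    rewrite (le_trans (outer_measureU2 (mass_outer HT) _ _))//.
    by rewrite [X in (_ + X <= _)%E]T0 adde0.
have cQ : T F (Q n) @[n --> \oo] --> T F Q'.
  have [_ h _] := mT; apply: h => //.
  - move=> i x; apply/cvgrPdist_le => h h0.
    have uni : \forall n \near \oo, forall a, closure A a -> `|P n i a - P' i a| <= h.
      have Ac : compact (closure A).
        apply: (subclosed_compact _ Kc); first exact: closed_closure.
        have Kcl : closed K by apply: compact_closed => //; exact: metric_hausdorff.
        by rewrite (closure_id K).1//; apply: closureS; exact: subIsetl.
      pose t := h / (8 * L); have t0 : 0 < t by rewrite divr_gt0// mulr_gt0.
      have tL : L * t = h / 8 by rewrite /t; field; rewrite gt_eqF.
      apply: ((compact_near_coveringP _).1 Ac _ _ (fun n a => `|P n i a - P' i a| <= h)).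
      move=> a Aa; have [b [Kb [y Sy yb]] ab] := closure_mdist t0 Aa.
      have h40 : 0 < h / 4 by rewrite divr_gt0.
      have nb : \forall n \near \oo, `|P n i b - P' i b| <= h / 4.
        have := cpi i y => /cvgrPdist_le/(_ _ h40); apply: filterS => n.
        by rewrite -yb (hP n).2// (hP' i).2// distrC.
      exists ([set a' | mdist a a' < t], [set n | `|P n i b - P' i b| <= h / 4]).
        by split => //=; apply/nbhs_mdistP; exists t.
      move=> [a' n] /= [aa' hn].
      have ab' : mdist a' b <= t + t.
        rewrite (le_trans (metric_triangle _ a _))// lerD ?(ltW ab)//.
        by rewrite metric_sym ltW.
      have Lab : L * mdist a' b <= h / 4.
        by rewrite (le_trans (ler_wpM2l (ltW L0) ab'))// mulrDr tL; lra.
      have -> : P n i a' - P' i a' = (P n i a' - P n i b) + (P n i b - P' i b) -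
          (P' i a' - P' i b) by ring.
      rewrite (le_trans (ler_normB _ _))//.
      have h1 := le_trans ((hP n).1 i a' b) Lab; have h2 := le_trans ((hP' i).1 a' b) Lab.
      have := ler_normD (P n i a' - P n i b) (P n i b - P' i b); lra.
    have [[a0 Aa0]|nA] := pselect (A !=set0); last first.
      apply: nearW => n; rewrite (_ : Q n i x = Q' i x) ?subrr ?normr0 ?(ltW h0)//.
      rewrite /Q /Q' /mcshane; congr inf.
      by apply/seteqP; split => z [a Aa _]; case: nA; exists a.
    move: uni; apply: filterS => n hn.
    have hA a : A a -> `|P n i a - P' i a| <= h by move=> Aa; apply: hn; exact: subset_closure.
    rewrite ler_norml; apply/andP; split.
      rewrite lerBrDl; apply: mcshane_ge; first by exists a0.
      move=> a Aa; have := mcshane_le (ltW L0) (PA n i) x Aa; rewrite -/(Q n i x).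
      by have := hA _ Aa; rewrite ler_norml => /andP[? ?]; lra.
    rewrite lerBlDr -lerBlDl; apply: mcshane_ge; first by exists a0.
    move=> a Aa; have := mcshane_le (ltW L0) (PA' i) x Aa; rewrite -/(Q' i x).
    by have := hA _ Aa; rewrite ler_norml => /andP[? ?]; lra.
  - move=> i B _; exists L => n; apply/klipP => x y _ _; exact: QL.
have e20 : 0 < e / 2 by rewrite divr_gt0.
have /cvgrPdist_le/(_ _ e20) := cQ; apply: filterS => n hn.
have h1 : `|T F P' - T F Q'| <= e / 4.
  apply: close => //; first by move=> i; exact: (hP' i).1.
  by move=> i x Ax; rewrite /Q' (mcshaneE (ltW L0) (PA' i)).
have h2 : `|T F (P n) - T F (Q n)| <= e / 4.
  apply: close => //; first exact: (hP n).1.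
  by move=> i x Ax; rewrite /Q (mcshaneE (ltW L0) (PA n i)).
have -> : T F P' - T F (P n) = (T F P' - T F Q') + (T F Q' - T F (Q n)) -
    (T F (P n) - T F (Q n)) by ring.
rewrite (le_trans (ler_normB _ _))//.
have := ler_normD (T F P' - T F Q') (T F Q' - T F (Q n)); lra.
Qed.

Lemma restr_metric_functional : metric_functional (restr T).
Proof.
split; [split|exact: restr_continuous|].
- move=> a f g pi [fB pl] gB.
  have [F [FB Fj]] := LipB_extend ij fB; have [G [GB Gj]] := LipB_extend ij gB.
  have [P [Pl PS]] := coords_extend (mboundedU (LipB_nz_mbounded fB) (LipB_nz_mbounded gB)) pl.
  have eF : ext_form f pi F P by split => // i y fy; apply: PS; left.
  have eG : ext_form g pi G P by split => // i y gy; apply: PS; right.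
  have eH : ext_form (fun y => a * f y + g y) pi (fun x => a * F x + G x) P.
    split => //.
    - by apply: LipBD => //; exact: LipBZ.
    - by apply/funext => y; rewrite -Fj -Gj.
    - move=> i y h; apply: PS; have [f0|f0] := eqVneq (f y) 0; [right|by left].
      by move: h; rewrite f0 mulr0 add0r.
  by rewrite (restrE eF) (restrE eG) (restrE eH) mfDZ.
- move=> a f pi i u v [fB pl] ul vl.
  have [F [FB Fj]] := LipB_extend ij fB.
  have Sb := LipB_nz_mbounded fB.
  have [P [Pl PS]] := coords_extend Sb pl.
  have [U [Ul US]] := @coords_extend 1 _ (fun=> u) Sb (fun=> ul).
  have [W [Wl WS]] := @coords_extend 1 _ (fun=> v) Sb (fun=> vl).
  have e w w' : LipLoc w' -> (forall y, f y != 0 -> w' (j y) = w y) ->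
      ext_form f (set_coord pi i w) F (set_coord P i w').
    move=> wl ww; split => //; first exact: LipLoc_set_coord.
    by move=> l y fy; rewrite /set_coord; case: ifP => _; [exact: ww|exact: PS].
  have eU := e u (U ord0) (Ul ord0) (US ord0).
  have eW := e v (W ord0) (Wl ord0) (WS ord0).
  have eUW : ext_form f (set_coord pi i (fun y => a * u y + v y)) F
      (set_coord P i (fun x => a * U ord0 x + W ord0 x)).
    apply: e; first by apply: LipLocD => //; exact: LipLocZ.
    by move=> y fy; rewrite (US ord0)// (WS ord0).
  by rewrite (restrE eU) (restrE eW) (restrE eUW) mf_coordDZ.
- move=> f pi [fB pl] [i [d [c [d0 hc]]]].
  have [F [FB Fj]] := LipB_extend ij fB.
  have [P [Pl PS]] := coords_extend (LipB_nz_mbounded fB) pl.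
  have e : ext_form f pi F (set_coord P i (fun=> c)).
    split => //; first by apply: LipLoc_set_coord => //; exact: LipLoc_cst.
    move=> l y fy; rewrite /set_coord; case: eqP => [->|_]; last exact: PS.
    by rewrite hc//; apply: (sub_closed_nbhd d0); exact: spt_nz.
  rewrite (restrE e); apply: (@mf_local _ _ _ _ mT _ _ i 1 c) => //.
    by apply: LipLoc_set_coord => //; exact: LipLoc_cst.
  by move=> x _; rewrite set_coordE.
Qed.

Lemma IRLoc_restr : IRLoc T -> IRLoc (restr T).
Proof.
move=> h; apply: (IRLoc_pull ij restr_metric_functional).
  exact: IRLoc_eq (eq_functional_sym restr_push) h.
by rewrite (mass_eq restr_push).
Qed.

Lemma mass_restr A : IRLoc T -> (mass (restr T) (j @^-1` A) <= mass T A)%E.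
Proof.
move=> h; rewrite -(mass_eq restr_push).
have HP : MLoc (push_functional j (restr T)).
  exact: MLoc_eq (eq_functional_sym restr_push) HT.
by apply: (mass_pull ij HP); rewrite (mass_eq restr_push).
Qed.

End fixed.

(** A cutoff of an extension restricts to a cutoff of the form. *)
Lemma boundary_restr k (T : functional X k.+1) : MLoc T -> MLoc (boundary T) ->
  mass T (~` range j) = 0%E -> mass (boundary T) (~` range j) = 0%E ->
  eq_functional (restr (boundary T)) (boundary (restr T)).
Proof.
move=> HT HB T0 B0 f pi [fB pl]; have [mT _ _] := HT.
have [F [FB Fj]] := LipB_extend ij fB.
have [s sF] := cutoff_spt_exists FB.
have sjB : LipB (s \o j) by apply: iso_LipB => //; case: sF.
have [P [Pl PS]] := coords_extend (mboundedU (LipB_nz_mbounded fB) (LipB_nz_mbounded sjB)) pl.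
have e : ext_form f pi F P by split => // i y fy; apply: PS; left.
have sj : cutoff f (s \o j) by rewrite -Fj; exact: cutoff_push.
have e' : ext_form (s \o j) (cons_coord f pi) s (cons_coord F P).
  split => //; first by case: sF.
  - by apply: LipLoc_cons_coord => //; exact: LipB_LipLoc.
  - move=> i y sy; rewrite /cons_coord; case: unlift => [l|]; last by rewrite -Fj.
    by apply: PS; right.
rewrite (restrE HB B0 e) (boundaryE mT _ sF)//.
rewrite (boundaryE (restr_metric_functional HT T0) _ sj)//.
by rewrite (restrE HT T0 e').
Qed.

Lemma ILoc_restr k (T : functional X k.+1) : ILoc T ->
  mass T (~` range j) = 0%E -> mass (boundary T) (~` range j) = 0%E ->
  ILoc (restr T).
Proof.
move=> [hT hB] T0 B0; have [HT _ _] := hT; have [HB _ _] := hB.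
split; first exact: IRLoc_restr.
by apply: (IRLoc_eq (boundary_restr HT HB T0 B0)); exact: IRLoc_restr.
Qed.

End restriction.

(** * Constructing complete metric spaces *)

Definition dist_cauchy (R : realType) (A : Type) (d : A -> A -> R) (u : nat -> A) : Prop :=
  forall e, 0 < e -> exists N, forall n m, (N <= n)%N -> (N <= m)%N -> d (u n) (u m) <= e.

Definition dist_cvg (R : realType) (A : Type) (d : A -> A -> R) (u : nat -> A) (a : A) : Prop :=
  forall e, 0 < e -> exists N, forall n, (N <= n)%N -> d (u n) a <= e.

(** Completeness is sequential: this is how it is verified for subspaces,
    products and amalgams. *)
Record complete_pseudodist (R : realType) := CompletePseudodist {
  cpd_sort : Type;
  cpd : cpd_sort -> cpd_sort -> R;
  cpd_point : cpd_sort;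
  cpdxx : forall a, cpd a a = 0;
  cpd_sym : forall a b, cpd a b = cpd b a;
  cpd_triangle : forall b a c, cpd a c <= cpd a b + cpd b c;
  cpd_complete : forall u, dist_cauchy cpd u -> exists a, dist_cvg cpd u a }.

Section metric_quotient.
Variables (R : realType) (A : complete_pseudodist R).
Local Notation d := (@cpd R A).

(** The point of the quotient represented by [a] is encoded by the function
    [d a], which identifies exactly the points at distance zero. *)
Definition mquot : Type := {f : cpd_sort A -> R | exists a, f = d a}.

Definition mq (a : cpd_sort A) : mquot := exist _ (d a) (ex_intro _ a erefl).

Definition mq_repr (q : mquot) : cpd_sort A := sval (cid (svalP q)).

Lemma mq_reprE (q : mquot) : sval q = d (mq_repr q).
Proof. exact: (svalP (cid (svalP q))). Qed.

Lemma mq_reprK : cancel mq_repr mq.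
Proof.
by move=> [f hf]; apply: eq_exist; rewrite -mq_reprE.
Qed.

Definition mq_dist (p q : mquot) : R := d (mq_repr p) (mq_repr q).

Lemma mq_distE a b : mq_dist (mq a) (mq b) = d a b.
Proof.
have E c : d (mq_repr (mq c)) = d c by rewrite -mq_reprE.
by rewrite /mq_dist E cpd_sym E cpd_sym.
Qed.

Let mq_distxx p : mq_dist p p = 0. Proof. exact: cpdxx. Qed.

Let mq_dist_positivity p q : mq_dist p q = 0 -> p = q.
Proof.
move=> pq; rewrite -[p]mq_reprK -[q]mq_reprK; apply: eq_exist.
apply/funext => c; apply/eqP; rewrite eq_le.
have h1 := cpd_triangle (mq_repr q) (mq_repr p) c.
have h2 := cpd_triangle (mq_repr p) (mq_repr q) c.
rewrite [d _ (mq_repr p)]cpd_sym in h2; rewrite /mq_dist in pq.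
by apply/andP; split; lra.
Qed.

Let mq_dist_sym p q : mq_dist p q = mq_dist q p. Proof. exact: cpd_sym. Qed.

Let mq_dist_triangle q p r : mq_dist p r <= mq_dist p q + mq_dist q r.
Proof. exact: cpd_triangle. Qed.

HB.instance Definition _ := gen_eqMixin mquot.
HB.instance Definition _ := gen_choiceMixin mquot.
HB.instance Definition _ := isPointed.Build mquot (mq (cpd_point A)).
HB.instance Definition _ := @isMetric.Build R mquot mq_dist
  mq_distxx mq_dist_positivity mq_dist_sym mq_dist_triangle.

Let mquot_complete (F : set_system mquot) : ProperFilter F -> cauchy F -> cvg F.
Proof.
move=> PF /cauchyP Fc.
have /choice[x hx] (n : nat) : exists x, F (ball x n.+1%:R^-1).
  by apply: Fc; rewrite invr_gt0.
have xx n m : mdist (x n) (x m) <= n.+1%:R^-1 + m.+1%:R^-1.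
  have [y [yn ym]] := filter_ex (filterI (hx n) (hx m)).
  rewrite !ballEmdist /= in yn ym.
  by rewrite (le_trans (metric_triangle _ y _))// lerD ?(ltW yn)// metric_sym ltW.
have small (e : R) : 0 < e -> exists N, forall n, (N <= n)%N -> n.+1%:R^-1 <= e.
  by move=> /natSinv_lt[N hN]; exists N => n /hN/ltW.
have [|a ha] := @cpd_complete R A (fun n => mq_repr (x n)).
  move=> e e0; have [N hN] := small (e / 2) (divr_gt0 e0 (ltr0Sn R 1)).
  by exists N => n m nN mN; rewrite (le_trans (xx n m))// [leRHS]splitr lerD ?hN.
apply/cvg_ex; exists (mq a).
move=> P /nbhs_mdistP[e e0 eP].
have e20 : 0 < e / 2 by rewrite divr_gt0.
have e40 : 0 < e / 4 by rewrite divr_gt0.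
have [N1 h1] := small _ e40; have [N2 h2] := ha _ e20.
pose n := maxn N1 N2; apply: filterS (hx n) => y; rewrite ballEmdist /= => ny.
apply: eP; have h3 : mdist (mq a) (x n) <= e / 2.
  rewrite metric_sym -[x n]mq_reprK.
  by rewrite [mdist _ _]mq_distE; apply: h2; exact: leq_maxr.
have h4 : n.+1%:R^-1 <= e / 4 by apply: h1; exact: leq_maxl.
have h5 := lt_le_trans ny h4.
apply: (le_lt_trans (metric_triangle _ (x n) _)).
by apply: (@le_lt_trans _ _ (e / 2 + mdist (x n) y)); [rewrite lerD2r|lra].
Qed.

HB.instance Definition _ := Uniform_isComplete.Build mquot mquot_complete.

Lemma mquot_mdist a b : mdist (mq a) (mq b) = d a b.
Proof. exact: mq_distE. Qed.

End metric_quotient.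

Lemma metric_quotient_exists (R : realType) (A : complete_pseudodist R) :
  exists (M : completeMetricType R) (q : cpd_sort A -> M),
    (forall a b, mdist (q a) (q b) = cpd a b) /\ forall x, exists a, q a = x.
Proof.
exists (mquot A : completeMetricType R), (@mq R A); split; first exact: mquot_mdist.
by move=> x; exists (mq_repr x); exact: mq_reprK.
Qed.

Lemma dist_cauchy_cvg (R : realType) (X : completeMetricType R) (u : nat -> X) :
  dist_cauchy (@mdist R X) u -> exists a, dist_cvg (@mdist R X) u a.
Proof.
move=> uc; have cu : cvg (u @ \oo).
  apply: cauchy_cvg; apply: cauchy_exP => e e0.
  have [N hN] := uc (e / 2) (divr_gt0 e0 (ltr0Sn R 1)).
  exists (u N); exists N => // n /= Nn; rewrite ballEmdist /=.
  by apply: (@le_lt_trans _ _ (e / 2)); [exact: hN|lra].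
exists (lim (u @ \oo)) => e e0.
have [N _ hN] := metricType_numDomainType.cvgr_dist_le cu e0.
by exists N => n Nn; rewrite metric_sym; exact: hN.
Qed.

Lemma dist_cvg_closed (R : realType) (X : completeMetricType R) (C : set X) (u : nat -> X) a :
  closed C -> (forall n, C (u n)) -> dist_cvg (@mdist R X) u a -> C a.
Proof.
move=> Cc Cu ua; apply: Cc => V /nbhs_mdistP[e e0 eV].
have [N hN] := ua (e / 2) (divr_gt0 e0 (ltr0Sn R 1)).
exists (u N); split => //; apply: eV; rewrite metric_sym.
by apply: (@le_lt_trans _ _ (e / 2)); [exact: hN|lra].
Qed.

Lemma subspace_exists (R : realType) (X : completeMetricType R) (C : set X) :
  closed C -> C !=set0 -> exists (Y : completeMetricType R) (j : Y -> X),
    isometric_embedding j /\ range j = C.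
Proof.
move=> Cc [x0 Cx0].
pose T := {x : X | C x}; pose d (a b : T) := mdist (sval a) (sval b).
have dc (u : nat -> T) : dist_cauchy d u -> exists a, dist_cvg d u a.
  move=> uc; have [a ha] := @dist_cauchy_cvg R X (fun n => sval (u n)) uc.
  have Ca : C a by apply: dist_cvg_closed ha => // n; exact: svalP.
  by exists (exist _ a Ca).
have [Y [q [qd qs]]] := metric_quotient_exists (@CompletePseudodist R T d
  (exist _ x0 Cx0) (fun a => mdistxx _) (fun a b => metric_sym _ _)
  (fun b a c => metric_triangle _ _ _) dc).
have /choice[r hr] := qs.
exists Y, (fun y => sval (r y)); split.
  by move=> y z; rewrite -[in RHS](hr y) -[in RHS](hr z) qd.
apply/seteqP; split => x; first by move=> [y _ <-]; exact: svalP.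
move=> Cx; exists (q (exist _ x Cx)) => //.
apply: mdist_positivity.
by have := qd (r (q (exist _ x Cx))) (exist _ x Cx); rewrite hr mdistxx => /esym.
Qed.

(** * Separability *)

Section separability.
Variable R : realType.

Definition separable_set (X : metricType R) (A : set X) : Prop :=
  exists D : set X, [/\ countable D, D `<=` A & A `<=` closure D].

Lemma separable_set_image (X Y : metricType R) (f : X -> Y) : separable X ->
  continuous f -> separable_set (range f).
Proof.
move=> [D Dc Dd] fc; exists (f @` D); split.
- exact: (card_le_trans (card_image_le f D)).
- by move=> _ [x _ <-]; exists x.
- move=> _ [x _ <-] V Vfx; have [W [Wo Wx] WV] : exists2 W : set X,
      open W /\ W x & W `<=` f @^-1` V.
    by have := fc x V Vfx; rewrite nbhsE => -[W [? ?] ?]; exists W.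
  have [y [Wy Dy]] := Dd W (ex_intro _ x Wx) Wo.
  by exists (f y); split; [exists y|exact: WV].
Qed.

Lemma separable_set_bigcup (X : metricType R) (F : nat -> set X) :
  (forall n, separable_set (F n)) -> separable_set (\bigcup_n F n).
Proof.
move=> /choice[D hD]; exists (\bigcup_n D n); split.
- by apply: bigcup_countable => // n _; case: (hD n).
- by apply: subset_bigcup => n _; case: (hD n).
- move=> x [n _ Fx]; have [_ _ /(_ x Fx)] := hD n.
  by apply: closureS; exact: bigcup_sup.
Qed.

Lemma separable_setU (X : metricType R) (A B : set X) : separable_set A ->
  separable_set B -> separable_set (A `|` B).
Proof.
move=> hA hB; rewrite -bigcup2E; apply: separable_set_bigcup => -[|[|n]] //=.
by exists set0; split; [exact: countable0|exact: sub0set|exact: sub0set].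
Qed.

Lemma separable_set_compact (X : completeMetricType R) (K : set X) : compact K ->
  separable_set K.
Proof.
move=> Kc.
have /choice[D hD] (n : nat) : exists D : set X, [/\ finite_set D, D `<=` K &
    forall x, K x -> exists2 y, D y & mdist x y < n.+1%:R^-1].
  move: Kc; rewrite compact_cover => /(_ X K (fun y => [set x | mdist y x < n.+1%:R^-1])) [].
  - by move=> y _; exact: open_mball.
  - by move=> x Kx; exists x => //=; rewrite mdistxx invr_gt0.
  move=> D DK KD; exists [set` D]; split; first exact: finite_fset.
    by move=> y /= /DK; rewrite inE.
  by move=> x /KD[y Dy] /=; rewrite metric_sym; exists y.
exists (\bigcup_n D n); split.
- by apply: bigcup_countable => // n _; apply: finite_set_countable; case: (hD n).
- by apply: bigcup_sub => n _; case: (hD n).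
- move=> x Kx V /nbhs_mdistP[e e0 eV].
  have [N /(_ N (leqnn N)) hN] := natSinv_lt e0.
  have [_ _ /(_ x Kx)[y Dy xy]] := hD N; exists y; split; first by exists N.
  by apply: eV; exact: lt_trans xy hN.
Qed.

Lemma separable_closure_range (X Y : completeMetricType R) (j : Y -> X) (A : set X) :
  isometric_embedding j -> range j = closure A -> separable_set A -> separable Y.
Proof.
move=> ij jA [D [Dc DA AD]]; exists (j @^-1` D).
  apply/countable_injP; have /countable_injP[f finj] := Dc.
  exists (f \o j) => x y Dx Dy /= fxy; apply: (iso_inj ij); apply: finj fxy.
    by rewrite inE; move: Dx; rewrite inE.
  by rewrite inE; move: Dy; rewrite inE.
move=> V [y Vy] Vo; have [e e0 eV] := (openP V).1 Vo y Vy.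
have : closure A (j y) by rewrite -jA; exists y.
move=> /(closureS AD); rewrite -(closure_id _).1; last exact: closed_closure.
move=> /(closure_mdist e0)[x Dx xy].
have [z _ zx] : range j x by rewrite jA; apply: subset_closure; exact: DA.
exists z; split; last by rewrite /= zx.
by apply: eV; rewrite -ij zx.
Qed.

Lemma separable_cover (W : metricType R) : separable_set [set: W] -> separable W.
Proof.
move=> [D [Dc _ WD]]; exists D => // V [x Vx] Vo.
have /(_ V) [|y [Dy Vy]] := WD x I; first by rewrite nbhsE; exists V.
by exists y.
Qed.

End separability.

(** * Gluing along a common subspace *)

(** In the product with the maximum distance, the slices through the base points
    are isometric copies of the factors. *)
Lemma common_space_exists (R : realType) (X Z : completeMetricType R) :
  exists (W : completeMetricType R) (a : X -> W) (b : Z -> W),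
    isometric_embedding a /\ isometric_embedding b.
Proof.
pose d (p q : X * Z) := Num.max (mdist p.1 q.1) (mdist p.2 q.2).
have d1 p q : mdist p.1 q.1 <= d p q by rewrite le_max lexx.
have d2 p q : mdist p.2 q.2 <= d p q by rewrite le_max lexx orbT.
have dxx p : d p p = 0 by rewrite /d !mdistxx maxxx.
have dsym p q : d p q = d q p by rewrite /d metric_sym [X in Num.max _ X]metric_sym.
have dtri q p r : d p r <= d p q + d q r.
  rewrite ge_max; apply/andP; split.
    by rewrite (le_trans (metric_triangle _ q.1 _))// lerD.
  by rewrite (le_trans (metric_triangle _ q.2 _))// lerD.
have dc u : dist_cauchy d u -> exists a, dist_cvg d u a.
  move=> uc.
  have [x hx] : exists x, dist_cvg (@mdist R X) (fun n => (u n).1) x.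
    apply: dist_cauchy_cvg => e e0; have [N hN] := uc e e0.
    by exists N => n m nN mN; exact: le_trans (hN n m nN mN).
  have [z hz] : exists z, dist_cvg (@mdist R Z) (fun n => (u n).2) z.
    apply: dist_cauchy_cvg => e e0; have [N hN] := uc e e0.
    by exists N => n m nN mN; exact: le_trans (hN n m nN mN).
  exists (x, z) => e e0; have [N hN] := hx e e0; have [M hM] := hz e e0.
  exists (maxn N M) => n; rewrite geq_max => /andP[nN nM].
  by rewrite ge_max; apply/andP; split; [exact: hN|exact: hM].
have [W [q [qd _]]] := metric_quotient_exists (@CompletePseudodist R _ d
  (point, point) dxx dsym dtri dc).
exists W, (fun x => q (x, point)), (fun z => q (point, z)); split => x y; rewrite qd /=.
  by rewrite /d/= mdistxx max_l// mdist_ge0.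
by rewrite /d/= mdistxx max_r// mdist_ge0.
Qed.

Section gluing.
Variables (R : realType) (Z : completeMetricType R) (Y : nat -> completeMetricType R).
Variable psi : forall n, Z -> Y n.
Hypothesis ipsi : forall n, isometric_embedding (psi n).

Local Notation A := {n : nat & Y n}.
Local Notation pt := (existT (fun n => CompleteMetric.sort (Y n))).

Let tr (p : A) (z : Z) : R := mdist (tagged p) (psi (tag p) z).

Let cross (p q : A) : R := inf [set tr p z + tr q z | z in [set: Z]].

(** Points of different pieces are joined through the common subspace. *)
Let D (p q : A) : R :=
  if tag p == tag q then mdist (tagged p) (tagged_as p q) else cross p q.

Let D_same n (x y : Y n) : D (pt n x) (pt n y) = mdist x y.
Proof. by rewrite /D eqxx tagged_asE. Qed.

Let D_diff p q : tag p != tag q -> D p q = cross p q.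
Proof. by rewrite /D => /negPf ->. Qed.

Let cross_le p q z : cross p q <= tr p z + tr q z.
Proof.
apply: ge_inf; last by exists z.
by exists 0 => w [z' _ <-]; rewrite addr_ge0// mdist_ge0.
Qed.

Let cross_ge p q c : (forall z, c <= tr p z + tr q z) -> c <= cross p q.
Proof.
move=> h; apply: lb_le_inf; first by exists (tr p point + tr q point), point.
by move=> _ [z _ <-].
Qed.

Let tr_tri p z z' : tr p z <= tr p z' + mdist z' z.
Proof. by rewrite /tr -(@ipsi (tag p)) metric_triangle. Qed.

Let tr_sum p z z' : mdist z z' <= tr p z + tr p z'.
Proof. by rewrite /tr -(@ipsi (tag p)) (metric_sym (tagged p)) metric_triangle. Qed.

Let D_le_tr p q z : D p q <= tr p z + tr q z.
Proof.
case: p q => n x [m y]; have [e|ne] := eqVneq n m; last first.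
  by rewrite D_diff//; exact: cross_le.
case: m / e y => y; rewrite D_same /tr/= (metric_sym y).
exact: metric_triangle.
Qed.

Let tr_le_D p q z : tr q z <= D p q + tr p z.
Proof.
case: p q => n x [m y]; have [e|ne] := eqVneq n m.
  case: m / e y => y; rewrite D_same /tr/= (metric_sym x).
  exact: metric_triangle.
rewrite D_diff// -lerBlDr; apply: cross_ge => z'.
set p := pt n x; set q := pt m y.
have := tr_tri q z z'; have := tr_sum p z' z; lra.
Qed.

Let D_sym p q : D p q = D q p.
Proof.
case: p q => n x [m y]; have [e|ne] := eqVneq n m.
  by case: m / e y => y; rewrite !D_same metric_sym.
rewrite !D_diff//= 1?eq_sym//; congr inf.
by apply/seteqP; split => w [z _ <-]; exists z => //; rewrite addrC.
Qed.

Let D_xx p : D p p = 0.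
Proof. by case: p => n x; rewrite D_same mdistxx. Qed.

Let D_tri q p r : D p r <= D p q + D q r.
Proof.
have [epq|npq] := eqVneq (tag p) (tag q); last first.
  rewrite (D_diff npq) -lerBlDr; apply: cross_ge => z.
  have := D_le_tr p r z; have := tr_le_D q r z; lra.
have [eqr|nqr] := eqVneq (tag q) (tag r); last first.
  rewrite (D_diff nqr) -lerBlDl; apply: cross_ge => z.
  have := D_le_tr p r z; have := tr_le_D q p z; rewrite (D_sym q p); lra.
case: p q r epq eqr => n x [m y] [l w] /= e; case: m / e y => y e.
by case: l / e w => w; rewrite !D_same metric_triangle.
Qed.

(** A Cauchy sequence either stays in one piece along a subsequence, or visits
    infinitely many pieces and then approaches the common subspace. *)
Let D_complete u : dist_cauchy D u -> exists a, dist_cvg D u a.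
Proof.
move=> uc.
have [[t ht]|nt] := pselect (exists t, forall N, exists2 n, (N <= n)%N & tag (u n) = t).
  have /choice[v hv] N : exists y : Y t, exists2 n, (N <= n)%N & u n = pt t y.
    have [n Nn] := ht N; case uy : (u n) => [t' y] /= e.
    by case: t / e ht => ht; exists y; exists n.
  have [y vy] : exists y, dist_cvg (@mdist R (Y t)) v y.
    apply: dist_cauchy_cvg => e e0; have [N hN] := uc e e0; exists N => n m nN mN.
    have [a na ua] := hv n; have [b mb ub] := hv m.
    by rewrite -D_same -ua -ub; apply: hN; [exact: leq_trans na|exact: leq_trans mb].
  exists (pt t y) => e e0; have e20 : 0 < e / 2 by rewrite divr_gt0.
  have [N hN] := uc _ e20; have [M hM] := vy _ e20.
  exists N => n nN; have [a ka ua] := hv (maxn N M).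
  rewrite (le_trans (D_tri (u a) _ _))// [leRHS]splitr lerD//.
    by apply: hN => //; apply: leq_trans ka; exact: leq_maxl.
  by rewrite ua D_same; apply: hM; exact: leq_maxr.
have fin t : exists N, forall n, (N <= n)%N -> tag (u n) != t.
  apply: contrapT => h; apply: nt; exists t => N; apply: contrapT => h'.
  by apply: h; exists N => n nN; apply/eqP => e; apply: h'; exists n.
have near e : 0 < e -> exists N z, forall n, (N <= n)%N -> tr (u n) z <= e.
  move=> e0; have e30 : 0 < e / 3 by rewrite divr_gt0.
  have [N hN] := uc _ e30; have [M hM] := fin (tag (u N)).
  have nm : tag (u N) != tag (u (maxn N M)) by rewrite eq_sym hM// leq_maxr.
  have NM : D (u N) (u (maxn N M)) <= e / 3 by apply: hN => //; exact: leq_maxl.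
  rewrite (D_diff nm) in NM.
  have [z hz] : exists z, tr (u N) z <= 2 * (e / 3).
    apply: contrapT => h; have : 2 * (e / 3) <= cross (u N) (u (maxn N M)).
      apply: cross_ge => z; have : 2 * (e / 3) <= tr (u N) z.
        by rewrite leNgt; apply/negP => h'; apply: h; exists z; exact: ltW.
      by move=> /le_trans; apply; rewrite lerDl mdist_ge0.
    lra.
  exists N, z => n nN; have := tr_le_D (u N) (u n) z.
  have := hN N n (leqnn _) nN; lra.
have /choice[z hz] (k : nat) : exists z, exists N, forall n, (N <= n)%N ->
    tr (u n) z <= k.+1%:R^-1.
  have k0 : 0 < k.+1%:R^-1 :> R by rewrite invr_gt0.
  by have [N [z h]] := near _ k0; exists z, N.
have small (e : R) : 0 < e -> exists N, forall n, (N <= n)%N -> n.+1%:R^-1 <= e.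
  by move=> /natSinv_lt[N hN]; exists N => n /hN/ltW.
have [z0 zz0] : exists z0, dist_cvg (@mdist R Z) z z0.
  apply: dist_cauchy_cvg => e e0; have [N hN] := small (e / 2) (divr_gt0 e0 (ltr0Sn R 1)).
  exists N => n m nN mN; have [a ha] := hz n; have [b hb] := hz m.
  have h1 := ha (maxn a b) (leq_maxl _ _); have h2 := hb (maxn a b) (leq_maxr _ _).
  apply: (le_trans (tr_sum (u (maxn a b)) (z n) (z m))); rewrite [leRHS]splitr.
  by apply: lerD; [exact: le_trans h1 (hN n nN)|exact: le_trans h2 (hN m mN)].
exists (pt 0%N (psi 0%N z0)) => e e0.
have e20 : 0 < e / 2 by rewrite divr_gt0.
have [N hN] := small _ e20; have [M hM] := zz0 _ e20.
pose k := maxn N M; have [a ha] := hz k; exists a => n na.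
have := D_le_tr (u n) (pt 0%N (psi 0%N z0)) z0.
rewrite [tr (pt _ _) _]/tr/= mdistxx addr0 => /le_trans; apply.
have h1 := ha n na; have h2 := tr_tri (u n) z0 (z k).
have h3 : k.+1%:R^-1 <= e / 2 by apply: hN; exact: leq_maxl.
have h4 : mdist (z k) z0 <= e / 2 by apply: hM; exact: leq_maxr.
by rewrite (le_trans h2)// [leRHS]splitr lerD// (le_trans h1).
Qed.

Lemma gluing_exists : exists (W : completeMetricType R) (iota : forall n, Y n -> W),
  [/\ forall n, isometric_embedding (iota n),
      forall n m z, iota n (psi n z) = iota m (psi m z) &
      forall w, exists n y, iota n y = w].
Proof.
have [W [q [qd qs]]] := metric_quotient_exists (@CompletePseudodist R A D
  (pt 0%N (point : Y 0%N)) D_xx D_sym D_tri D_complete).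
exists W, (fun n y => q (pt n y)); split.
- by move=> n x y; rewrite qd; exact: D_same.
- move=> n m z; apply: mdist_positivity; rewrite qd /=; apply/eqP; rewrite eq_le.
  apply/andP; split; last by rewrite -[X in _ <= X]qd mdist_ge0.
  apply: (le_trans (D_le_tr _ _ z)).
  by rewrite /tr/= !mdistxx addr0.
- by move=> w; have [[n y] <-] := qs w; exists n, y.
Qed.

End gluing.

(** * Separable bridges between two current spaces *)

Section bridges.
Variable R : realType.

Lemma closed_nbhd_set1 (X : metricType R) (r : R) (c x : X) :
  closed_nbhd r [set c] x -> mdist x c <= r.
Proof.
move=> h; apply/ler_addgt0Pr => e e0.
by have [y -> /ltW] := @closed_nbhd_lt _ _ r (r + e) _ x ltac:(by rewrite ltrDl) h.
Qed.

(** The mass on each ball around the base point is carried, up to arbitrarily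
    small errors, by compact sets; countably many of them carry all of it. *)
Lemma MLoc_separable_carrier (X : completeMetricType R) k (T : functional X k) : MLoc T ->
  exists2 A : set X, separable_set A & forall B, A `<=` B -> closed B -> mass T (~` B) = 0%E.
Proof.
move=> HT; have [_ _ tight] := HT.
pose V (n : nat) := [set x : X | mdist point x < n%:R].
have Vo n : open (V n) by exact: open_mball.
have Vb n : mbounded (V n) by apply/(mboundedP (point : X)); exists n%:R => x /ltW.
have /choice[K hK] (nm : nat * nat) : exists K, [/\ compact K, K `<=` V nm.1 &
    (mass T (V nm.1 `\` K) < (nm.2.+1%:R^-1)%:E)%E].
  have m0 : 0 < nm.2.+1%:R^-1 :> R by rewrite invr_gt0.
  by have [K [Kc KV] Ke] := tight _ _ (Vo nm.1) (Vb nm.1) m0; exists K.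
exists (\bigcup_n \bigcup_m K (n, m)).
  apply: separable_set_bigcup => n; apply: separable_set_bigcup => m.
  by apply: separable_set_compact; case: (hK (n, m)).
move=> B KB Bc.
have VB0 n : mass T (V n `\` B) = 0%E.
  apply/eqP; rewrite eq_le mass_ge0 andbT; apply/lee_addgt0Pr => e e0; rewrite add0e.
  have [m /(_ m (leqnn m))/ltW me] := natSinv_lt e0.
  have [_ _ /ltW h] := hK (n, m); apply: (@le_trans _ _ (m.+1%:R^-1)%:E); last by rewrite lee_fin.
  apply: (le_trans _ h); apply: mass_mono => x [Vx nBx]; split => // Kx.
  by apply: nBx; apply: KB; exists n => //; exists m.
apply/eqP; rewrite eq_le mass_ge0 andbT.
apply: (@le_trans _ _ (mass T (\bigcup_n (V n `\` B)))).
  apply: mass_mono => x nBx; exists (Num.bound (mdist point x)) => //; split => //.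
  by rewrite /V/= archi_boundP// mdist_ge0.
apply: (le_trans (mass_sigma_subadditive HT _)).
by under eq_eseriesr do rewrite VB0; rewrite eseries0.
Qed.

Lemma factor_range (X W Y : completeMetricType R) (phi : X -> W) (j : Y -> W) :
  isometric_embedding phi -> isometric_embedding j -> range phi `<=` range j ->
  exists2 psi : X -> Y, isometric_embedding psi & j \o psi = phi.
Proof.
move=> iphi ij h.
have /choice[psi hpsi] x : exists y, j y = phi x.
  by have [y _ yx] := h (phi x) (ex_intro2 _ _ x I erefl); exists y.
exists psi; last by apply/funext => x /=.
by move=> x y; rewrite -ij !hpsi.
Qed.

Lemma separable_subspace (P Q W : completeMetricType R) (a : P -> W) (b : Q -> W)
    (A : set W) : separable P -> separable Q -> separable_set A ->
  isometric_embedding a -> isometric_embedding b ->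
  exists (Y : completeMetricType R) (j : Y -> W) (a' : P -> Y) (b' : Q -> Y),
    [/\ separable Y, isometric_embedding j, A `<=` range j,
      isometric_embedding a' /\ j \o a' = a & isometric_embedding b' /\ j \o b' = b].
Proof.
move=> sP sQ sA ia ib; pose A' := (range a `|` range b) `|` A.
have sA' : separable_set A'.
  apply: separable_setU => //.
  by apply: separable_setU; apply: separable_set_image => //; exact: iso_continuous.
have [Y [j [ij jA]]] : exists (Y : completeMetricType R) (j : Y -> W),
    isometric_embedding j /\ range j = closure A'.
  apply: subspace_exists; first exact: closed_closure.
  by exists (a point); apply: subset_closure; left; left; exists point.
have A'j : A' `<=` range j by rewrite jA; exact: subset_closure.
have [a' ia' ja] : exists2 a' : P -> Y, isometric_embedding a' & j \o a' = a.
  by apply: factor_range => // x ax; apply: A'j; left; left.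
have [b' ib' jb] : exists2 b' : Q -> Y, isometric_embedding b' & j \o b' = b.
  by apply: factor_range => // x bx; apply: A'j; left; right.
exists Y, j, a', b'; split => //; first exact: separable_closure_range ij jA sA'.
by move=> x Ax; apply: A'j; right.
Qed.

Variable k : nat.

Definition bridge_near (P Q : pointed_current_space R k) (Y : completeMetricType R)
    (a : P -> Y) (b : Q -> Y) (e : R) : Prop :=
  mdist (a (pcs_base P)) (b (pcs_base Q)) < e /\
  exists U V, flat_decomposition (push_functional a (pcs_current P))
                               (push_functional b (pcs_current Q)) U V /\
    (mass U (closed_nbhd e^-1 [set b (pcs_base Q)]) +
     mass V (closed_nbhd e^-1 [set b (pcs_base Q)]) < e%:E)%E.

(** For the indices at which the capped distance gives no information. *)
Lemma trivial_bridge (P Q : pointed_current_space R k) :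
  exists (Y : completeMetricType R) (a : P -> Y) (b : Q -> Y),
    [/\ separable Y, isometric_embedding a & isometric_embedding b].
Proof.
have [W [a [b [ia ib]]]] := common_space_exists P Q.
have s0 : separable_set (set0 : set W).
  by exists set0; split; [exact: countable0|exact: sub0set|exact: sub0set].
have [Y [j [a' [b' [Ys _ _ [ia' _] [ib' _]]]]]] :=
  separable_subspace (pcs_separable P) (pcs_separable Q) s0 ia ib.
by exists Y, a', b'.
Qed.

End bridges.

Section flat_bridge.
Variables (R : realType) (k : nat).

(** The filling currents and their boundaries are carried by separable sets, and
    so they live on a separable closed subspace that contains both spaces. *)
Lemma flat_bridge (P Q : pointed_current_space R k.+1) (e : R) : flat_close P Q e ->
  exists (Y : completeMetricType R) (a : P -> Y) (b : Q -> Y),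
    [/\ separable Y, isometric_embedding a, isometric_embedding b & bridge_near a b e].
Proof.
move=> [e0 [W [a [b [ia ib ab /(_ _ (or_intror erefl))]]]]].
move=> [U [V [[IU IV UV] mUV]]].
have [[HU _ _] [HdU _ _]] := IU; have [[HV _ _] [HdV _ _]] := IV.
have [A1 s1 c1] := MLoc_separable_carrier HU.
have [A2 s2 c2] := MLoc_separable_carrier HdU.
have [A3 s3 c3] := MLoc_separable_carrier HV.
have [A4 s4 c4] := MLoc_separable_carrier HdV.
pose A := (A1 `|` A2) `|` (A3 `|` A4).
have As : separable_set A by apply: separable_setU; exact: separable_setU.
have [Y [j [a' [b' [Ys ij Ac [ia' ja] [ib' jb]]]]]] :=
  separable_subspace (pcs_separable P) (pcs_separable Q) As ia ib.
have rc := iso_range_closed ij.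
have U0 : mass U (~` range j) = 0%E by apply: c1 => // x h; apply: Ac; left; left.
have dU0 : mass (boundary U) (~` range j) = 0%E.
  by apply: c2 => // x h; apply: Ac; left; right.
have V0 : mass V (~` range j) = 0%E by apply: c3 => // x h; apply: Ac; right; left.
have dV0 : mass (boundary V) (~` range j) = 0%E.
  by apply: c4 => // x h; apply: Ac; right; right.
exists Y, a', b'; split => //.
split; first by rewrite -ij -[j (a' _)]/((j \o a') _) -[j (b' _)]/((j \o b') _) ja jb.
exists (restr j U), (restr j V); split.
  split; [exact: ILoc_restr|exact: ILoc_restr|].
  move=> f pi [fB pl].
  have [F [FB Fj]] := LipB_extend ij fB.
  have [G [Gl GS]] := coords_extend ij (LipB_nz_mbounded fB) pl.
  have ef : ext_form j f pi F G by split.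
  rewrite -(boundary_restr ij HV HdV V0 dV0)//.
  rewrite (restrE HU U0 ef) (restrE HdV dV0 ef) -UV//.
  have E (S : pointed_current_space R k.+1) (c : S -> W) (c' : S -> Y) :
      isometric_embedding c -> isometric_embedding c' -> j \o c' = c ->
      push_functional c' (pcs_current S) f pi = push_functional c (pcs_current S) F G.
    move=> ic ic' jc; rewrite /push_functional.
    have [[HS _ _] _] := pcs_current_ILoc S.
    have -> : F \o c = f \o c' by rewrite -jc -Fj.
    apply: (mf_null_congr HS).
    - exact: iso_LipB.
    - by move=> i; exact: iso_LipLoc.
    - by move=> i; exact: iso_LipLoc.
    - move=> i; rewrite (_ : [set x | _] = set0) ?(mass_set0 HS)//.
      rewrite -subset0 => x /= [fx /eqP]; apply.
      by rewrite -jc /= GS.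
  by rewrite (E _ a)// (E _ b).
apply: le_lt_trans mUV; apply: leeD.
  apply: (le_trans _ (mass_restr ij HU U0 _ IU.1)); apply: mass_mono => y hy /=.
  apply: (closed_nbhd_mdist _ (_ : [set b (pcs_base Q)] _)); rewrite ?invr_gt0//.
  by rewrite -jb /= ij; exact: closed_nbhd_set1.
apply: (le_trans _ (mass_restr ij HV V0 _ IV.1)); apply: mass_mono => y hy /=.
apply: (closed_nbhd_mdist _ (_ : [set b (pcs_base Q)] _)); rewrite ?invr_gt0//.
by rewrite -jb /= ij; exact: closed_nbhd_set1.
Qed.

Lemma dF_close (P Q : pointed_current_space R k) (t : R) : (dF P Q < (2^-1)%:E)%E ->
  0 < t -> exists2 e, flat_close P Q e & (e%:E < dF P Q + t%:E)%E.
Proof.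
rewrite /dF => h t0.
have hd : (dF_tilde P Q < (2^-1)%:E)%E.
  rewrite ltNge; apply/negP => h'; move: h.
  by rewrite min_r// ltxx.
rewrite min_l; last exact: ltW.
have d0 : (0 <= dF_tilde P Q)%E.
  by apply: le_ereal_inf_tmp => _ [e [e0 _] <-]; rewrite lee_fin ltW.
have df : dF_tilde P Q \is a fin_num by rewrite ge0_fin_numE// (lt_trans hd)// ltry.
by have [_ [e he <-] et] := lb_ereal_inf_adherent t0 df; exists e.
Qed.

Lemma dF_ge0 (P Q : pointed_current_space R k) : (0 <= dF P Q)%E.
Proof.
rewrite /dF le_min; apply/andP; split; last by rewrite lee_fin invr_ge0.
by apply: le_ereal_inf_tmp => _ [e [e0 _] <-]; rewrite lee_fin ltW.
Qed.

End flat_bridge.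

Theorem proposition3p6 (R : realType) (k : nat) (hk : (1 <= k)%N)
    (X : nat -> pointed_current_space R k) (Z : pointed_current_space R k)
    (hXZ : dF (X n) Z @[n --> \oo] --> 0%E) :
  exists (Z' : pointed_current_space R k) (phi_ : forall n, X n -> Z'),
    [/\ forall n, isometric_embedding (phi_ n),
        phi_ n (pcs_base (X n)) @[n --> \oo] --> pcs_base Z',
        local_flat_cvg (fun n => push_functional (phi_ n) (pcs_current (X n)))
                       (pcs_current Z') &
        exists phi : Z -> Z',
          [/\ isometric_embedding phi, phi (pcs_base Z) = pcs_base Z' &
              eq_functional (push_functional phi (pcs_current Z))
                            (pcs_current Z')]].
Proof.
case: k hk X Z hXZ => [//|k] _ X Z hXZ.
pose good n := (dF (X n) Z < (2^-1)%:E)%E.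
have H n : exists (Y : completeMetricType R) (a : X n -> Y) (b : Z -> Y),
    [/\ separable Y, isometric_embedding a, isometric_embedding b &
      good n -> exists e, [/\ 0 < e, (e%:E < dF (X n) Z + (n.+1%:R^-1)%:E)%E &
        bridge_near a b e]].
  have [gn|ngn] := pselect (good n).
    have n0 : 0 < n.+1%:R^-1 :> R by rewrite invr_gt0.
    have [e ec et] := dF_close gn n0.
    have [Y [a [b [Ys ia ib ab]]]] := flat_bridge ec.
    exists Y, a, b; split => // _; exists e; split => //; by case: ec.
  have [Y [a [b [Ys ia ib]]]] := trivial_bridge (X n) Z.
  by exists Y, a, b.
pose Y n := sval (cid (H n)); pose H1 n := svalP (cid (H n)).
pose a n : X n -> Y n := sval (cid (H1 n)); pose H2 n := svalP (cid (H1 n)).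
pose b n : Z -> Y n := sval (cid (H2 n)).
have H3 n : [/\ separable (Y n), isometric_embedding (a n), isometric_embedding (b n) &
      good n -> exists e, [/\ 0 < e, (e%:E < dF (X n) Z + (n.+1%:R^-1)%:E)%E &
        bridge_near (a n) (b n) e]] by exact: svalP (cid (H2 n)).
have ia n : isometric_embedding (a n) by case: (H3 n).
have ib n : isometric_embedding (b n) by case: (H3 n).
have [W [iota [iiota bb cover]]] := gluing_exists ib.
have Ws : separable W.
  apply: separable_cover; rewrite (_ : [set: W] = \bigcup_n range (iota n)); last first.
    apply/seteqP; split => w // _; have [n [y <-]] := cover w.
    by exists n => //; exists y.
  apply: separable_set_bigcup => n; apply: separable_set_image; first by case: (H3 n).
  exact: iso_continuous.
pose phi := iota 0%N \o b 0%N; pose phi_ n := iota n \o a n.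
have iphi : isometric_embedding phi by move=> x y; rewrite /phi /= iiota ib.
have iphi_ n : isometric_embedding (phi_ n) by move=> x y; rewrite /phi_ /= iiota ia.
have phiE n : phi = iota n \o b n by apply/funext => z; exact: bb.
have IT : ILoc (push_functional phi (pcs_current Z)) by exact: ILoc_push (pcs_current_ILoc Z).
have IS n : ILoc (push_functional (phi_ n) (pcs_current (X n))).
  exact: ILoc_push (pcs_current_ILoc (X n)).
have smalle (t : R) : 0 < t -> \forall n \near \oo, good n /\
    (dF (X n) Z + (n.+1%:R^-1)%:E <= t%:E)%E.
  move=> t0; have /ge0_cvge0P := hXZ => /(_ (fun n => dF_ge0 _ _)) hX.
  have t20 : 0 < Num.min (t / 2) 4^-1 by rewrite lt_min divr_gt0// invr_gt0 ltr0n.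
  have n1 := hX _ t20.
  have n2 : \forall n \near \oo, n.+1%:R^-1 <= t / 2 :> R.
    apply: filterS (near_infty_natSinv_lt (PosNum (divr_gt0 t0 (ltr0Sn R 1)))) => n.
    exact: ltW.
  near=> n; split.
    apply: (@le_lt_trans _ _ (Num.min (t / 2) 4^-1)%:E); first by near: n.
    by rewrite lte_fin gt_min; apply/orP; right; lra.
  rewrite [t]splitr EFinD; apply: leeD; last by rewrite lee_fin; near: n.
  apply: (@le_trans _ _ (Num.min (t / 2) 4^-1)%:E); first by near: n.
  by rewrite lee_fin ge_min lexx.
exists (PointedCurrentSpace Ws (phi (pcs_base Z)) IT), phi_; split => //.
- apply/metricType_numDomainType.cvgrPdist_lt => t t0.
  move: (smalle t t0); apply: filterS => n [gn dn].
  have [_ _ _ /(_ gn)[e [_ ed [ab _]]]] := H3 n.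
  have et : e < t by rewrite -lte_fin (lt_le_trans ed).
  rewrite /= metric_sym (phiE n) /phi_ /= iiota; exact: lt_trans ab et.
- split => // B Bc Bb.
  have [r hr] := (mboundedP (phi (pcs_base Z)) _).1 Bb.
  have /choice[UV hUV] n : exists UV : functional W k.+1 * functional W k.+2,
      flat_decomposition (push_functional (phi_ n) (pcs_current (X n)))
        (push_functional phi (pcs_current Z)) UV.1 UV.2 /\
      (good n -> exists e, [/\ 0 < e, (e%:E < dF (X n) Z + (n.+1%:R^-1)%:E)%E &
        r + 1 <= e^-1 -> (mass UV.1 B + mass UV.2 B <= e%:E)%E]).
    have [gn|ngn] := pselect (good n); last first.
      (* The whole difference is put into [U]; this happens finitely often. *)
      exists (functionalB (push_functional (phi_ n) (pcs_current (X n)))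
        (push_functional phi (pcs_current Z)), functional0 (k := k.+2)) => /=.
      split => //; split; [exact: ILocB|exact: ILoc0|].
      by move=> f pi _; rewrite /boundary /functional0 addr0.
    have [_ _ _ /(_ gn)[e [e0 ed [_ [U [V [[IU IV UV] mUV]]]]]]] := H3 n.
    exists (push_functional (iota n) U, push_functional (iota n) V) => /=; split.
      split; [exact: ILoc_push|exact: ILoc_push|].
      move=> f pi [fB pl].
      have tf : test_form (f \o iota n) (fun i => pi i \o iota n).
        by split; [exact: iso_LipB|move=> i; exact: iso_LipLoc].
      have [[[mV _ _] _ _] _] := IV.
      rewrite -(boundary_push (iiota n) mV)//.
      by have := UV _ _ tf; rewrite (phiE n).
    move=> _; exists e; split => // re; apply: (le_trans _ (ltW mUV)).
    pose O := [set w : W | mdist (phi (pcs_base Z)) w < r + 1].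
    have BO : B `<=` O by move=> w /hr h; rewrite /O/= (le_lt_trans h)// ltrDl.
    have Oo : open O by exact: open_mball.
    have sub : iota n @^-1` O `<=` closed_nbhd e^-1 [set b n (pcs_base Z)].
      move=> y /= Oy; apply: (closed_nbhd_mdist _ (erefl : [set b n (pcs_base Z)] _)).
        by rewrite invr_gt0.
      rewrite metric_sym -(iiota n) -[iota n (b n _)]/((iota n \o b n) _) -phiE.
      by rewrite (le_trans (ltW Oy)).
    have bound m (S : functional (Y n) m) :
        (mass (push_functional (iota n) S) B <= mass S (closed_nbhd e^-1 [set b n (pcs_base Z)]))%E.
      apply: (le_trans (mass_mono _ BO)); apply: (le_trans (mass_push (iiota n) _ Oo)).
      exact: mass_mono.
    by apply: leeD; exact: bound.
  exists (fun n => (UV n).1), (fun n => (UV n).2); split; first by move=> n; case: (hUV n).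
  apply/ge0_cvge0P; first by move=> n; rewrite adde_ge0// mass_ge0.
  move=> t t0.
  (* For [e] below [t'] the ball of radius [1 / e] contains [B]. *)
  pose t' := Num.min t (`|r| + 1)^-1.
  have r0 : 0 < `|r| + 1 by rewrite ltr_wpDl.
  have t'0 : 0 < t' by rewrite lt_min t0 invr_gt0.
  move: (smalle t' t'0); apply: filterS => n [gn dn].
  have [_ /(_ gn)[e [e0 ed h]]] := hUV n.
  have et : e < t' by rewrite -lte_fin (lt_le_trans ed).
  apply: (le_trans (h _)); last by rewrite lee_fin ltW// (lt_le_trans et)// ge_min lexx.
  apply: (@le_trans _ _ (`|r| + 1)); first by rewrite lerD2r ler_norm.
  by rewrite -[leLHS]invrK lef_pV2 ?posrE ?invr_gt0// ltW// (lt_le_trans et)// ge_min lexx orbT.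
- by exists phi.
Unshelve. all: by end_near. Qed.
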